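(* Put $E_{2,4}^{(0)}(\tau)=\eta(\tau)^8\eta(2\tau)^{-4}$ and $E_{2,4}^{(1)}(\tau)=\Delta_4(\tau)=\eta(4\tau)^8\eta(2\tau)^{-4}$. The space $S_6(\Gamma_0(4))$ is one-dimensional and its unitary generator is $$F_{6,4}^{(1)}=E_{2,4}^{(0)}E_{2,4}^{(1)}\left[E_{2,4}^{(0)}+16E_{2,4}^{(1)}\right].$$ For every integer $k\ge3$ and every unitary upper triangular basis $\mathcal{B}_{2k-6}$ of $M_{2k-6}(\Gamma_0(4))$, the family $F_{6,4}^{(1)}\cdot\mathcal{B}_{2k-6}$ is a unitary upper triangular basis of $S_{2k}(\Gamma_0(4))$.
   Context: $\tau$ is in the upper half-plane, $q=e^{2i\pi\tau}$, and $\eta$ is Dedekind's eta function. $M_{2k}(\Gamma_0(N))$, $S_{2k}(\Gamma_0(N))$ are the spaces of modular and cusp forms of weight $2k$, with $M_0=\mathbb{C}$. The valuation of a nonzero form is its order in $q$ at $\infty$; a form is unitary if its leading $q$-coefficient is $1$; a family is unitary upper triangular if all members are unitary and their valuations are strictly increasing. $F\cdot(b_i)$ denotes $(Fb_i)$. *)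

(* Defs.v *)
From Stdlib Require Export Reals ZArith List.
From Coquelicot Require Export Coquelicot.
Export ListNotations.
Open Scope R_scope.

(** A function on the upper half-plane is represented by a total function
    [C -> C]; only its values on [upper] matter, and in particular equality of
    functions always means agreement on [upper]. *)

Definition upper (tau : C) : Prop := 0 < Im tau.

Definition eq_upper (f g : C -> C) : Prop :=
  forall tau, upper tau -> f tau = g tau.

Definition Cexp (z : C) : C := (exp (Re z) * cos (Im z), exp (Re z) * sin (Im z)).

(** [exp2ipi z] is e^(2 i pi z); the usual q is [exp2ipi tau]. *)
Definition exp2ipi (z : C) : C := Cexp (2 * PI * Ci * z)%C.

(** The limit of a convergent sequence of complex numbers. *)
Definition Climit (u : nat -> C) : C :=
  iota (T := C_CompleteNormedModule)
    (fun l => filterlim u eventually (locally l)).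

(** [Cprod u n] is the product of u 1, ..., u n. *)
Fixpoint Cprod (u : nat -> C) (n : nat) : C :=
  match n with
  | O => 1
  | S m => Cprod u m * u n
  end%C.

(** Dedekind's eta function, e^(2 i pi tau / 24) prod_{m >= 1} (1 - q^m). *)
Definition eta (tau : C) : C :=
  (exp2ipi (tau / 24) *
   Climit (Cprod (fun m => 1 - exp2ipi tau ^ m)))%C.

(** ** Modular forms *)

Record SL2Z : Set := mkSL2Z {
  ma : Z; mb : Z; mc : Z; md : Z;
  SL2Z_det : (ma * md - mb * mc = 1)%Z
}.

Definition Gamma0 (N : positive) (g : SL2Z) : Prop := (Z.pos N | mc g)%Z.

Definition mobius (g : SL2Z) (tau : C) : C :=
  ((IZR (ma g) * tau + IZR (mb g)) / (IZR (mc g) * tau + IZR (md g)))%C.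

Definition autfactor (g : SL2Z) (tau : C) : C :=
  (IZR (mc g) * tau + IZR (md g))%C.

(** The weight [w] slash action, (f | g) tau = (c tau + d)^(-w) f (g tau). *)
Definition slash (w : nat) (f : C -> C) (g : SL2Z) (tau : C) : C :=
  (f (mobius g tau) / autfactor g tau ^ w)%C.

Definition holomorphic_upper (f : C -> C) : Prop :=
  forall tau, upper tau -> ex_derive (K := C_AbsRing) (V := C_NormedModule) f tau.

(** f is the sum of the a_n e^(2 i pi n tau / h), n >= 0, on the upper
    half-plane. *)
Definition fourier_expansion (h : positive) (f : C -> C) (a : nat -> C) : Prop :=
  forall tau, upper tau ->
    is_pseries (K := C_AbsRing) (V := C_NormedModule)
      a (exp2ipi (tau / IZR (Z.pos h))%C) (f tau).

Definition weakly_modular (N : positive) (w : nat) (f : C -> C) : Prop :=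
  forall g, Gamma0 N g -> eq_upper (slash w f g) f.

(** For f weakly modular on Gamma0(N), every f | g with g in SL2(Z) is invariant
    under tau |-> tau + N.  As g varies this covers all the cusps. *)
Definition modular_form (N : positive) (w : nat) (f : C -> C) : Prop :=
  holomorphic_upper f /\
  weakly_modular N w f /\
  forall g : SL2Z, exists a, fourier_expansion N (slash w f g) a.

Definition cusp_form (N : positive) (w : nat) (f : C -> C) : Prop :=
  holomorphic_upper f /\
  weakly_modular N w f /\
  forall g : SL2Z, exists a, fourier_expansion N (slash w f g) a /\ a 0%nat = 0.

(** ** Valuations and unitary upper triangular families *)

(** The q-expansion of f at infinity is c q^v + O(q^(v+1)) with c <> 0. *)
Definition leading_term (f : C -> C) (v : nat) (c : C) : Prop :=
  exists a, fourier_expansion 1 f a /\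
    (forall n, (n < v)%nat -> a n = 0) /\ a v = c /\ c <> 0.

Definition valuation (f : C -> C) (v : nat) : Prop :=
  exists c, leading_term f v c.

Definition unitary (f : C -> C) : Prop :=
  exists v, leading_term f v 1.

(** Every unitary form has exactly one valuation, so the universal
    quantification over valuations is not vacuous. *)
Definition unitary_upper_triangular (B : list (C -> C)) : Prop :=
  List.Forall unitary B /\
  ForallOrdPairs
    (fun f g => forall v w, valuation f v -> valuation g w -> (v < w)%nat) B.

(** ** Bases of spaces of functions on the upper half-plane *)

Fixpoint lincomb (c : list C) (B : list (C -> C)) (tau : C) : C :=
  match c, B with
  | x :: c', b :: B' => x * b tau + lincomb c' B' tau
  | _, _ => 0
  end%C.

Definition is_basis (V : (C -> C) -> Prop) (B : list (C -> C)) : Prop :=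
  List.Forall V B /\
  (forall c, length c = length B ->
     eq_upper (lincomb c B) (fun _ => 0) -> List.Forall (fun x : C => x = 0) c) /\
  (forall f, V f ->
     exists c, length c = length B /\ eq_upper f (lincomb c B)).

Definition has_dimension (V : (C -> C) -> Prop) (n : nat) : Prop :=
  exists B, length B = n /\ is_basis V B.

Definition is_unitary_generator (V : (C -> C) -> Prop) (F : C -> C) : Prop :=
  is_basis V [F] /\ unitary F.

(** The family F . (b_i) = (F b_i). *)
Definition mul_family (F : C -> C) (B : list (C -> C)) : list (C -> C) :=
  map (fun b tau => F tau * b tau)%C B.

(** ** The forms at level 4 *)

Definition E24_0 (tau : C) : C := (eta tau ^ 8 / eta (2 * tau) ^ 4)%C.

Definition Delta4 (tau : C) : C := (eta (4 * tau) ^ 8 / eta (2 * tau) ^ 4)%C.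

Definition E24_1 : C -> C := Delta4.

Definition F64_1 (tau : C) : C :=
  (E24_0 tau * E24_1 tau * (E24_0 tau + 16 * E24_1 tau))%C.

(* Main.v *)
Require Import Defs.
From Stdlib Require Import Lra Lia.

(** Everything rests on F = eta(2 tau)^12, whose only zeros are simple zeros at the three cusps.

    The inversion formula for eta^4 comes from its logarithmic derivative, the Eisenstein series G2:
    subtracting 1/(z^2 - 1/4) from 1/z^2 makes the lattice sum absolutely convergent, and the two
    orders of summation then differ by the anomaly 2 pi i / tau.

    The identity behind F = eta(2 tau)^12 is Jacobi's theta_4^4 + theta_2^4 = theta_3^4.  Written with
    eta quotients, the difference of its two sides has weight 2 and the same sign character as eta^12,
    and vanishes at infinity; divided by eta^12 it has weight -4.  A form of negative weight, holomorphic
    at the cusps, is O(Im tau^l) with l > 0, so its Fourier coefficients vanish by Cauchy's estimate.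

    A cusp form is divisible by F at every cusp, hence S_2k = F M_(2k-6).  For h in M_0, with values
    c_1, c_2, c_3 at the cusps, (h - c_1)(h - c_2)(h - c_3) / F has weight -6, so h is constant. *)

(** * Series of complex numbers *)

(** Every analytic statement is carried by power series on the open unit disc: q runs through the
    punctured disc, so identities on the half-plane become identities of coefficients. Eta and its
    quotients enter through the logarithm [Lc] of the Euler product: exponentiating c times [Lc]
    gives any power, inverses included, as a series with constant term 1, and shows that eta has no
    zero.

    The two orders of summation of the lattice sum need the partial fractions of 1/sin^2 and cot.
    These come from iterating the duplication formulas: after n halvings the terms converge one by
    one under a summable bound.

    At level 4 a single form of negative weight is not stable under inversion, so the growth bound
    is proved for families: all quotients (p|g)/(F|g) share one bound for Im tau >= 1/2, because
    there are only three cusps.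

    The cusps infinity and 1/2 have width 1 and the cusp 0 has width 4, so in the common parameter
    q^(1/4) a cusp form vanishes there to order at least 4, 4 and 1. These are exactly the orders of
    F, which is why the quotient stays holomorphic. *)

Definition Clim (u : nat -> C) (l : C) : Prop :=
  forall eps, 0 < eps -> exists N, forall n, (N <= n)%nat -> Cmod (u n - l)%C < eps.

Lemma Clim_unique u l1 l2 : Clim u l1 -> Clim u l2 -> l1 = l2.
Proof.
  intros H1 H2.
  destruct (Req_dec (Cmod (l1 - l2)%C) 0) as [E|E].
  - apply Cmod_eq_0 in E.
    replace l1 with ((l1 - l2) + l2)%C by ring. rewrite E. ring.
  - assert (P : 0 < Cmod (l1 - l2)%C / 2) by (generalize (Cmod_ge_0 (l1 - l2)%C); lra).
    destruct (H1 _ P) as [N1 K1]. destruct (H2 _ P) as [N2 K2].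
    specialize (K1 (N1 + N2)%nat ltac:(lia)). specialize (K2 (N1 + N2)%nat ltac:(lia)).
    exfalso. set (x := u (N1 + N2)%nat) in *.
    generalize (Cmod_triangle (l1 - x)%C (x - l2)%C).
    replace (l1 - x + (x - l2))%C with (l1 - l2)%C by ring.
    replace (Cmod (l1 - x)%C) with (Cmod (x - l1)%C); [lra|].
    rewrite <- Cmod_opp. f_equal. ring.
Qed.

Lemma Clim_ext_loc u v l N0 :
  (forall n, (N0 <= n)%nat -> u n = v n) -> Clim u l -> Clim v l.
Proof.
  intros E H eps P. destruct (H _ P) as [N K]. exists (N0 + N)%nat. intros n Hn.
  rewrite <- E by lia. apply K. lia.
Qed.

Lemma Clim_ext u v l : (forall n, u n = v n) -> Clim u l -> Clim v l.
Proof. intros E. apply (Clim_ext_loc _ _ _ 0). intros; apply E. Qed.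

Lemma Clim_const c : Clim (fun _ => c) c.
Proof.
  intros eps P. exists 0%nat. intros n _. replace (c - c)%C with (RtoC 0) by ring.
  rewrite Cmod_0. exact P.
Qed.

Lemma Clim_dominated (u : nat -> C) (l : C) (v : nat -> R) :
  (forall n, Cmod (u n - l)%C <= v n) -> is_lim_seq v 0 -> Clim u l.
Proof.
  intros H L eps P. apply is_lim_seq_spec in L.
  destruct (L (mkposreal _ P)) as [N K]. exists N. intros n Hn.
  specialize (K n Hn). simpl in K. rewrite Rminus_0_r in K.
  apply Rle_lt_trans with (1 := H n). generalize (Rle_abs (v n)). lra.
Qed.

Lemma Clim_plus u v a b : Clim u a -> Clim v b -> Clim (fun n => u n + v n)%C (a + b)%C.
Proof.
  intros Hu Hv eps P. destruct (Hu (eps / 2) ltac:(lra)) as [N K].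
  destruct (Hv (eps / 2) ltac:(lra)) as [M L]. exists (N + M)%nat. intros n Hn.
  specialize (K n ltac:(lia)). specialize (L n ltac:(lia)).
  replace (u n + v n - (a + b))%C with ((u n - a) + (v n - b))%C by ring.
  generalize (Cmod_triangle (u n - a)%C (v n - b)%C). lra.
Qed.

Lemma Clim_bounded u a : Clim u a -> exists N, forall n, (N <= n)%nat -> Cmod (u n) <= Cmod a + 1.
Proof.
  intros H. destruct (H 1 Rlt_0_1) as [N K]. exists N. intros n Hn. specialize (K n Hn).
  generalize (Cmod_triangle (u n - a)%C a).
  replace (u n - a + a)%C with (u n) by ring. lra.
Qed.

Lemma Clim_mult u v a b : Clim u a -> Clim v b -> Clim (fun n => u n * v n)%C (a * b)%C.
Proof.
  intros Hu Hv eps P.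
  pose proof (Cmod_ge_0 a) as Pa. pose proof (Cmod_ge_0 b) as Pb.
  destruct (Clim_bounded _ _ Hv) as [N0 K0].
  assert (P1 : 0 < eps / 2 / (Cmod b + 1)) by (repeat apply Rdiv_lt_0_compat; lra).
  assert (P2 : 0 < eps / 2 / (Cmod a + 1)) by (repeat apply Rdiv_lt_0_compat; lra).
  destruct (Hu _ P1) as [N1 K1]. destruct (Hv _ P2) as [N2 K2].
  exists (N0 + N1 + N2)%nat. intros n Hn.
  specialize (K0 n ltac:(lia)). specialize (K1 n ltac:(lia)). specialize (K2 n ltac:(lia)).
  replace (u n * v n - a * b)%C with ((u n - a) * v n + a * (v n - b))%C by ring.
  apply Rle_lt_trans with (1 := Cmod_triangle _ _). rewrite !Cmod_mult.
  assert (A : Cmod (u n - a)%C * Cmod (v n) <= Cmod (u n - a)%C * (Cmod b + 1)).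
  { apply Rmult_le_compat_l; [apply Cmod_ge_0|exact K0]. }
  assert (B : Cmod (u n - a)%C * (Cmod b + 1) < eps / 2).
  { apply Rmult_lt_reg_r with (/ (Cmod b + 1)); [apply Rinv_0_lt_compat; lra|].
    rewrite Rmult_assoc, Rinv_r, Rmult_1_r by lra. exact K1. }
  assert (D : Cmod a * Cmod (v n - b)%C <= eps / 2).
  { apply Rle_trans with ((Cmod a + 1) * (eps / 2 / (Cmod a + 1))).
    - apply Rmult_le_compat; [lra|apply Cmod_ge_0|lra|lra].
    - right. field. lra. }
  lra.
Qed.

Lemma Clim_scal c u a : Clim u a -> Clim (fun n => c * u n)%C (c * a)%C.
Proof. intros H. apply (Clim_mult (fun _ => c) u); [apply Clim_const|exact H]. Qed.

Lemma Clim_opp u a : Clim u a -> Clim (fun n => - u n)%C (- a)%C.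
Proof.
  intros H. apply Clim_ext with (fun n => (- (1)) * u n)%C; [intros; ring|].
  replace (- a)%C with ((- (1)) * a)%C by ring. apply Clim_scal, H.
Qed.

Lemma Clim_minus u v a b : Clim u a -> Clim v b -> Clim (fun n => u n - v n)%C (a - b)%C.
Proof. intros Hu Hv. apply (Clim_plus _ _ _ _ Hu (Clim_opp _ _ Hv)). Qed.

Lemma Clim_le u a M : Clim u a -> (forall n, Cmod (u n) <= M) -> Cmod a <= M.
Proof.
  intros H B. apply Rnot_lt_le. intros L.
  destruct (H (Cmod a - M) ltac:(lra)) as [N K]. specialize (K N (le_n _)). specialize (B N).
  generalize (Cmod_triangle (u N) (- (u N - a))%C).
  replace (u N + - (u N - a))%C with a by ring. rewrite Cmod_opp. lra.
Qed.

Lemma Clim_inv u a : Clim u a -> a <> 0%C -> Clim (fun n => / u n)%C (/ a)%C.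
Proof.
  intros H Na eps P.
  assert (Pa : 0 < Cmod a) by (apply Cmod_gt_0; exact Na).
  assert (P1 : 0 < eps * (Cmod a * Cmod a) / 2).
  { apply Rdiv_lt_0_compat; [|lra]. repeat apply Rmult_lt_0_compat; lra. }
  destruct (H (Cmod a / 2) ltac:(lra)) as [N1 K1]. destruct (H _ P1) as [N2 K2].
  exists (N1 + N2)%nat. intros n Hn.
  specialize (K1 n ltac:(lia)). specialize (K2 n ltac:(lia)).
  assert (L : Cmod a / 2 < Cmod (u n)).
  { generalize (Cmod_triangle (u n) (- (u n - a))%C).
    replace (u n + - (u n - a))%C with a by ring. rewrite Cmod_opp. lra. }
  assert (Nu : u n <> 0%C) by (apply Cmod_gt_0; lra).
  replace (/ u n - / a)%C with (- ((u n - a) / (u n * a)))%C by (field; auto).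
  rewrite Cmod_opp, Cmod_div, Cmod_mult by (apply Cmult_neq_0; auto).
  apply Rmult_lt_reg_r with (Cmod (u n) * Cmod a); [apply Rmult_lt_0_compat; lra|].
  unfold Rdiv. rewrite Rmult_assoc, Rinv_l, Rmult_1_r
    by (apply Rgt_not_eq, Rmult_lt_0_compat; lra).
  apply Rlt_trans with (1 := K2).
  replace (eps * (Cmod a * Cmod a) / 2) with (eps * (Cmod a / 2 * Cmod a)) by field.
  apply Rmult_lt_compat_l; [exact P|]. apply Rmult_lt_compat_r; lra.
Qed.

Lemma Clim_incr u l N : Clim (fun n => u (N + n)%nat) l -> Clim u l.
Proof.
  intros H eps P. destruct (H _ P) as [M K]. exists (N + M)%nat. intros n Hn.
  replace n with (N + (n - N))%nat by lia. apply K. lia.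
Qed.

Lemma Clim_subseq u l (phi : nat -> nat) :
  Clim u l -> (forall n, (n <= phi n)%nat) -> Clim (fun n => u (phi n)) l.
Proof.
  intros H Hphi eps P. destruct (H _ P) as [M K]. exists M. intros n Hn.
  apply K. specialize (Hphi n). lia.
Qed.

Fixpoint csum (u : nat -> C) (n : nat) : C :=
  match n with O => 0%C | S m => (csum u m + u m)%C end.

Lemma csum_ext u v n : (forall k, (k < n)%nat -> u k = v k) -> csum u n = csum v n.
Proof.
  induction n as [|n IH]; intros H; [reflexivity|]. simpl.
  rewrite IH by (intros; apply H; lia). rewrite H by lia. reflexivity.
Qed.

Lemma csum_plus u v n : csum (fun k => u k + v k)%C n = (csum u n + csum v n)%C.
Proof. induction n as [|n IH]; simpl; [ring|rewrite IH; ring]. Qed.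

Lemma csum_scal c u n : csum (fun k => c * u k)%C n = (c * csum u n)%C.
Proof. induction n as [|n IH]; simpl; [ring|rewrite IH; ring]. Qed.

Lemma csum_add u n m : csum u (n + m) = (csum u n + csum (fun k => u (n + k)%nat) m)%C.
Proof.
  induction m as [|m IH]; simpl.
  - rewrite Nat.add_0_r. ring.
  - rewrite Nat.add_succ_r. simpl. rewrite IH. ring.
Qed.

Lemma csum_shift u n : csum u (S n) = (u 0%nat + csum (fun k => u (S k)) n)%C.
Proof. change (S n) with (1 + n)%nat. rewrite csum_add. simpl. ring. Qed.

Lemma csum_rev u n : csum u n = csum (fun k => u (n - 1 - k)%nat) n.
Proof.
  induction n as [|n IH]; [reflexivity|].
  rewrite (csum_shift (fun k => u (S n - 1 - k)%nat)). simpl csum at 1. rewrite IH.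
  replace (S n - 1 - 0)%nat with n by lia. rewrite Cplus_comm. f_equal.
  apply csum_ext. intros k Hk. f_equal. lia.
Qed.

Lemma csum_zero n : csum (fun _ => 0%C) n = 0%C.
Proof. induction n as [|n IH]; simpl; [reflexivity|rewrite IH; ring]. Qed.

Fixpoint rsum (u : nat -> R) (n : nat) : R :=
  match n with O => 0 | S m => rsum u m + u m end.

Lemma Cmod_csum u n : Cmod (csum u n) <= rsum (fun k => Cmod (u k)) n.
Proof.
  induction n as [|n IH]; simpl; [rewrite Cmod_0; lra|].
  generalize (Cmod_triangle (csum u n) (u n)). lra.
Qed.

Lemma rsum_le u v n : (forall k, (k < n)%nat -> u k <= v k) -> rsum u n <= rsum v n.
Proof.
  induction n as [|n IH]; intros H; simpl; [lra|].
  specialize (IH ltac:(intros; apply H; lia)). specialize (H n ltac:(lia)). lra.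
Qed.

Lemma sum_n_rsum (u : nat -> R) n : sum_n u n = rsum u (S n).
Proof.
  induction n as [|n IH].
  - rewrite sum_O. simpl. ring.
  - rewrite sum_Sn, IH. reflexivity.
Qed.

Lemma rsum_pos u n : (forall k, 0 <= u k) -> 0 <= rsum u n.
Proof. intros H; induction n as [|n IH]; simpl; [lra|specialize (H n); lra]. Qed.

Lemma rsum_Series_le u n : (forall k, 0 <= u k) -> ex_series u -> rsum u n <= Series u.
Proof.
  intros Hp Hs. apply Rle_trans with (rsum u (S n)); [simpl; specialize (Hp n); lra|].
  apply Series_correct in Hs.
  assert (L : is_lim_seq (sum_n u) (Series u)) by exact Hs.
  rewrite <- sum_n_rsum.
  apply (is_lim_seq_incr_compare (sum_n u) (Series u) L).
  intros k. rewrite sum_Sn. specialize (Hp (S k)). unfold plus; simpl. lra.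
Qed.

Lemma ex_series_rsum_bound u M :
  (forall k, 0 <= u k) -> (forall n, rsum u n <= M) -> ex_series u.
Proof.
  intros Hp HM. destruct (ex_finite_lim_seq_incr (sum_n u) M) as [l Hl].
  - intros n. rewrite sum_Sn. specialize (Hp (S n)). unfold plus; simpl. lra.
  - intros n. rewrite sum_n_rsum. apply HM.
  - exists l. exact Hl.
Qed.

Lemma Series_le_bound u M :
  (forall k, 0 <= u k) -> (forall n, rsum u n <= M) -> Series u <= M.
Proof.
  intros Hp HM. assert (H := ex_series_rsum_bound u M Hp HM).
  apply Series_correct in H.
  assert (L : is_lim_seq (sum_n u) (Series u)) by exact H.
  change (Rbar_le (Series u) M).
  apply (is_lim_seq_le (sum_n u) (fun _ => M) _ _); [|exact L|apply is_lim_seq_const].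
  intros n. rewrite sum_n_rsum. apply HM.
Qed.

Lemma Series_pos u : (forall k, 0 <= u k) -> ex_series u -> 0 <= Series u.
Proof. intros H E. apply Rle_trans with (rsum u 0); [simpl; lra|]. now apply rsum_Series_le. Qed.

Lemma ex_series_Rscal c (u : nat -> R) : ex_series u -> ex_series (fun n => c * u n).
Proof. exact (ex_series_scal (K := R_AbsRing) (V := R_NormedModule) c u). Qed.

Lemma Series_tail_small (s : nat -> R) :
  ex_series s -> forall eps, 0 < eps -> exists K, Series (fun k => s (K + k)%nat) < eps.
Proof.
  intros Hs eps P. pose proof (Series_correct _ Hs) as H.
  assert (L : is_lim_seq (sum_n s) (Series s)) by exact H.
  apply is_lim_seq_spec in L. destruct (L (mkposreal _ P)) as [N K].
  specialize (K N (le_n _)). simpl in K. exists (S N).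
  rewrite (Series_incr_n s (S N)) in K; [|lia|exact Hs].
  rewrite sum_n_Reals in K. simpl pred in K.
  apply Rabs_lt_between in K. lra.
Qed.

(** * Absolutely convergent complex series *)

Definition asum (u : nat -> C) : Prop := ex_series (fun n => Cmod (u n)).

(** Total, like the real [Series] of its two components; [Clim_csum] identifies it with the limit of
    the partial sums when the terms are absolutely summable. *)
Definition CSeries (u : nat -> C) : C :=
  (Series (fun n => Re (u n)), Series (fun n => Im (u n))).

Lemma im_le_Cmod c : Rabs (Im c) <= Cmod c.
Proof. apply Rle_trans with (2 := Rmax_Cmod c). apply Rmax_r. Qed.

Lemma Cmod_le_re_im (c : C) : Cmod c <= Rabs (Re c) + Rabs (Im c).
Proof.
  replace c with (RtoC (Re c) + Ci * RtoC (Im c))%C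
    by (destruct c as [a b]; unfold Re, Im, RtoC, Ci, Cplus, Cmult; simpl; f_equal; ring).
  eapply Rle_trans; [apply Cmod_triangle|].
  rewrite Cmod_mult, Cmod_Ci, !Cmod_R, Rmult_1_l.
  destruct c as [a b]; unfold Re, Im; simpl.
  replace (a + (0 * b - 1 * 0)) with a by ring.
  replace (0 + (0 * 0 + 1 * b)) with b by ring. lra.
Qed.

Lemma asum_le u (v : nat -> R) : (forall n, Cmod (u n) <= v n) -> ex_series v -> asum u.
Proof.
  intros H E. apply (ex_series_le (K := R_AbsRing) (V := R_CompleteNormedModule)
    (fun n => Cmod (u n)) v); [|exact E].
  intros n. change (Rabs (Cmod (u n)) <= v n).
  rewrite Rabs_pos_eq by apply Cmod_ge_0. apply H.
Qed.

Lemma asum_re u : asum u -> ex_series (fun n => Re (u n)).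
Proof.
  intros H. apply (ex_series_le (K := R_AbsRing) (V := R_CompleteNormedModule) _ (fun n => Cmod (u n))); [|exact H].
  intros n. apply re_le_Cmod.
Qed.

Lemma asum_im u : asum u -> ex_series (fun n => Im (u n)).
Proof.
  intros H. apply (ex_series_le (K := R_AbsRing) (V := R_CompleteNormedModule) _ (fun n => Cmod (u n))); [|exact H].
  intros n. apply im_le_Cmod.
Qed.

Lemma csum_re_im u n : csum u n = (rsum (fun k => Re (u k)) n, rsum (fun k => Im (u k)) n).
Proof. induction n as [|n IH]; simpl; [reflexivity|rewrite IH; reflexivity]. Qed.

Lemma is_series_rsum (u : nat -> R) l : is_series u l -> is_lim_seq (rsum u) l.
Proof.
  intros H. apply is_lim_seq_incr_1.
  apply is_lim_seq_ext with (sum_n u); [intros; apply sum_n_rsum|exact H].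
Qed.

Lemma Clim_csum u : asum u -> Clim (csum u) (CSeries u).
Proof.
  intros H.
  assert (H1 := is_series_rsum _ _ (Series_correct _ (asum_re _ H))).
  assert (H2 := is_series_rsum _ _ (Series_correct _ (asum_im _ H))).
  apply is_lim_seq_spec in H1. apply is_lim_seq_spec in H2.
  intros eps P.
  destruct (H1 (mkposreal (eps / 2) ltac:(lra))) as [N K].
  destruct (H2 (mkposreal (eps / 2) ltac:(lra))) as [M L].
  exists (N + M)%nat. intros n Hn.
  specialize (K n ltac:(lia)). specialize (L n ltac:(lia)). simpl in K, L.
  apply Rle_lt_trans with (1 := Cmod_le_re_im _).
  rewrite csum_re_im. unfold CSeries, Re, Im in *. simpl. unfold Rminus in *. lra.
Qed.

Lemma CSeries_eq u l : asum u -> Clim (csum u) l -> CSeries u = l.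
Proof. intros H L. apply (Clim_unique (csum u)); [apply Clim_csum, H|exact L]. Qed.

Lemma CSeries_ext u v : (forall n, u n = v n) -> CSeries u = CSeries v.
Proof. intros H. unfold CSeries. f_equal; apply Series_ext; intros; now rewrite H. Qed.

Lemma asum_ext u v : (forall n, u n = v n) -> asum u -> asum v.
Proof. intros H. apply ex_series_ext. intros; now rewrite H. Qed.

Lemma asum_plus u v : asum u -> asum v -> asum (fun n => u n + v n)%C.
Proof.
  intros Hu Hv. apply asum_le with (fun n => Cmod (u n) + Cmod (v n)).
  - intros; apply Cmod_triangle.
  - apply (ex_series_plus (K := R_AbsRing) (V := R_NormedModule)); assumption.
Qed.

Lemma asum_scal c u : asum u -> asum (fun n => c * u n)%C.
Proof.
  intros Hu. apply ex_series_ext with (fun n => Cmod c * Cmod (u n)).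
  - intros; symmetry; apply Cmod_mult.
  - apply ex_series_Rscal. exact Hu.
Qed.

Lemma asum_opp u : asum u -> asum (fun n => - u n)%C.
Proof.
  intros H. apply ex_series_ext with (2 := H). intros; symmetry; apply Cmod_opp.
Qed.

Lemma asum_minus u v : asum u -> asum v -> asum (fun n => u n - v n)%C.
Proof. intros Hu Hv. apply (asum_plus _ _ Hu (asum_opp _ Hv)). Qed.

Lemma CSeries_plus u v : asum u -> asum v ->
  CSeries (fun n => u n + v n)%C = (CSeries u + CSeries v)%C.
Proof.
  intros Hu Hv. apply CSeries_eq; [now apply asum_plus|].
  apply Clim_ext with (fun n => csum u n + csum v n)%C.
  - intros; symmetry; apply csum_plus.
  - apply Clim_plus; now apply Clim_csum.
Qed.

Lemma CSeries_scal c u : asum u -> CSeries (fun n => c * u n)%C = (c * CSeries u)%C.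
Proof.
  intros Hu. apply CSeries_eq; [now apply asum_scal|].
  apply Clim_ext with (fun n => c * csum u n)%C.
  - intros; symmetry; apply csum_scal.
  - apply Clim_scal; now apply Clim_csum.
Qed.

Lemma CSeries_opp u : asum u -> CSeries (fun n => - u n)%C = (- CSeries u)%C.
Proof.
  intros H. rewrite (CSeries_ext _ (fun n => (- (1)) * u n)%C) by (intros; ring).
  rewrite CSeries_scal by exact H. ring.
Qed.

Lemma CSeries_minus u v : asum u -> asum v ->
  CSeries (fun n => u n - v n)%C = (CSeries u - CSeries v)%C.
Proof.
  intros Hu Hv. unfold Cminus. rewrite (CSeries_plus _ _ Hu (asum_opp _ Hv)).
  now rewrite CSeries_opp.
Qed.

Lemma asum_incr u N : asum u -> asum (fun n => u (N + n)%nat).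
Proof. intros H. apply (ex_series_incr_n (fun n => Cmod (u n)) N), H. Qed.

Lemma asum_decr u N : asum (fun n => u (N + n)%nat) -> asum u.
Proof. intros H. apply (ex_series_incr_n (fun n => Cmod (u n)) N), H. Qed.

Lemma CSeries_incr u N : asum u ->
  CSeries u = (csum u N + CSeries (fun n => u (N + n)%nat))%C.
Proof.
  intros H. apply CSeries_eq; [exact H|].
  apply Clim_incr with N.
  apply Clim_ext with (fun n => csum u N + csum (fun k => u (N + k)%nat) n)%C.
  - intros; symmetry; apply csum_add.
  - apply Clim_plus; [apply Clim_const|]. apply Clim_csum, asum_incr, H.
Qed.

Lemma CSeries_shift u : asum u -> CSeries u = (u 0%nat + CSeries (fun n => u (S n)))%C.
Proof. intros H. rewrite (CSeries_incr u 1 H). simpl. f_equal. ring. Qed.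

Lemma Cmod_CSeries_le u (s : nat -> R) :
  (forall n, Cmod (u n) <= s n) -> ex_series s -> Cmod (CSeries u) <= Series s.
Proof.
  intros H E. assert (A := asum_le _ _ H E).
  apply (Clim_le _ _ _ (Clim_csum _ A)). intros n.
  apply Rle_trans with (1 := Cmod_csum _ _).
  apply Rle_trans with (rsum s n); [apply rsum_le; auto|].
  apply rsum_Series_le; [|exact E].
  intros k. apply Rle_trans with (2 := H k), Cmod_ge_0.
Qed.

Lemma Cmod_CSeries u : asum u -> Cmod (CSeries u) <= Series (fun n => Cmod (u n)).
Proof. intros H. apply Cmod_CSeries_le; [intros; lra|exact H]. Qed.

Lemma is_series_R0 : is_series (fun _ : nat => 0) 0.
Proof.
  change (is_lim_seq (sum_n (fun _ : nat => 0)) 0).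
  apply is_lim_seq_ext with (fun _ => 0); [|apply is_lim_seq_const].
  intros n. rewrite sum_n_const. ring.
Qed.

Lemma CSeries_zero : CSeries (fun _ => 0%C) = 0%C.
Proof.
  apply CSeries_eq.
  - apply ex_series_ext with (fun _ => 0); [intros; now rewrite Cmod_0|].
    exists 0. exact is_series_R0.
  - apply Clim_ext with (fun _ => 0%C); [intros; symmetry; apply csum_zero|apply Clim_const].
Qed.

Lemma Clim_csum_bounded (f : nat -> nat -> C) g K :
  (forall k, Clim (fun N => f N k) (g k)) -> Clim (fun N => csum (f N) K) (csum g K).
Proof.
  intros H. induction K as [|K IH]; simpl; [apply Clim_const|].
  apply Clim_plus; [exact IH|apply H].
Qed.

(** Dominated convergence for series: beyond some K the dominating tail is below eps/3 for all
    indices at once, and the finite head converges term by term. The bound is asked only from [N0]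
    on because the halving estimates hold only for large n. *)
Lemma Tannery (f : nat -> nat -> C) (g : nat -> C) (s : nat -> R) (N0 : nat) :
  ex_series s ->
  (forall N k, (N0 <= N)%nat -> Cmod (f N k) <= s k) ->
  (forall k, Clim (fun N => f N k) (g k)) ->
  asum g /\ Clim (fun N => CSeries (f N)) (CSeries g).
Proof.
  intros Es Hb Hl.
  assert (Hg : forall k, Cmod (g k) <= s k).
  { intros k. apply (Clim_le (fun n => f (N0 + n)%nat k)).
    - intros eps P. destruct (Hl k eps P) as [M K]. exists M. intros n Hn. apply K. lia.
    - intros n. apply Hb. lia. }
  assert (Ag := asum_le _ _ Hg Es).
  split; [exact Ag|]. intros eps P.
  destruct (Series_tail_small s Es (eps / 3) ltac:(lra)) as [K HK].
  destruct (Clim_csum_bounded f g K Hl (eps / 3) ltac:(lra)) as [N1 H1].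
  exists (N0 + N1)%nat. intros N HN.
  specialize (H1 N ltac:(lia)).
  assert (Af : asum (f N)) by (apply asum_le with s; [intros; apply Hb; lia|exact Es]).
  assert (Et : ex_series (fun k => s (K + k)%nat)) by (apply (ex_series_incr_n s K), Es).
  rewrite (CSeries_incr (f N) K Af), (CSeries_incr g K Ag).
  assert (B1 := Cmod_CSeries_le (fun n => f N (K + n)%nat) _ (fun n => Hb N (K + n)%nat ltac:(lia)) Et).
  assert (B2 := Cmod_CSeries_le (fun n => g (K + n)%nat) _ (fun n => Hg (K + n)%nat) Et).
  set (a := CSeries (fun n => f N (K + n)%nat)) in *.
  set (b := CSeries (fun n => g (K + n)%nat)) in *.
  replace (csum (f N) K + a - (csum g K + b))%C with ((csum (f N) K - csum g K) + (a - b))%C by ring.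
  generalize (Cmod_triangle (csum (f N) K - csum g K)%C (a - b)%C).
  generalize (Cmod_triangle a (- b)%C). rewrite Cmod_opp. fold (Cminus a b). lra.
Qed.

(** * Double series *)

Definition asum2 (f : nat -> nat -> C) : Prop :=
  (forall m, asum (f m)) /\ ex_series (fun m => Series (fun n => Cmod (f m n))).

Lemma asum_row u n : asum u -> Cmod (u n) <= Series (fun k => Cmod (u k)).
Proof.
  intros H. apply Rle_trans with (rsum (fun k => Cmod (u k)) (S n)).
  - simpl. generalize (rsum_pos (fun k => Cmod (u k)) n (fun k => Cmod_ge_0 _)). lra.
  - apply rsum_Series_le; [intros; apply Cmod_ge_0|exact H].
Qed.

Lemma asum2_column f n : asum2 f -> asum (fun m => f m n).
Proof.
  intros [H1 H2]. apply asum_le with (2 := H2). intros m. apply (asum_row (f m)), H1.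
Qed.

Lemma asum2_rows f : asum2 f -> asum (fun m => CSeries (f m)).
Proof.
  intros [H1 H2]. apply asum_le with (2 := H2). intros m. apply Cmod_CSeries, H1.
Qed.

Lemma rsum_Series_swap (f : nat -> nat -> C) N :
  (forall n, asum (fun m => f m n)) ->
  is_series (fun m => rsum (fun n => Cmod (f m n)) N)
    (rsum (fun n => Series (fun m => Cmod (f m n))) N).
Proof.
  intros H. induction N as [|N IH]; simpl.
  - exact is_series_R0.
  - apply (is_series_plus (K := R_AbsRing) (V := R_NormedModule)); [exact IH|].
    apply Series_correct, H.
Qed.

Lemma asum2_swap f : asum2 f -> asum2 (fun n m => f m n).
Proof.
  intros H. pose proof H as [H1 H2]. split; [intros n; apply asum2_column, H|].
  apply ex_series_rsum_bound with (Series (fun m => Series (fun n => Cmod (f m n)))).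
  - intros n. apply Series_pos; [intros; apply Cmod_ge_0|apply (asum2_column _ n H)].
  - intros N. pose proof (rsum_Series_swap f N (fun n => asum2_column f n H)) as S.
    rewrite <- (is_series_unique _ _ S).
    apply Series_le; [|exact H2].
    intros m. split; [apply rsum_pos; intros; apply Cmod_ge_0|].
    apply rsum_Series_le; [intros; apply Cmod_ge_0|apply H1].
Qed.

Lemma CSeries_csum (f : nat -> nat -> C) N :
  (forall n, asum (fun m => f m n)) ->
  asum (fun m => csum (f m) N) /\
  CSeries (fun m => csum (f m) N) = csum (fun n => CSeries (fun m => f m n)) N.
Proof.
  intros H. induction N as [|N [IH1 IH2]]; simpl.
  - split; [|apply CSeries_zero].
    apply asum_le with (fun _ => 0); [intros; rewrite Cmod_0; lra|].
    exists 0. exact is_series_R0.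
  - split; [now apply asum_plus|]. rewrite CSeries_plus by auto. now rewrite IH2.
Qed.

(** The sums over m of the partial rows of length N equal the partial sums of the column series;
    [Tannery] lets N tend to infinity, the absolute row sums being the dominating sequence. *)
Lemma CSeries_swap f : asum2 f ->
  CSeries (fun m => CSeries (f m)) = CSeries (fun n => CSeries (fun m => f m n)).
Proof.
  intros H. pose proof H as [H1 H2].
  symmetry. apply CSeries_eq; [apply (asum2_rows _ (asum2_swap _ H))|].
  apply Clim_ext with (fun N => CSeries (fun m => csum (f m) N)).
  - intros N. apply CSeries_csum. intros n; apply asum2_column, H.
  - refine (proj2 (Tannery (fun N m => csum (f m) N) _ _ 0 H2 _ _)).
    + intros N m _. apply Rle_trans with (1 := Cmod_csum _ _).
      apply rsum_Series_le; [intros; apply Cmod_ge_0|apply H1].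
    + intros m. apply Clim_csum, H1.
Qed.

Lemma asum2_product_bound f (u v : nat -> R) :
  (forall m n, Cmod (f m n) <= u m * v n) ->
  (forall m, 0 <= u m) -> ex_series u -> ex_series v -> asum2 f.
Proof.
  intros H Pu Eu Ev.
  assert (R1 : forall m, ex_series (fun n => u m * v n)).
  { intros m. apply ex_series_Rscal, Ev. }
  split.
  - intros m. apply asum_le with (2 := R1 m). intros n. apply H.
  - apply (ex_series_le (K := R_AbsRing) (V := R_CompleteNormedModule) _
      (fun m => u m * Series v)).
    + intros m. change (Rabs (Series (fun n => Cmod (f m n))) <= u m * Series v).
      assert (A : asum (f m)) by (apply asum_le with (2 := R1 m); apply H).
      rewrite Rabs_pos_eq by (apply Series_pos; [intros; apply Cmod_ge_0|exact A]).
      rewrite <- Series_scal_l. apply Series_le; [|apply R1].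
      intros n. split; [apply Cmod_ge_0|apply H].
    + destruct Eu as [l Hl]. exists (l * Series v).
      apply (is_series_ext (fun m => scal (Series v) (u m))).
      * intros n; apply Rmult_comm.
      * replace (l * Series v) with (scal (Series v) l) by apply Rmult_comm.
        apply (is_series_scal (K := R_AbsRing) (V := R_NormedModule)), Hl.
Qed.

Lemma sum_n_csum (u : nat -> C) n :
  sum_n (G := C_AbelianMonoid) u n = csum u (S n).
Proof.
  induction n as [|n IH].
  - rewrite sum_O. simpl. ring.
  - rewrite sum_Sn, IH. reflexivity.
Qed.

Lemma filterlim_Clim (u : nat -> C) (l : C) :
  filterlim u eventually (locally (T := C_UniformSpace) l) <-> Clim u l.
Proof.
  split.
  - intros H eps P.
    assert (L : locally (T := C_UniformSpace) l (fun y => Cmod (y - l)%C < eps)).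
    { apply locally_C. exists (mkposreal _ P). intros y Hy. exact Hy. }
    destruct (H _ L) as [N K]. exists N. exact K.
  - intros H Q HQ. apply locally_C in HQ. destruct HQ as [[eps P] HQ].
    destruct (H _ P) as [N K]. exists N. intros n Hn. apply HQ. apply K, Hn.
Qed.

Lemma is_series_Clim (u : nat -> C) (l : C) :
  is_series (K := C_AbsRing) (V := C_NormedModule) u l <-> Clim (csum u) l.
Proof.
  unfold is_series. etransitivity; [apply filterlim_Clim|]. split.
  - intros H. apply (Clim_incr _ _ 1).
    apply Clim_ext with (2 := H). intros n. apply sum_n_csum.
  - intros H. apply Clim_ext with (fun n => csum u (S n)).
    + intros n. symmetry. apply sum_n_csum.
    + apply (Clim_subseq (csum u) l S H). intros; lia.
Qed.

Lemma Climit_eq (u : nat -> C) (l : C) : Clim u l -> Climit u = l.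
Proof.
  intros H. apply (Clim_unique u); [|exact H].
  apply filterlim_Clim.
  apply (iota_correct (V := C_CompleteNormedModule) (fun l => filterlim u eventually (locally (T := C_UniformSpace) l))).
  exists l. split; [apply filterlim_Clim, H|].
  intros y Hy. apply (Clim_unique u); [exact H|apply filterlim_Clim, Hy].
Qed.

(** * The complex exponential *)

Lemma Cexp_plus x y : Cexp (x + y)%C = (Cexp x * Cexp y)%C.
Proof.
  destruct x as [a b], y as [c d]. unfold Cexp, Re, Im, Cmult, Cplus; simpl.
  rewrite exp_plus, cos_plus, sin_plus. f_equal; ring.
Qed.

Lemma Cexp_0 : Cexp 0%C = 1%C.
Proof. unfold Cexp, Re, Im, RtoC; simpl. rewrite exp_0, cos_0, sin_0. f_equal; ring. Qed.

Lemma Cexp_neq_0 (x : C) : Cexp x <> 0%C.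
Proof.
  intros H. assert (E : Cexp (x + - x)%C = 1%C) by (rewrite <- Cexp_0; f_equal; ring).
  rewrite Cexp_plus, H in E. apply C1_nz. rewrite <- E. ring.
Qed.

Lemma Cexp_opp x : Cexp (- x)%C = (/ Cexp x)%C.
Proof.
  assert (H : (Cexp (- x) * Cexp x)%C = 1%C).
  { rewrite <- Cexp_plus, <- Cexp_0. f_equal. ring. }
  replace (Cexp (- x)) with (Cexp (- x) * Cexp x * / Cexp x)%C
    by (field; apply Cexp_neq_0).
  rewrite H. ring.
Qed.

Lemma Cexp_minus x y : Cexp (x - y)%C = (Cexp x / Cexp y)%C.
Proof. unfold Cminus. now rewrite Cexp_plus, Cexp_opp. Qed.

Lemma RtoC_INR_S n : RtoC (INR (S n)) = (RtoC (INR n) + 1)%C.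
Proof. rewrite S_INR, RtoC_plus. reflexivity. Qed.

Lemma Cexp_pow n x : Cexp (INR n * x)%C = (Cexp x ^ n)%C.
Proof.
  induction n as [|n IH].
  - simpl. rewrite <- Cexp_0. f_equal. ring.
  - rewrite RtoC_INR_S. replace ((INR n + 1) * x)%C with (INR n * x + x)%C by ring.
    rewrite Cexp_plus, IH, Cpow_S. ring.
Qed.

Lemma Cmod_Cexp x : Cmod (Cexp x) = exp (Re x).
Proof.
  destruct x as [a b]. unfold Cexp, Cmod, Re, Im. simpl.
  replace (exp a * cos b * (exp a * cos b * 1) + exp a * sin b * (exp a * sin b * 1))
    with (exp a * exp a * (Rsqr (sin b) + Rsqr (cos b))) by (unfold Rsqr; ring).
  rewrite sin2_cos2, Rmult_1_r. apply sqrt_square. left. apply exp_pos.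
Qed.

Lemma Cexp_2PIi_Z (k : Z) : Cexp (2 * PI * Ci * IZR k)%C = 1%C.
Proof.
  assert (Hn : forall n, Cexp (2 * PI * Ci * INR n)%C = 1%C).
  { intros n. replace (2 * PI * Ci * INR n)%C with (INR n * (2 * PI * Ci))%C by ring.
    rewrite Cexp_pow. replace (Cexp (2 * PI * Ci)%C) with (RtoC 1); [apply Cpow_1_l|].
    unfold Cexp, Ci, Cmult, Re, Im, RtoC; simpl.
    replace ((2 * PI - 0 * 0) * 0 - (2 * 0 + 0 * PI) * 1) with 0 by ring.
    replace ((2 * PI - 0 * 0) * 1 + (2 * 0 + 0 * PI) * 0) with (2 * PI) by ring.
    rewrite exp_0, cos_2PI, sin_2PI. f_equal; ring. }
  destruct (Z_le_gt_dec 0 k) as [H|H].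
  - rewrite <- (Z2Nat.id k H), <- INR_IZR_INZ. apply Hn.
  - replace (IZR k) with (- IZR (- k)) by (rewrite opp_IZR; ring).
    rewrite <- (Z2Nat.id (- k)%Z) by lia. rewrite <- INR_IZR_INZ.
    rewrite RtoC_opp. replace (2 * PI * Ci * - INR (Z.to_nat (- k)))%C
      with (- (2 * PI * Ci * INR (Z.to_nat (- k))))%C by ring.
    rewrite Cexp_opp, Hn. field.
Qed.

(** * Complex derivatives *)

Definition Cderive (f : C -> C) (z l : C) : Prop :=
  is_derive (K := C_AbsRing) (V := C_NormedModule) f z l.

Lemma Cderive_eps (f : C -> C) (z l : C) :
  Cderive f z l <->
  (forall eps, 0 < eps -> exists delta, 0 < delta /\
     forall h, Cmod h < delta -> Cmod (f (z + h) - f z - h * l)%C <= eps * Cmod h).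
Proof.
  split.
  - intros [_ H] eps P.
    specialize (H z (fun P HP => HP) (mkposreal _ P)).
    destruct H as [[d Pd] H]. exists d. split; [exact Pd|].
    intros h Hh. specialize (H (z + h)%C).
    assert (B : ball (M := AbsRing_UniformSpace C_AbsRing) z (mkposreal d Pd) (z + h)%C).
    { change (Cmod (z + h - z)%C < d). replace (z + h - z)%C with h by ring. exact Hh. }
    specialize (H B).
    change (Cmod ((f (z + h) - f z) - (z + h - z) * l)%C
            <= eps * Cmod (z + h - z)%C) in H. replace (z + h - z)%C with h in H by ring. exact H.
  - intros H. split; [apply is_linear_scal_l|].
    intros x Hx [eps P].
    assert (Ex : z = x).
    { apply (is_filter_lim_locally_unique (K := C_AbsRing) (V := AbsRing_NormedModule C_AbsRing)), Hx. }
    subst x. destruct (H eps P) as [d [Pd K]]. exists (mkposreal _ Pd).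
    intros y' Hy. set (y := y' : C). change y' with y. change (Cmod (y - z)%C < d) in Hy. specialize (K _ Hy). clearbody y.
    replace (z + (y - z))%C with y in K by ring.
    exact K.
Qed.


(** [C] is a normed module over itself in two ways, with the same operations and norm. The product,
    identity and chain rules speak of [AbsRing_NormedModule C_AbsRing], while [holomorphic_upper]
    uses [C_NormedModule]. *)
Lemma Cderive_AbsRing f z l :
  Cderive f z l <-> is_derive (K := C_AbsRing) (V := AbsRing_NormedModule C_AbsRing) f z l.
Proof.
  split; intros [[Lp Ls Ln] H]; (split; [split; [exact Lp|exact Ls|exact Ln]|exact H]).
Qed.

Lemma Cderive_const c z : Cderive (fun _ => c) z 0%C.
Proof. exact (is_derive_const (K := C_AbsRing) (V := C_NormedModule) c z). Qed.

Lemma Cderive_id z : Cderive (fun x => x) z 1%C.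
Proof. apply Cderive_AbsRing. exact (is_derive_id (K := C_AbsRing) z). Qed.

Lemma Cderive_plus f g z a b :
  Cderive f z a -> Cderive g z b -> Cderive (fun x => f x + g x)%C z (a + b)%C.
Proof. exact (is_derive_plus (K := C_AbsRing) (V := C_NormedModule) f g z a b). Qed.

Lemma Cderive_continuous_bound f z l : Cderive f z l -> exists delta, 0 < delta /\
  forall h, Cmod h < delta -> Cmod (f (z + h) - f z)%C <= (Cmod l + 1) * Cmod h.
Proof.
  intros H. rewrite Cderive_eps in H. destruct (H 1 Rlt_0_1) as [d [Pd K]].
  exists d. split; [exact Pd|]. intros h Hh. specialize (K h Hh).
  generalize (Cmod_triangle (f (z + h) - f z - h * l)%C (h * l)%C).
  replace (f (z + h) - f z - h * l + h * l)%C with (f (z + h) - f z)%C by ring.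
  rewrite Cmod_mult. lra.
Qed.

Lemma Cderive_mult f g z a b :
  Cderive f z a -> Cderive g z b -> Cderive (fun x => f x * g x)%C z (a * g z + f z * b)%C.
Proof.
  rewrite !Cderive_AbsRing. intros Hf Hg.
  exact (is_derive_mult (K := C_AbsRing) f g z a b Hf Hg Cmult_comm).
Qed.

Lemma Cderive_comp f g z df dg :
  Cderive f (g z) df -> Cderive g z dg -> Cderive (fun x => f (g x)) z (dg * df)%C.
Proof.
  rewrite (Cderive_AbsRing g).
  exact (is_derive_comp (K := C_AbsRing) (V := C_NormedModule) f g z df dg).
Qed.

Lemma Cderive_ext f g z l : (forall x, f x = g x) -> Cderive f z l -> Cderive g z l.
Proof. intros E. apply (is_derive_ext (K := C_AbsRing) (V := C_NormedModule)). exact E. Qed.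

Lemma Cderive_ext_ball f g z l d : 0 < d ->
  (forall h, Cmod h < d -> f (z + h)%C = g (z + h)%C) -> Cderive f z l -> Cderive g z l.
Proof.
  intros Pd E H. apply Cderive_eps; rewrite Cderive_eps in H. intros eps P.
  destruct (H eps P) as [d' [Pd' K]]. exists (Rmin d d').
  split; [apply Rmin_pos; assumption|]. intros h Hh.
  assert (h1 := Rlt_le_trans _ _ _ Hh (Rmin_l _ _)).
  assert (h2 := Rlt_le_trans _ _ _ Hh (Rmin_r _ _)).
  rewrite <- (E h h1). replace (g z) with (f z); [apply K, h2|].
  specialize (E 0%C). rewrite Cmod_0 in E. specialize (E Pd).
  replace (z + 0)%C with z in E by ring. exact E.
Qed.

Lemma Cderive_scal c f z l : Cderive f z l -> Cderive (fun x => c * f x)%C z (c * l)%C.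
Proof.
  intros H. replace (c * l)%C with (0 * f z + c * l)%C by ring.
  apply (Cderive_mult (fun _ => c) f); [apply Cderive_const|exact H].
Qed.

Lemma Cderive_val f z l l' : l = l' -> Cderive f z l -> Cderive f z l'.
Proof. now intros ->. Qed.

Lemma Cderive_minus f g z a b :
  Cderive f z a -> Cderive g z b -> Cderive (fun x => f x - g x)%C z (a - b)%C.
Proof. exact (is_derive_minus (K := C_AbsRing) (V := C_NormedModule) f g z a b). Qed.

Lemma Cderive_inv (z : C) : z <> 0%C -> Cderive (fun x => / x)%C z (- / (z * z))%C.
Proof.
  intros Nz. apply Cderive_eps. intros eps P.
  assert (Pz : 0 < Cmod z) by (apply Cmod_gt_0; exact Nz).
  set (m := Cmod z) in *.
  (* The first radius keeps z + h at distance at least m/2 from 0; the second then bounds h / (z^2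
     (z + h)) by eps. *)
  exists (Rmin (m / 2) (eps * (m * m * m) / 2)). split.
  { apply Rmin_pos; [lra|]. apply Rdiv_lt_0_compat; [|lra]. repeat apply Rmult_lt_0_compat; lra. }
  intros h Hh.
  assert (h1 := Rlt_le_trans _ _ _ Hh (Rmin_l _ _)).
  assert (h2 := Rlt_le_trans _ _ _ Hh (Rmin_r _ _)).
  assert (L : m / 2 < Cmod (z + h)%C).
  { generalize (Cmod_triangle (z + h)%C (- h)%C). replace (z + h + - h)%C with z by ring.
    rewrite Cmod_opp. fold m. lra. }
  assert (Nzh : (z + h)%C <> 0%C) by (apply Cmod_gt_0; lra).
  replace (/ (z + h) - / z - h * - / (z * z))%C with (h * (h / (z * z * (z + h))))%C
    by (field; auto).
  rewrite Cmod_mult, Cmod_div, !Cmod_mult by (repeat apply Cmult_neq_0; auto).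
  fold m. rewrite Rmult_comm. apply Rmult_le_compat_r; [apply Cmod_ge_0|].
  apply Rmult_le_reg_r with (m * m * Cmod (z + h)%C); [repeat apply Rmult_lt_0_compat; lra|].
  unfold Rdiv. rewrite Rmult_assoc, Rinv_l, Rmult_1_r
    by (apply Rgt_not_eq; repeat apply Rmult_lt_0_compat; lra).
  left. apply Rlt_trans with (1 := h2).
  replace (eps * (m * m * m) / 2) with (eps * (m * m * (m / 2))) by field.
  apply Rmult_lt_compat_l; [exact P|]. apply Rmult_lt_compat_l; [apply Rmult_lt_0_compat; lra|exact L].
Qed.

Lemma derivable_pt_lim_0_eps (f : R -> R) (l : R) :
  derivable_pt_lim f 0 l -> f 0 = 0 ->
  forall eps, 0 < eps -> exists d, 0 < d /\ forall x, Rabs x < d -> Rabs (f x - x * l) <= eps * Rabs x.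
Proof.
  intros H f0 eps P. destruct (H eps P) as [[d Pd] K]. exists d. split; [exact Pd|].
  intros x Hx. destruct (Req_dec x 0) as [->|Nx].
  - rewrite f0. replace (0 - 0 * l) with 0 by ring. rewrite Rabs_R0. lra.
  - specialize (K x Nx Hx). rewrite Rplus_0_l, f0, Rminus_0_r in K.
    replace (f x - x * l) with ((f x / x - l) * x) by (field; exact Nx).
    rewrite Rabs_mult. apply Rmult_le_compat_r; [apply Rabs_pos|lra].
Qed.

Lemma Cexp_derive_0 : forall eps, 0 < eps -> exists d, 0 < d /\
  forall h, Cmod h < d -> Cmod (Cexp h - 1 - h)%C <= eps * Cmod h.
Proof.
  intros eps P.
  assert (He : derivable_pt_lim (fun x => exp x - 1) 0 1).
  { apply is_derive_Reals. auto_derive; [exact I|]. change (1 * exp 0 = 1). rewrite exp_0. ring. }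
  assert (Hc : derivable_pt_lim (fun x => cos x - 1) 0 0).
  { apply is_derive_Reals. auto_derive; [exact I|]. change (1 * - sin 0 = 0). rewrite sin_0. ring. }
  assert (Hs : derivable_pt_lim sin 0 1) by (rewrite <- cos_0; apply derivable_pt_lim_sin).
  (* With m = |h| < e <= 1 the bounds [B1] and [B2] below add up to at most 9 e m, hence the tenth
     of eps. *)
  assert (Pe : 0 < Rmin 1 (eps / 10)) by (apply Rmin_pos; lra).
  assert (M1 := Rmin_l 1 (eps / 10)). assert (M2 := Rmin_r 1 (eps / 10)).
  set (e := Rmin 1 (eps / 10)) in *. clearbody e.
  assert (e0 : exp 0 - 1 = 0) by (rewrite exp_0; ring).
  assert (c0 : cos 0 - 1 = 0) by (rewrite cos_0; ring).
  destruct (derivable_pt_lim_0_eps _ _ He e0 e Pe) as [d1 [P1 K1]].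
  destruct (derivable_pt_lim_0_eps _ _ Hc c0 e Pe) as [d2 [P2 K2]].
  destruct (derivable_pt_lim_0_eps _ _ Hs sin_0 e Pe) as [d3 [P3 K3]].
  exists (Rmin (Rmin d1 d2) (Rmin d3 e)). split; [repeat apply Rmin_pos; assumption|].
  intros [x y] Hh.
  assert (h12 := Rlt_le_trans _ _ _ Hh (Rmin_l _ _)).
  assert (h34 := Rlt_le_trans _ _ _ Hh (Rmin_r _ _)).
  assert (h1 := Rlt_le_trans _ _ _ h12 (Rmin_l _ _)).
  assert (h2 := Rlt_le_trans _ _ _ h12 (Rmin_r _ _)).
  assert (h3 := Rlt_le_trans _ _ _ h34 (Rmin_l _ _)).
  assert (h4 := Rlt_le_trans _ _ _ h34 (Rmin_r _ _)).
  clear Hh h12 h34.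
  assert (Bx := re_le_Cmod (x, y)). assert (By := im_le_Cmod (x, y)).
  unfold Re, Im in Bx, By; simpl in Bx, By.
  set (m := Cmod (x, y)) in *.
  specialize (K1 x ltac:(lra)). specialize (K2 y ltac:(lra)). specialize (K3 y ltac:(lra)).
  apply Rle_trans with (1 := Cmod_le_re_im _).
  unfold Cexp, Re, Im, RtoC, Cminus, Cplus, Copp; simpl.
  set (E := exp x - 1 - x * 1) in *. set (Q := cos y - 1 - y * 0) in *. set (S := sin y - y * 1) in *.
  replace (exp x * cos y + - (1) + - x) with (E + (exp x - 1) * (cos y - 1) + (cos y - 1))
    by (unfold E; ring).
  replace (exp x * sin y + - 0 + - y) with ((exp x - 1) * sin y + S) by (unfold S; ring).
  assert (Pm : 0 <= m) by apply Cmod_ge_0.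
  assert (Ex : e * Rabs x <= e * m) by (apply Rmult_le_compat_l; lra).
  assert (Ey : e * Rabs y <= e * m) by (apply Rmult_le_compat_l; lra).
  assert (Em : e * m <= m) by (rewrite <- (Rmult_1_l m) at 2; apply Rmult_le_compat_r; lra).
  assert (A1 : Rabs (exp x - 1) <= 2 * m).
  { replace (exp x - 1) with (E + x) by (unfold E; ring).
    apply Rle_trans with (1 := Rabs_triang _ _). lra. }
  assert (A2 : Rabs (cos y - 1) <= e * m).
  { replace (cos y - 1) with Q by (unfold Q; ring). lra. }
  assert (A3 : Rabs (sin y) <= 2 * m).
  { replace (sin y) with (S + y) by (unfold S; ring).
    apply Rle_trans with (1 := Rabs_triang _ _). lra. }
  assert (B1 : Rabs (E + (exp x - 1) * (cos y - 1) + (cos y - 1)) <= e * m + 2 * m * (e * m) + e * m).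
  { eapply Rle_trans; [apply Rabs_triang|]. apply Rplus_le_compat; [|exact A2].
    eapply Rle_trans; [apply Rabs_triang|]. apply Rplus_le_compat; [lra|].
    rewrite Rabs_mult. apply Rmult_le_compat; auto using Rabs_pos. }
  assert (B2 : Rabs ((exp x - 1) * sin y + S) <= 2 * m * (2 * m) + e * m).
  { eapply Rle_trans; [apply Rabs_triang|]. apply Rplus_le_compat; [|lra].
    rewrite Rabs_mult. apply Rmult_le_compat; auto using Rabs_pos. }
  assert (m <= 1) by lra.
  assert (m * m <= e * m) by (apply Rmult_le_compat_r; lra).
  assert (2 * m * (e * m) <= 2 * (e * m)) by nra.
  assert (E8 : 9 * (e * m) <= 9 * (eps / 10) * m) by nra.
  assert (e * m <= eps / 10 * m) by (apply Rmult_le_compat_r; lra).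
  nra.
Qed.

Lemma Cderive_Cexp z : Cderive Cexp z (Cexp z).
Proof.
  apply Cderive_eps. intros eps P.
  assert (Pz : 0 < Cmod (Cexp z)) by (apply Cmod_gt_0, Cexp_neq_0).
  destruct (Cexp_derive_0 (eps / Cmod (Cexp z))) as [d [Pd K]].
  { apply Rdiv_lt_0_compat; assumption. }
  exists d. split; [exact Pd|]. intros h Hh. specialize (K h Hh).
  rewrite Cexp_plus.
  replace (Cexp z * Cexp h - Cexp z - h * Cexp z)%C with (Cexp z * (Cexp h - 1 - h))%C by ring.
  rewrite Cmod_mult.
  replace (eps * Cmod h) with (Cmod (Cexp z) * (eps / Cmod (Cexp z) * Cmod h)) by (field; lra).
  apply Rmult_le_compat_l; lra.
Qed.

Lemma Cderive_Cexp_comp f z l : Cderive f z l -> Cderive (fun x => Cexp (f x)) z (l * Cexp (f z))%C.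
Proof. intros H. apply (Cderive_comp Cexp f); [apply Cderive_Cexp|exact H]. Qed.

Lemma Cderive_div (f g : C -> C) (z a b : C) : g z <> 0%C -> Cderive f z a -> Cderive g z b ->
  Cderive (fun x => f x / g x)%C z ((a * g z - f z * b) / (g z * g z))%C.
Proof.
  intros N Hf Hg.
  apply Cderive_val with (a * / g z + f z * (b * - / (g z * g z)))%C; [field; exact N|].
  apply (Cderive_mult f (fun x => / g x)%C); [exact Hf|].
  apply (Cderive_comp Cinv g); [|exact Hg]. apply Cderive_inv, N.
Qed.

Lemma segment_const (g : R -> R) :
  (forall t, 0 <= t <= 1 -> is_derive g t 0) -> g 0 = g 1.
Proof.
  intros H. destruct (MVT_gen g 0 1 (fun _ => 0)) as [c [_ E]].
  - intros x Hx. apply H. rewrite Rmin_left, Rmax_right in Hx; lra.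
  - intros x Hx. rewrite Rmin_left, Rmax_right in Hx by lra.
    apply continuity_pt_filterlim.
    apply (ex_derive_continuous (K := R_AbsRing) (V := R_NormedModule)). exists 0. apply H. lra.
  - lra.
Qed.

(** The mean value theorem on the segment from z0 to z1. The functional p is additive and bounded by
    the modulus, so that one argument serves for both the real and the imaginary part. *)
Lemma Cderive_zero_const (f : C -> C) (z0 z1 : C) :
  (forall t : R, 0 <= t <= 1 -> Cderive f (z0 + t * (z1 - z0))%C 0) -> f z0 = f z1.
Proof.
  intros H.
  assert (Hd : forall (p : C -> R), (forall z, Rabs (p z) <= Cmod z) ->
     (forall x y, p (x - y)%C = p x - p y) ->
     forall t, 0 <= t <= 1 -> is_derive (fun t : R => p (f (z0 + t * (z1 - z0))%C)) t 0).
  { intros p Hp Hm t Ht. apply is_derive_Reals. intros eps P.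
    set (m := Cmod (z1 - z0)%C + 1).
    assert (Pm : 0 < m) by (unfold m; generalize (Cmod_ge_0 (z1 - z0)%C); lra).
    specialize (H t Ht). rewrite Cderive_eps in H.
    destruct (H (eps / 2 / m)) as [d [Pd K]]; [repeat apply Rdiv_lt_0_compat; lra|].
    assert (Pdm : 0 < d / m) by (apply Rdiv_lt_0_compat; lra).
    exists (mkposreal _ Pdm). intros h Nh Hh. simpl in Hh.
    assert (Bh : Cmod (h * (z1 - z0))%C <= Rabs h * m).
    { rewrite Cmod_mult, Cmod_R. apply Rmult_le_compat_l; [apply Rabs_pos|unfold m; lra]. }
    assert (Lh : Cmod (h * (z1 - z0))%C < d).
    { apply Rle_lt_trans with (1 := Bh). replace d with (d / m * m) by (field; lra).
      apply Rmult_lt_compat_r; lra. }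
    specialize (K _ Lh).
    replace (z0 + t * (z1 - z0) + h * (z1 - z0))%C with (z0 + (t + h)%R * (z1 - z0))%C in K
      by (rewrite RtoC_plus; ring).
    rewrite Rminus_0_r, <- Hm. unfold Rdiv at 1. rewrite Rabs_mult, Rabs_inv.
    assert (Ph : 0 < Rabs h) by (apply Rabs_pos_lt; exact Nh).
    apply Rmult_lt_reg_r with (Rabs h); [exact Ph|].
    rewrite Rmult_assoc, Rinv_l, Rmult_1_r by lra.
    apply Rle_lt_trans with (1 := Hp _).
    match type of K with Cmod (?a - ?b - ?c)%C <= _ => replace (a - b - c)%C with (a - b)%C in K by ring end.
    apply Rle_lt_trans with (1 := K).
    apply Rle_lt_trans with (eps / 2 / m * (Rabs h * m)).
    - apply Rmult_le_compat_l; [|exact Bh]. left. repeat apply Rdiv_lt_0_compat; lra.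
    - replace (eps / 2 / m * (Rabs h * m)) with (eps / 2 * Rabs h) by (field; lra).
      apply Rmult_lt_compat_r; lra. }
  assert (E0 : (z0 + 0%R * (z1 - z0))%C = z0) by ring.
  assert (E1 : (z0 + 1%R * (z1 - z0))%C = z1) by ring.
  pose proof (segment_const _ (Hd Re re_le_Cmod (fun x y => eq_refl))) as A.
  pose proof (segment_const _ (Hd Im im_le_Cmod (fun x y => eq_refl))) as B.
  cbv beta in A, B. rewrite E0, E1 in A, B.
  destruct (f z0), (f z1). unfold Re, Im in A, B; simpl in A, B. congruence.
Qed.

Lemma CSeries_finite (u : nat -> C) N : (forall n, (N <= n)%nat -> u n = 0%C) -> asum u /\ CSeries u = csum u N.
Proof.
  intros H.
  assert (A : asum u).
  { apply (asum_decr u N). apply asum_le with (fun _ => 0).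
    - intros n. rewrite H by lia. rewrite Cmod_0. lra.
    - exists 0. exact is_series_R0. }
  split; [exact A|]. rewrite (CSeries_incr u N A).
  rewrite (CSeries_ext _ (fun _ => 0%C)) by (intros; apply H; lia).
  rewrite CSeries_zero. ring.
Qed.

Definition conv (a b : nat -> C) (n : nat) : C := csum (fun k => a k * b (n - k)%nat)%C (S n).

Lemma asum2_swap_le f : asum2 f ->
  Series (fun n => Series (fun m => Cmod (f m n))) <= Series (fun m => Series (fun n => Cmod (f m n))).
Proof.
  intros H. pose proof H as [H1 H2]. apply Series_le_bound.
  - intros n. apply Series_pos; [intros; apply Cmod_ge_0|apply (asum2_column _ n H)].
  - intros N. pose proof (rsum_Series_swap f N (fun n => asum2_column f n H)) as S.
    rewrite <- (is_series_unique _ _ S).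
    apply Series_le; [|exact H2].
    intros m. split; [apply rsum_pos; intros; apply Cmod_ge_0|].
    apply rsum_Series_le; [intros; apply Cmod_ge_0|apply H1].
Qed.

(** Put u_m v_(n-m) at place (m, n) and 0 for n < m: rows sum to the product, columns to the
    convolution. The inequality of norms is what allows powers of a series to be summed over the
    exponent in [expcoef_spec]. *)
Lemma conv_sum u v : asum u -> asum v ->
  asum (conv u v) /\ CSeries (conv u v) = (CSeries u * CSeries v)%C /\
  Series (fun n => Cmod (conv u v n)) <= Series (fun n => Cmod (u n)) * Series (fun n => Cmod (v n)).
Proof.
  intros Hu Hv.
  set (f := fun m n => if (m <=? n)%nat then (u m * v (n - m)%nat)%C else 0%C).
  assert (F1 : forall m n, f m (m + n)%nat = (u m * v n)%C).
  { intros m n. unfold f. rewrite (proj2 (Nat.leb_le m (m + n)) ltac:(lia)).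
    now replace (m + n - m)%nat with n by lia. }
  assert (F0 : forall m n, (n < m)%nat -> f m n = 0%C).
  { intros m n L. unfold f. now rewrite (proj2 (Nat.leb_gt m n) L). }
  assert (A1 : forall m, asum (f m)).
  { intros m. apply (asum_decr _ m). apply asum_ext with (fun n => u m * v n)%C.
    - intros n. symmetry. apply F1.
    - apply asum_scal, Hv. }
  assert (S1 : forall m, CSeries (f m) = (u m * CSeries v)%C).
  { intros m. rewrite (CSeries_incr _ m (A1 m)).
    rewrite (csum_ext _ (fun _ => 0%C)) by (intros; apply F0; assumption).
    rewrite csum_zero, (CSeries_ext _ (fun n => u m * v n)%C) by apply F1.
    rewrite CSeries_scal by exact Hv. ring. }
  assert (S2 : forall m, Series (fun n => Cmod (f m n)) = Series (fun n => Cmod (v n)) * Cmod (u m)).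
  { intros m. destruct m as [|m].
    - rewrite (Series_ext _ (fun n => Cmod (u 0%nat) * Cmod (v n))).
      + rewrite Series_scal_l. ring.
      + intros n. rewrite <- Cmod_mult. f_equal. apply (F1 0%nat n).
    - rewrite (Series_incr_n _ (S m)); [|lia|apply A1].
      rewrite (Series_ext _ (fun n => Cmod (u (S m)) * Cmod (v n))).
      + rewrite Series_scal_l. rewrite <- sum_n_Reals, sum_n_rsum.
        assert (Z : forall k, (k <= S m)%nat -> rsum (fun n => Cmod (f (S m) n)) k = 0).
        { induction k as [|k IH]; intros L; [reflexivity|]. simpl. rewrite IH by lia.
          rewrite F0 by lia. rewrite Cmod_0. ring. }
        rewrite Z by (simpl; lia). ring.
      + intros n. rewrite <- Cmod_mult. f_equal. apply F1. }
  assert (A2 : asum2 f).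
  { split; [exact A1|].
    apply ex_series_ext with (fun m => Series (fun n => Cmod (v n)) * Cmod (u m)); [intros; symmetry; apply S2|].
    apply ex_series_Rscal, Hu. }
  assert (Ec : forall n, CSeries (fun m => f m n) = conv u v n).
  { intros n. rewrite (proj2 (CSeries_finite (fun m => f m n) (S n) ltac:(intros; apply F0; lia))).
    apply csum_ext. intros k Hk. unfold f. now rewrite (proj2 (Nat.leb_le k n) ltac:(lia)). }
  assert (A3 := asum2_rows _ (asum2_swap _ A2)).
  split; [|split].
  - apply asum_ext with (2 := A3). exact Ec.
  - rewrite <- (CSeries_ext _ _ Ec), <- (CSeries_swap f A2).
    rewrite (CSeries_ext _ (fun m => CSeries v * u m)%C) by (intros; rewrite S1; ring).
    rewrite CSeries_scal by exact Hu. ring.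
  - apply Rle_trans with (Series (fun n => Series (fun m => Cmod (f m n)))).
    + apply Series_le; [|apply (asum2_swap _ A2)].
      intros n. split; [apply Cmod_ge_0|]. rewrite <- Ec.
      apply Cmod_CSeries. apply asum2_column, A2.
    + apply Rle_trans with (1 := asum2_swap_le f A2).
      rewrite (Series_ext _ _ S2), Series_scal_l. right. ring.
Qed.

(** * Power series on the unit disc *)

(** This is the intrinsic content of a Fourier expansion, see [fourier_expansion_dser]: since q
    takes every value of the punctured disc, convergence for all tau means absolute convergence on
    the whole disc. *)
Definition dser (a : nat -> C) : Prop :=
  forall z : C, Cmod z < 1 -> asum (fun n => a n * z ^ n)%C.

Definition PS (a : nat -> C) (z : C) : C := CSeries (fun n => a n * z ^ n)%C.

Lemma dser_plus a b : dser a -> dser b -> dser (fun n => a n + b n)%C.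
Proof.
  intros Ha Hb z Hz. apply asum_ext with (fun n => a n * z ^ n + b n * z ^ n)%C; [intros; ring|].
  apply asum_plus; auto.
Qed.

Lemma PS_plus a b z : dser a -> dser b -> Cmod z < 1 ->
  PS (fun n => a n + b n)%C z = (PS a z + PS b z)%C.
Proof.
  intros Ha Hb Hz. unfold PS. rewrite <- CSeries_plus by auto.
  apply CSeries_ext. intros; ring.
Qed.

Lemma dser_scal c a : dser a -> dser (fun n => c * a n)%C.
Proof.
  intros Ha z Hz. apply asum_ext with (fun n => c * (a n * z ^ n))%C; [intros; ring|].
  apply asum_scal; auto.
Qed.

Lemma PS_scal c a z : dser a -> Cmod z < 1 -> PS (fun n => c * a n)%C z = (c * PS a z)%C.
Proof.
  intros Ha Hz. unfold PS. rewrite <- CSeries_scal by auto.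
  apply CSeries_ext. intros; ring.
Qed.

Lemma PS_ext a b z : (forall n, a n = b n) -> PS a z = PS b z.
Proof. intros H. apply CSeries_ext. intros; now rewrite H. Qed.

Lemma dser_ext a b : (forall n, a n = b n) -> dser a -> dser b.
Proof. intros H Ha z Hz. apply asum_ext with (2 := Ha z Hz). intros; now rewrite H. Qed.

Lemma conv_monomial a b (z : C) n :
  conv (fun k => a k * z ^ k)%C (fun k => b k * z ^ k)%C n = (conv a b n * z ^ n)%C.
Proof.
  unfold conv. rewrite (Cmult_comm _ (z ^ n)%C), <- csum_scal. apply csum_ext. intros k Hk.
  replace (z ^ n)%C with (z ^ k * z ^ (n - k))%C; [ring|].
  rewrite <- Cpow_add_r. f_equal. lia.
Qed.

Lemma dser_conv a b : dser a -> dser b -> dser (conv a b).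
Proof.
  intros Ha Hb z Hz. apply asum_ext with (1 := conv_monomial a b z).
  apply (conv_sum _ _ (Ha z Hz) (Hb z Hz)).
Qed.

Lemma PS_conv a b z : dser a -> dser b -> Cmod z < 1 -> PS (conv a b) z = (PS a z * PS b z)%C.
Proof.
  intros Ha Hb Hz. unfold PS. rewrite <- (CSeries_ext _ _ (conv_monomial a b z)).
  apply (conv_sum _ _ (Ha z Hz) (Hb z Hz)).
Qed.

Definition cst (c : C) (n : nat) : C := match n with O => c | _ => 0%C end.

Lemma dser_cst c : dser (cst c).
Proof.
  intros z _. apply (CSeries_finite _ 1). intros [|n] L; [lia|]. simpl. ring.
Qed.

Lemma PS_cst c z : PS (cst c) z = c.
Proof.
  unfold PS. rewrite (proj2 (CSeries_finite (fun n => cst c n * z ^ n)%C 1 ltac:(intros [|n] L; [lia|]; simpl; ring))).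
  simpl. ring.
Qed.

Definition shift (k : nat) (a : nat -> C) (n : nat) : C :=
  if (n <? k)%nat then 0%C else a (n - k)%nat.

Lemma shift_add k a n : shift k a (k + n)%nat = a n.
Proof.
  unfold shift. rewrite (proj2 (Nat.ltb_ge (k + n) k) ltac:(lia)). f_equal. lia.
Qed.

Lemma shift_small k a n : (n < k)%nat -> shift k a n = 0%C.
Proof. intros L. unfold shift. now rewrite (proj2 (Nat.ltb_lt n k) L). Qed.

Lemma shift_asum k a (z : C) : asum (fun n => a n * z ^ n)%C ->
  asum (fun n => shift k a n * z ^ n)%C /\ PS (shift k a) z = (z ^ k * PS a z)%C.
Proof.
  intros H.
  assert (E : forall n, (shift k a (k + n)%nat * z ^ (k + n))%C = (z ^ k * (a n * z ^ n))%C).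
  { intros n. rewrite shift_add, Cpow_add_r. ring. }
  assert (A : asum (fun n => shift k a n * z ^ n)%C).
  { apply (asum_decr _ k). apply asum_ext with (fun n => z ^ k * (a n * z ^ n))%C.
    - intros; now rewrite E.
    - apply asum_scal, H. }
  split; [exact A|]. unfold PS. rewrite (CSeries_incr _ k A).
  rewrite (csum_ext _ (fun _ => 0%C)) by (intros; rewrite shift_small by lia; ring).
  rewrite csum_zero, (CSeries_ext _ _ E), CSeries_scal by exact H. ring.
Qed.

Lemma dser_shift k a : dser a -> dser (shift k a).
Proof. intros H z Hz. apply shift_asum; auto. Qed.

Lemma PS_shift k a z : dser a -> Cmod z < 1 -> PS (shift k a) z = (z ^ k * PS a z)%C.
Proof. intros H Hz. apply shift_asum; auto. Qed.

Lemma Cmod_half : Cmod (/ 2)%C = / 2.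
Proof. rewrite <- RtoC_inv by lra. rewrite Cmod_R, Rabs_pos_eq; lra. Qed.

Lemma dser_unshift k a : dser a -> dser (fun n => a (k + n)%nat).
Proof.
  intros H.
  assert (H0 : forall z : C, z <> 0%C -> Cmod z < 1 -> asum (fun n => a (k + n)%nat * z ^ n)%C).
  { intros z Nz Hz. apply asum_ext with (fun n => (/ z ^ k) * (a (k + n)%nat * z ^ (k + n)))%C.
    - intros n. rewrite Cpow_add_r. field. apply Cpow_nz, Nz.
    - apply asum_scal. apply (asum_incr _ k (H z Hz)). }
  intros z Hz. destruct (Ceq_dec z 0%C) as [->|Nz]; [|auto].
  apply (CSeries_finite _ 1). intros [|n] L; [lia|]. rewrite Cpow_S. ring.
Qed.

Lemma PS_unshift k a z : dser a -> Cmod z < 1 -> (forall n, (n < k)%nat -> a n = 0%C) ->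
  PS a z = (z ^ k * PS (fun n => a (k + n)%nat) z)%C.
Proof.
  intros H Hz Z. rewrite <- PS_shift by (auto using dser_unshift).
  apply PS_ext. intros n. unfold shift. destruct (Nat.ltb_spec n k) as [L|L]; [auto|].
  f_equal. lia.
Qed.

Lemma dser_twist (w : C) a : Cmod w <= 1 -> dser a -> dser (fun n => a n * w ^ n)%C.
Proof.
  intros Hw H z Hz. apply asum_ext with (fun n => a n * (w * z) ^ n)%C.
  - intros n. rewrite Cpow_mult_l. ring.
  - apply H. rewrite Cmod_mult. generalize (Cmod_ge_0 z) (Cmod_ge_0 w). nra.
Qed.

Lemma PS_twist (w : C) a (z : C) : PS (fun n => a n * w ^ n)%C z = PS a (w * z)%C.
Proof. apply CSeries_ext. intros n. rewrite Cpow_mult_l. ring. Qed.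

(** Coefficients of z |-> a(z^k). *)
Definition dil (k : nat) (a : nat -> C) (n : nat) : C :=
  if (n mod k =? 0)%nat then a (n / k)%nat else 0%C.

Lemma dil_mult k a n : (0 < k)%nat -> dil k a (k * n)%nat = a n.
Proof.
  intros P. unfold dil. rewrite (Nat.mul_comm k n), Nat.Div0.mod_mul, Nat.eqb_refl, Nat.div_mul by lia.
  reflexivity.
Qed.

Lemma dil_between k a n j : (0 < j < k)%nat -> dil k a (k * n + j)%nat = 0%C.
Proof.
  intros P. unfold dil. rewrite Nat.add_comm, (Nat.mul_comm k n), Nat.Div0.mod_add, Nat.mod_small by lia.
  destruct j; [lia|reflexivity].
Qed.

Lemma rsum_add u n m : rsum u (n + m) = rsum u n + rsum (fun k => u (n + k)%nat) m.
Proof.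
  induction m as [|m IH]; simpl.
  - rewrite Nat.add_0_r. ring.
  - rewrite Nat.add_succ_r. simpl. rewrite IH. ring.
Qed.

Lemma rsum_block (u : nat -> R) k N : (0 < k)%nat ->
  (forall n j, (0 < j < k)%nat -> u (k * n + j)%nat = 0) ->
  rsum u (k * N) = rsum (fun n => u (k * n)%nat) N.
Proof.
  intros P H. induction N as [|N IH]; [now rewrite Nat.mul_0_r|].
  replace (k * S N)%nat with (k * N + k)%nat by lia. rewrite rsum_add, IH. simpl. f_equal.
  assert (Q : forall i, (0 < i <= k)%nat -> rsum (fun j => u (k * N + j)%nat) i = u (k * N)%nat).
  { induction i as [|i IHi]; intros L; [lia|]. simpl. destruct (Nat.eq_dec i 0) as [->|Ni].
    - simpl. rewrite Nat.add_0_r. ring.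
    - rewrite IHi, H by lia. ring. }
  apply Q. lia.
Qed.

Lemma csum_block (u : nat -> C) k N : (0 < k)%nat ->
  (forall n j, (0 < j < k)%nat -> u (k * n + j)%nat = 0%C) ->
  csum u (k * N) = csum (fun n => u (k * n)%nat) N.
Proof.
  intros P H. rewrite !csum_re_im.
  rewrite (rsum_block (fun k => Re (u k))), (rsum_block (fun k => Im (u k))); auto;
    intros n j L; now rewrite H.
Qed.

Lemma rsum_mono u n m : (forall k, 0 <= u k) -> (n <= m)%nat -> rsum u n <= rsum u m.
Proof.
  intros H L. replace m with (n + (m - n))%nat by lia. rewrite rsum_add.
  generalize (rsum_pos (fun k => u (n + k)%nat) (m - n) (fun k => H (n + k)%nat)). lra.
Qed.

(** All nonzero terms sit at multiples of k, so the partial sums of length k N are partial sums of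
    the original series at z^k. The inequality of norms is needed to sum over k in [lamw_spec]. *)
Lemma dil_asum k a (z : C) : (0 < k)%nat -> asum (fun n => a n * (z ^ k) ^ n)%C ->
  asum (fun n => dil k a n * z ^ n)%C /\ PS (dil k a) z = PS a (z ^ k)%C /\
  Series (fun n => Cmod (dil k a n * z ^ n)%C) <= Series (fun n => Cmod (a n * (z ^ k) ^ n)%C).
Proof.
  intros P H.
  assert (E : forall n, (dil k a (k * n) * z ^ (k * n))%C = (a n * (z ^ k) ^ n)%C).
  { intros n. rewrite dil_mult by exact P. now rewrite Cpow_mult_r. }
  assert (Z : forall n j, (0 < j < k)%nat -> (dil k a (k * n + j) * z ^ (k * n + j))%C = 0%C).
  { intros n j L. rewrite dil_between by exact L. ring. }
  assert (B : forall n, rsum (fun n => Cmod (dil k a n * z ^ n)%C) n <= Series (fun n => Cmod (a n * (z ^ k) ^ n)%C)).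
  { intros n. apply Rle_trans with (rsum (fun n => Cmod (dil k a n * z ^ n)%C) (k * n)).
    - apply rsum_mono; [intros; apply Cmod_ge_0|nia].
    - rewrite rsum_block; [|exact P|intros; rewrite Z by assumption; apply Cmod_0].
      apply Rle_trans with (rsum (fun n => Cmod (a n * (z ^ k) ^ n)%C) n).
      + apply rsum_le. intros; rewrite E. lra.
      + apply rsum_Series_le; [intros; apply Cmod_ge_0|exact H]. }
  assert (A : asum (fun n => dil k a n * z ^ n)%C)
    by (apply ex_series_rsum_bound with (2 := B); intros; apply Cmod_ge_0).
  split; [exact A|]. split.
  - apply (Clim_unique (fun N => csum (fun n => dil k a n * z ^ n)%C (k * N))).
    + apply (Clim_subseq _ _ (fun N => k * N)%nat (Clim_csum _ A)). intros; nia.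
    + apply Clim_ext with (2 := Clim_csum _ H). intros N.
      rewrite csum_block by auto. apply csum_ext. intros; now rewrite E.
  - apply Series_le_bound with (2 := B). intros; apply Cmod_ge_0.
Qed.

Lemma Cmod_pow_lt_1 (z : C) k : (0 < k)%nat -> Cmod z < 1 -> Cmod (z ^ k)%C < 1.
Proof.
  intros P H. rewrite Cmod_pow. apply pow_lt_1_compat; [split; [apply Cmod_ge_0|exact H]|exact P].
Qed.

Lemma dser_dil k a : (0 < k)%nat -> dser a -> dser (dil k a).
Proof. intros P H z Hz. apply dil_asum; [exact P|]. apply H, Cmod_pow_lt_1; auto. Qed.

Lemma PS_dil k a z : (0 < k)%nat -> dser a -> Cmod z < 1 -> PS (dil k a) z = PS a (z ^ k)%C.
Proof. intros P H Hz. apply dil_asum; [exact P|]. apply H, Cmod_pow_lt_1; auto. Qed.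

(** An interchange of sums. That each coefficient series over m converges at all follows by
    evaluating at the nonzero point 1/2 and dividing by (1/2)^n. *)
Lemma dser_family (A : nat -> nat -> C) :
  (forall z : C, Cmod z < 1 -> asum2 (fun m n => A m n * z ^ n)%C) ->
  dser (fun n => CSeries (fun m => A m n)) /\
  (forall z, Cmod z < 1 -> PS (fun n => CSeries (fun m => A m n)) z = CSeries (fun m => PS (A m) z)).
Proof.
  intros H.
  assert (Hc : forall n, asum (fun m => A m n)).
  { intros n. assert (L : Cmod (/ 2)%C < 1) by (rewrite Cmod_half; lra).
    assert (Nh : (/ 2)%C <> 0%C) by (apply Cmod_gt_0; rewrite Cmod_half; lra).
    apply asum_ext with (fun m => / (/ 2) ^ n * (A m n * (/ 2) ^ n))%C.
    - intros m. field. apply Cpow_nz, Nh.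
    - apply asum_scal. apply (asum2_column _ n (H _ L)). }
  assert (E : forall z n, CSeries (fun m => A m n * z ^ n)%C = (CSeries (fun m => A m n) * z ^ n)%C).
  { intros z n. rewrite (CSeries_ext _ (fun m => z ^ n * A m n)%C) by (intros; ring).
    rewrite CSeries_scal by apply Hc. ring. }
  split.
  - intros z Hz. apply asum_ext with (1 := E z). apply (asum2_rows _ (asum2_swap _ (H z Hz))).
  - intros z Hz. unfold PS. rewrite <- (CSeries_ext _ _ (E z)). symmetry. apply (CSeries_swap _ (H z Hz)).
Qed.

Lemma is_pseries_Clim (a : nat -> C) (z l : C) :
  is_pseries (K := C_AbsRing) (V := C_NormedModule) a z l <->
  Clim (csum (fun n => a n * z ^ n)%C) l.
Proof.
  unfold is_pseries. rewrite is_series_Clim.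
  assert (E : forall n, scal (K := C_AbsRing) (V := C_NormedModule) (pow_n z n) (a n) = (a n * z ^ n)%C).
  { intros n. change (pow_n (K := C_Ring) z n * a n = a n * z ^ n)%C. rewrite Cmult_comm. f_equal.
  }
  split; apply Clim_ext; intros; apply csum_ext; intros; rewrite E; reflexivity.
Qed.

Lemma is_pseries_PS a z : dser a -> Cmod z < 1 ->
  is_pseries (K := C_AbsRing) (V := C_NormedModule) a z (PS a z).
Proof. intros H Hz. apply is_pseries_Clim, Clim_csum, H, Hz. Qed.

Lemma is_pseries_PS_eq a z l : dser a -> Cmod z < 1 ->
  is_pseries (K := C_AbsRing) (V := C_NormedModule) a z l -> PS a z = l.
Proof. intros H Hz L. apply CSeries_eq; [apply H, Hz|apply is_pseries_Clim, L]. Qed.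

Lemma ex_series_Rgeom q : Rabs q < 1 -> ex_series (fun n => q ^ n).
Proof. intros H. exists (/ (1 - q)). apply is_series_geom, H. Qed.

(** Abel's lemma: convergence at a real r with |z| < r < 1 makes a_n r^n bounded, so the terms at z
    are eventually dominated by (|z|/r)^n. The origin is excluded because q never vanishes. *)
Lemma dser_of_convergence a :
  (forall z : C, z <> 0%C -> Cmod z < 1 -> exists l, is_pseries (K := C_AbsRing) (V := C_NormedModule) a z l) ->
  dser a.
Proof.
  intros H z Hz.
  set (r := (Cmod z + 1) / 2).
  assert (Pz := Cmod_ge_0 z).
  assert (Pr : 0 < r < 1) by (unfold r; lra).
  destruct (H (RtoC r)) as [l Hl].
  { apply Cmod_gt_0. rewrite Cmod_R, Rabs_pos_eq; lra. }
  { rewrite Cmod_R, Rabs_pos_eq; lra. }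
  rewrite is_pseries_Clim in Hl.
  assert (H0 : Clim (fun n => a n * r ^ n)%C 0%C).
  { replace (RtoC 0) with (l - l)%C by ring.
    apply Clim_ext with (fun n => csum (fun n => a n * r ^ n)%C (S n) - csum (fun n => a n * r ^ n)%C n)%C.
    - intros n. simpl. ring.
    - apply Clim_minus; [|exact Hl]. apply (Clim_subseq _ _ S Hl). intros; lia. }
  destruct (Clim_bounded _ _ H0) as [N B]. rewrite Cmod_0, Rplus_0_l in B.
  apply (asum_decr _ N).
  apply asum_le with (fun n => (Cmod z / r) ^ (N + n)).
  - intros n. specialize (B (N + n)%nat ltac:(lia)).
    rewrite Cmod_mult, Cmod_pow in *. rewrite Cmod_R, Rabs_pos_eq in B by lra.
    unfold Rdiv. rewrite Rpow_mult_distr, pow_inv.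
    apply Rmult_le_reg_r with (r ^ (N + n)); [apply pow_lt; lra|].
    replace (Cmod z ^ (N + n) * / r ^ (N + n) * r ^ (N + n)) with (1 * Cmod z ^ (N + n))
      by (field; apply pow_nonzero; lra).
    replace (Cmod (a (N + n)%nat) * Cmod z ^ (N + n) * r ^ (N + n))
      with (Cmod (a (N + n)%nat) * r ^ (N + n) * Cmod z ^ (N + n)) by ring.
    apply Rmult_le_compat_r; [apply pow_le, Pz|exact B].
  - apply (ex_series_incr_n (fun n => (Cmod z / r) ^ n) N). apply ex_series_Rgeom.
    rewrite Rabs_pos_eq.
    + apply Rmult_lt_reg_r with r; [lra|]. unfold Rdiv. rewrite Rmult_assoc, Rinv_l by lra. unfold r; lra.
    + apply Rmult_le_pos; [lra|]. left. apply Rinv_0_lt_compat; lra.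
Qed.

Lemma Cmult_integral (x y : C) : (x * y)%C = 0%C -> x = 0%C \/ y = 0%C.
Proof.
  intros E. assert (M : Cmod x * Cmod y = 0) by (rewrite <- Cmod_mult, E; apply Cmod_0).
  apply Rmult_integral in M. destruct M as [M|M]; [left|right]; apply Cmod_eq_0, M.
Qed.

Lemma PS_0 a : PS a 0%C = a 0%nat.
Proof.
  unfold PS. rewrite (proj2 (CSeries_finite (fun n => a n * 0 ^ n)%C 1
    ltac:(intros [|n] L; [lia|]; rewrite Cpow_S; ring))).
  simpl. ring.
Qed.

Lemma PS_near_0 a : dser a -> exists M, 0 <= M /\
  forall z, Cmod z <= / 2 -> Cmod (PS a z - a 0%nat)%C <= M * Cmod z.
Proof.
  intros H. assert (H1 := dser_unshift 1 a H).
  assert (L : Cmod (/ 2)%C < 1) by (rewrite Cmod_half; lra).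
  exists (Series (fun n => Cmod (a (1 + n)%nat * (/ 2) ^ n)%C)). split.
  - apply Series_pos; [intros; apply Cmod_ge_0|apply (H1 _ L)].
  - intros z Hz. assert (Lz : Cmod z < 1) by lra.
    unfold PS. rewrite CSeries_shift by (apply H, Lz).
    replace (a 0%nat * z ^ 0 + CSeries (fun n => a (S n) * z ^ S n) - a 0%nat)%C
      with (CSeries (fun n => a (S n) * z ^ S n)%C) by (simpl; ring).
    rewrite (CSeries_ext _ (fun n => z * (a (1 + n)%nat * z ^ n))%C)
      by (intros; rewrite Cpow_S; simpl; ring).
    rewrite CSeries_scal by (apply (H1 _ Lz)). rewrite Cmod_mult, Rmult_comm.
    apply Rmult_le_compat_r; [apply Cmod_ge_0|].
    apply Cmod_CSeries_le; [|apply (H1 _ L)].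
    intros n. rewrite !Cmod_mult, !Cmod_pow, Cmod_half. apply Rmult_le_compat_l; [apply Cmod_ge_0|].
    apply pow_incr. split; [apply Cmod_ge_0|exact Hz].
Qed.

(** Continuity at the excluded origin: if c = |a_0| were positive, a real point r with M r <= c/2
    would contradict [PS_near_0]. *)
Lemma PS_zero_const_term a : dser a ->
  (forall z : C, z <> 0%C -> Cmod z < 1 -> PS a z = 0%C) -> a 0%nat = 0%C.
Proof.
  intros H Z. destruct (PS_near_0 a H) as [M [PM K]].
  apply Cmod_eq_0. apply Rle_antisym; [|apply Cmod_ge_0].
  apply Rnot_lt_le. intros P.
  set (c := Cmod (a 0%nat)) in *.
  set (r := Rmin (/ 2) (c / 2 / (M + 1))).
  assert (Pr : 0 < r) by (apply Rmin_pos; [lra|repeat apply Rdiv_lt_0_compat; lra]).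
  assert (R1 : r <= / 2) by apply Rmin_l.
  assert (R2 : r <= c / 2 / (M + 1)) by apply Rmin_r.
  assert (E : Cmod (RtoC r) = r) by (rewrite Cmod_R; apply Rabs_pos_eq; lra).
  specialize (K (RtoC r) ltac:(lra)). rewrite Z in K; [|apply Cmod_gt_0; lra|lra].
  replace (0 - a 0%nat)%C with (- a 0%nat)%C in K by ring. rewrite Cmod_opp, E in K. fold c in K.
  assert (M * r <= (M + 1) * (c / 2 / (M + 1))) by (apply Rmult_le_compat; lra).
  replace ((M + 1) * (c / 2 / (M + 1))) with (c / 2) in H0 by (field; lra). lra.
Qed.

Lemma PS_zero_coeffs a : dser a ->
  (forall z : C, z <> 0%C -> Cmod z < 1 -> PS a z = 0%C) -> forall n, a n = 0%C.
Proof.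
  intros H Z n.
  assert (Q : forall k, (forall j, (j < k)%nat -> a j = 0%C) /\ True).
  { induction k as [|k [IH _]]; split; auto; [intros; lia|].
    intros j Hj. destruct (Nat.eq_dec j k) as [->|Nj]; [|apply IH; lia].
    assert (D := dser_unshift k a H).
    rewrite <- (Nat.add_0_r k). apply (PS_zero_const_term _ D).
    intros z Nz Lz. specialize (Z z Nz Lz). rewrite (PS_unshift k a z H Lz IH) in Z.
    apply Cmult_integral in Z. destruct Z as [Z|Z]; [|exact Z].
    exfalso. revert Z. apply Cpow_nz, Nz. }
  apply (proj1 (Q (S n))). lia.
Qed.

Lemma dser_minus a b : dser a -> dser b -> dser (fun n => a n - b n)%C.
Proof.
  intros Ha Hb. apply dser_ext with (fun n => a n + (- (1)) * b n)%C; [intros; ring|].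
  apply dser_plus; [exact Ha|apply dser_scal, Hb].
Qed.

Lemma PS_minus a b z : dser a -> dser b -> Cmod z < 1 ->
  PS (fun n => a n - b n)%C z = (PS a z - PS b z)%C.
Proof.
  intros Ha Hb Hz. rewrite (PS_ext _ (fun n => a n + (- (1)) * b n)%C) by (intros; ring).
  rewrite PS_plus, PS_scal by auto using dser_scal. ring.
Qed.

Lemma PS_inj a b : dser a -> dser b ->
  (forall z : C, z <> 0%C -> Cmod z < 1 -> PS a z = PS b z) -> forall n, a n = b n.
Proof.
  intros Ha Hb E n. assert (D := dser_minus a b Ha Hb).
  assert (Z : (a n - b n)%C = 0%C).
  { apply (PS_zero_coeffs _ D). intros z Nz Lz. rewrite PS_minus, E by auto. ring. }
  replace (a n) with (a n - b n + b n)%C by ring. rewrite Z. ring.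
Qed.

(** 1 - x^n = (1 - x)(1 + x + ... + x^(n-1)), and each of the n powers is at least x^n. In
    [dser_INR] this absorbs the factor n in the gap between |z| and a larger radius. *)
Lemma INR_pow_bound x n : 0 <= x <= 1 -> INR n * x ^ n * (1 - x) <= 1 - x ^ n.
Proof.
  intros Hx. induction n as [|n IH]; [simpl; lra|].
  rewrite S_INR. simpl pow. set (p := x ^ n) in *.
  assert (0 <= p <= 1) by (split; [apply pow_le; lra|unfold p; rewrite <- (pow1 n); apply pow_incr; lra]).
  assert (x * (INR n * p * (1 - x)) <= x * (1 - p)) by (apply Rmult_le_compat_l; lra).
  assert (0 <= x * p <= 1) by (split; [apply Rmult_le_pos|apply Rle_trans with (1 * 1); [apply Rmult_le_compat|]]; lra).
  assert (0 <= (1 - x) * (1 - x * p)) by (apply Rmult_le_pos; lra).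
  nra.
Qed.

Lemma dser_INR a : dser a -> dser (fun n => INR n * a n)%C.
Proof.
  intros H z Hz. assert (Pz := Cmod_ge_0 z).
  set (r := (Cmod z + 1) / 2).
  assert (Pr : 0 < r < 1) by (unfold r; lra).
  assert (Lr : Cmod (RtoC r) < 1) by (rewrite Cmod_R, Rabs_pos_eq; lra).
  set (x := Cmod z / r).
  assert (Hx : 0 <= x < 1).
  { unfold x. split.
    - apply Rmult_le_pos; [lra|]. left. apply Rinv_0_lt_compat; lra.
    - apply Rmult_lt_reg_r with r; [lra|]. unfold Rdiv. rewrite Rmult_assoc, Rinv_l by lra. unfold r; lra. }
  apply asum_le with (fun n => / (1 - x) * Cmod (a n * r ^ n)%C).
  - intros n. rewrite !Cmod_mult, !Cmod_pow, !Cmod_R, (Rabs_pos_eq r), (Rabs_pos_eq (INR n)) by (try apply pos_INR; lra).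
    replace (Cmod z) with (x * r) by (unfold x; field; lra). rewrite Rpow_mult_distr.
    assert (B := INR_pow_bound x n ltac:(lra)).
    assert (Px : 0 <= x ^ n) by (apply pow_le; lra).
    replace (INR n * Cmod (a n) * (x ^ n * r ^ n)) with (INR n * x ^ n * (Cmod (a n) * r ^ n)) by ring.
    apply Rmult_le_compat_r.
    + apply Rmult_le_pos; [apply Cmod_ge_0|apply pow_le; lra].
    + apply Rmult_le_reg_r with (1 - x); [lra|]. rewrite Rinv_l by lra. lra.
  - apply ex_series_Rscal. apply (H _ Lr).
Qed.

Definition dcoef (a : nat -> C) (n : nat) : C := (INR (S n) * a (S n))%C.

Lemma dser_dcoef a : dser a -> dser (dcoef a).
Proof. intros H. apply (dser_unshift 1 _ (dser_INR a H)). Qed.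

Lemma PS_dcoef a z : dser a -> Cmod z < 1 ->
  (z * PS (dcoef a) z)%C = PS (fun n => INR n * a n)%C z.
Proof.
  intros H Hz. rewrite (PS_unshift 1 (fun n => INR n * a n)%C) by
    (auto using dser_INR; intros n L; replace n with 0%nat by lia; simpl; ring).
  simpl. rewrite Cmult_1_r. reflexivity.
Qed.

(** The remainders satisfy D_(n+1) = (z + h) D_n + h^2 (n+1) z^n, and N^2 + N <= (N + 1)^2 closes
    the induction. The factor [rho] on the left avoids the exponent n - 1 on the right. *)
Lemma pow_increment_bound (z h : C) rho n : Cmod z <= rho -> Cmod (z + h)%C <= rho ->
  Cmod ((z + h) ^ S n - z ^ S n - h * (INR (S n) * z ^ n))%C * rho
  <= Cmod h * Cmod h * (INR (S n) * INR (S n)) * rho ^ n.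
Proof.
  intros Hz Hzh. assert (Pz := Cmod_ge_0 z). assert (Ph := Cmod_ge_0 h).
  induction n as [|n IH].
  - replace ((z + h) ^ 1 - z ^ 1 - h * (INR 1 * z ^ 0))%C with (RtoC 0) by (simpl; ring).
    rewrite Cmod_0. simpl. nra.
  - replace ((z + h) ^ S (S n) - z ^ S (S n) - h * (INR (S (S n)) * z ^ S n))%C
      with ((z + h) * ((z + h) ^ S n - z ^ S n - h * (INR (S n) * z ^ n)) + h * h * (INR (S n) * z ^ n))%C.
    2:{ rewrite (RtoC_INR_S (S n)). set (N := RtoC (INR (S n))).
        rewrite !(Cpow_S _ (S n)), !(Cpow_S _ n). ring. }
    set (D := ((z + h) ^ S n - z ^ S n - h * (INR (S n) * z ^ n))%C) in *.
    apply Rle_trans with ((rho * Cmod D + Cmod h * Cmod h * (INR (S n) * rho ^ n)) * rho).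
    + apply Rmult_le_compat_r; [lra|]. eapply Rle_trans; [apply Cmod_triangle|].
      rewrite !Cmod_mult. apply Rplus_le_compat.
      * apply Rmult_le_compat_r; [apply Cmod_ge_0|exact Hzh].
      * apply Rmult_le_compat_l; [nra|]. rewrite Cmod_R, Rabs_pos_eq, Cmod_pow by apply pos_INR.
        apply Rmult_le_compat_l; [apply pos_INR|]. apply pow_incr. lra.
    + rewrite (S_INR (S n)). set (N := INR (S n)) in *.
      assert (PN : 0 <= N) by apply pos_INR.
      assert (Pp : 0 <= rho ^ S n) by (apply pow_le; lra).
      assert (rho * (Cmod D * rho) <= rho * (Cmod h * Cmod h * (N * N) * rho ^ n))
        by (apply Rmult_le_compat_l; [lra|exact IH]).
      assert (P2 : 0 <= Cmod h * Cmod h) by nra.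
      apply Rle_trans with (Cmod h * Cmod h * (N * N) * rho ^ S n + Cmod h * Cmod h * N * rho ^ S n).
      * simpl pow. nra.
      * replace (Cmod h * Cmod h * (N * N) * rho ^ S n + Cmod h * Cmod h * N * rho ^ S n)
          with (Cmod h * Cmod h * rho ^ S n * (N * N + N)) by ring.
        replace (Cmod h * Cmod h * ((N + 1) * (N + 1)) * rho ^ S n)
          with (Cmod h * Cmod h * rho ^ S n * ((N + 1) * (N + 1))) by ring.
        apply Rmult_le_compat_l; [apply Rmult_le_pos; assumption|nra].
Qed.

(** Termwise differentiation. With rho halfway between |z| and 1, the error of second order is at
    most |h|^2/rho times the sum of (n+1)^2 |a_(n+1)| rho^n, which converges by two uses of
    [dser_INR]. *)
Lemma Cderive_PS a z : dser a -> Cmod z < 1 -> Cderive (PS a) z (PS (dcoef a) z).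
Proof.
  intros H Hz. apply Cderive_eps. intros eps P.
  assert (Pz := Cmod_ge_0 z).
  set (rho := (Cmod z + 1) / 2).
  assert (Pr : 0 < rho < 1) by (unfold rho; lra).
  assert (Lr : Cmod (RtoC rho) < 1) by (rewrite Cmod_R, Rabs_pos_eq; lra).
  assert (D2 := dser_unshift 1 _ (dser_INR _ (dser_INR _ H))).
  assert (A2 := D2 _ Lr).
  set (t := fun n => (INR (1 + n) * (INR (1 + n) * a (1 + n)%nat) * rho ^ n)%C) in *.
  set (K := Series (fun n => Cmod (t n)) / rho).
  assert (PK : 0 <= K).
  { apply Rmult_le_pos; [|left; apply Rinv_0_lt_compat; lra].
    apply Series_pos; [intros; apply Cmod_ge_0|exact A2]. }
  exists (Rmin (rho - Cmod z) (eps / (K + 1))). split.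
  { apply Rmin_pos; [unfold rho; lra|apply Rdiv_lt_0_compat; lra]. }
  intros h Hh.
  assert (h1 := Rlt_le_trans _ _ _ Hh (Rmin_l _ _)).
  assert (h2 := Rlt_le_trans _ _ _ Hh (Rmin_r _ _)).
  assert (Lzh : Cmod (z + h)%C <= rho) by (generalize (Cmod_triangle z h); lra).
  assert (Lz : Cmod z <= rho) by (unfold rho; lra).
  assert (Szh := H (z + h)%C ltac:(lra)). assert (Sz := H z Hz).
  assert (Sd := dser_dcoef a H z Hz).
  assert (E : (PS a (z + h) - PS a z - h * PS (dcoef a) z)%C =
    CSeries (fun n => a (S n) * ((z + h) ^ S n - z ^ S n - h * (INR (S n) * z ^ n)))%C).
  { unfold PS. rewrite (CSeries_shift _ Szh), (CSeries_shift _ Sz).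
    rewrite <- (CSeries_scal h _ Sd).
    rewrite (CSeries_ext (fun n => a (S n) * ((z + h) ^ S n - z ^ S n - h * (INR (S n) * z ^ n)))%C
      (fun n => a (S n) * (z + h) ^ S n - a (S n) * z ^ S n - h * (dcoef a n * z ^ n))%C)
      by (intros; unfold dcoef; ring).
    assert (S1 := asum_incr _ 1 Szh). assert (S2 := asum_incr _ 1 Sz).
    simpl plus in S1, S2.
    rewrite CSeries_minus, CSeries_minus by auto using asum_minus, asum_scal.
    simpl. ring. }
  rewrite E.
  apply Rle_trans with (Series (fun n => Cmod h * Cmod h / rho * Cmod (t n))).
  - apply Cmod_CSeries_le; [|apply ex_series_Rscal, A2].
    intros n. unfold t. rewrite !Cmod_mult, Cmod_pow, !Cmod_R, (Rabs_pos_eq rho), Rabs_pos_eq by (try apply pos_INR; lra).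
    assert (B := pow_increment_bound z h rho n Lz Lzh).
    change (1 + n)%nat with (S n). set (N := INR (S n)) in *.
    set (W := Cmod ((z + h) ^ S n - z ^ S n - h * (N * z ^ n))%C) in *.
    apply Rmult_le_reg_r with rho; [lra|].
    replace (Cmod h * Cmod h / rho * (N * (N * Cmod (a (S n))) * rho ^ n) * rho)
      with (Cmod (a (S n)) * (Cmod h * Cmod h * (N * N) * rho ^ n)) by (field; lra).
    rewrite Rmult_assoc. apply Rmult_le_compat_l; [apply Cmod_ge_0|exact B].
  - rewrite Series_scal_l.
    replace (Cmod h * Cmod h / rho * Series (fun n => Cmod (t n))) with (K * Cmod h * Cmod h)
      by (unfold K; field; lra).
    apply Rmult_le_compat_r; [apply Cmod_ge_0|].
    assert (Ph := Cmod_ge_0 h).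
    apply Rle_trans with ((K + 1) * (eps / (K + 1))); [|right; field; lra].
    apply Rmult_le_compat; lra.
Qed.

(** * The exponential series and exponentials of power series *)

Lemma asum_exp (w : C) : asum (fun n => w ^ n / INR (fact n))%C.
Proof.
  assert (E : forall n, / INR (fact n) * Cmod w ^ n = Cmod (w ^ n / INR (fact n))%C).
  { intros n. assert (0 < INR (fact n)) by apply INR_fact_lt_0.
    assert (N : RtoC (INR (fact n)) <> 0%C) by (apply Cmod_gt_0; rewrite Cmod_R, Rabs_pos_eq; lra).
    rewrite Cmod_div, Cmod_pow, Cmod_R, Rabs_pos_eq by (exact N || lra). unfold Rdiv; ring. }
  apply ex_series_ext with (1 := E).
  exists (exp (Cmod w)). apply (is_pseries_R (fun n => / INR (fact n))). apply is_exp_Reals.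
Qed.

Lemma INR_fact_C_neq_0 n : RtoC (INR (fact n)) <> 0%C.
Proof.
  assert (0 < INR (fact n)) by apply INR_fact_lt_0.
  apply Cmod_gt_0. rewrite Cmod_R, Rabs_pos_eq; lra.
Qed.

Lemma Cmod_segment (z : C) t : 0 <= t <= 1 -> Cmod (0 + t * (z - 0))%C <= Cmod z.
Proof.
  intros Ht. replace (0 + t * (z - 0))%C with (t * z)%C by ring.
  rewrite Cmod_mult, Cmod_R, Rabs_pos_eq by lra. generalize (Cmod_ge_0 z). nra.
Qed.

(** The series times e^(-R w) has derivative zero in w. Rescaling by R > |z| brings the point z into
    the unit disc, where power series are differentiated. *)
Lemma Cexp_series (z : C) : CSeries (fun n => z ^ n / INR (fact n))%C = Cexp z.
Proof.
  set (R := Cmod z + 1). assert (Pz := Cmod_ge_0 z).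
  assert (PR : 0 < R) by (unfold R; lra).
  assert (NR : RtoC R <> 0%C) by (apply Cmod_gt_0; rewrite Cmod_R, Rabs_pos_eq; lra).
  set (a := fun n => (R ^ n / INR (fact n))%C).
  assert (Ea : forall w n, (a n * w ^ n)%C = ((R * w) ^ n / INR (fact n))%C).
  { intros w n. unfold a. rewrite Cpow_mult_l. field. apply INR_fact_C_neq_0. }
  assert (Da : dser a).
  { intros w _. apply asum_ext with (fun n => (R * w) ^ n / INR (fact n))%C.
    - intros; now rewrite Ea.
    - apply asum_exp. }
  assert (Dd : forall w, Cmod w < 1 -> PS (dcoef a) w = (R * PS a w)%C).
  { intros w Hw. rewrite <- PS_scal by auto. apply PS_ext. intros n. unfold dcoef, a.
    rewrite fact_simpl, mult_INR, RtoC_mult, Cpow_S. field.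
    split; [apply INR_fact_C_neq_0|].
    apply Cmod_gt_0. rewrite Cmod_R, Rabs_pos_eq by apply pos_INR. apply lt_0_INR. lia. }
  set (f := fun w => (PS a w * Cexp (- (R * w)))%C).
  set (w := (z / R)%C).
  assert (Hw : Cmod w < 1).
  { unfold w. rewrite Cmod_div, Cmod_R, Rabs_pos_eq by (auto; lra).
    apply Rmult_lt_reg_r with R; [exact PR|]. unfold Rdiv. rewrite Rmult_assoc, Rinv_l by lra.
    unfold R; lra. }
  assert (E : f 0%C = f w).
  { apply Cderive_zero_const. intros t Ht.
    assert (Hv := Cmod_segment w t Ht).
    set (v := (0 + t * (w - 0))%C) in *.
    apply Cderive_val with (PS (dcoef a) v * Cexp (- (R * v)) + PS a v * ((- R) * Cexp (- (R * v))))%C.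
    - rewrite Dd by lra. ring.
    - apply (Cderive_mult (PS a) (fun w => Cexp (- (R * w)))); [apply Cderive_PS; [exact Da|lra]|].
      apply (Cderive_Cexp_comp (fun x => (- (R * x))%C)). apply Cderive_ext with (fun x => (- R) * x)%C; [intros; ring|].
      apply Cderive_val with ((- R) * 1)%C; [ring|]. apply Cderive_scal, Cderive_id. }
  unfold f in E. rewrite PS_0 in E.
  replace (- (R * 0))%C with (RtoC 0) in E by ring.
  assert (Rw : (R * w)%C = z) by (unfold w; field; exact NR).
  rewrite Cexp_0, Rw, Cexp_opp in E. unfold a at 1 in E. simpl in E.
  assert (E' : PS a w = Cexp z).
  { replace (PS a w) with (PS a w * / Cexp z * Cexp z)%C by (field; apply Cexp_neq_0).
    rewrite <- E. field. }
  rewrite <- E'. unfold PS. apply CSeries_ext. intros n. now rewrite Ea, Rw.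
Qed.

Fixpoint cpow (a : nat -> C) (j : nat) : nat -> C :=
  match j with O => cst 1 | S i => conv a (cpow a i) end.

Lemma cpow_sum a (z : C) j : dser a -> Cmod z < 1 ->
  asum (fun n => cpow a j n * z ^ n)%C /\ PS (cpow a j) z = (PS a z ^ j)%C /\
  Series (fun n => Cmod (cpow a j n * z ^ n)%C) <= Series (fun n => Cmod (a n * z ^ n)%C) ^ j.
Proof.
  intros H Hz. induction j as [|j [IH1 [IH2 IH3]]].
  - simpl. split; [apply dser_cst, Hz|]. split; [apply PS_cst|].
    rewrite (Series_ext _ (fun n => Cmod (cst 1 n))).
    + rewrite Series_incr_1.
      * simpl. rewrite Cmod_1. rewrite (Series_ext _ (fun _ => 0)) by (intros; apply Cmod_0).
        rewrite (is_series_unique _ _ is_series_R0). lra.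
      * apply (ex_series_incr_1 (fun n => Cmod (cst 1 n))). exists 0.
        apply is_series_ext with (fun _ => 0); [intros; symmetry; apply Cmod_0|exact is_series_R0].
    + intros [|n]; simpl; [f_equal; ring|]. f_equal. ring.
  - simpl cpow. destruct (conv_sum _ _ (H z Hz) IH1) as [A1 [A2 A3]].
    pose proof (conv_monomial a (cpow a j) z) as E.
    split; [apply asum_ext with (1 := E), A1|]. split.
    + unfold PS at 1. rewrite <- (CSeries_ext _ _ E), A2. fold (PS a z) (PS (cpow a j) z).
      rewrite IH2. reflexivity.
    + rewrite <- (Series_ext _ _ (fun n => f_equal Cmod (E n))).
      apply Rle_trans with (1 := A3). simpl. apply Rmult_le_compat_l; [|exact IH3].
      apply Series_pos; [intros; apply Cmod_ge_0|apply (H z Hz)].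
Qed.

Definition expcoef (a : nat -> C) (n : nat) : C :=
  CSeries (fun j => cpow a j n / INR (fact j))%C.

(** The double series of a^j / j! is dominated by the exponential of the sum of the |a_n z^n|, so
    summing over j first gives a power series and summing over n first gives the exponential. *)
Lemma expcoef_spec a : dser a ->
  dser (expcoef a) /\ forall z, Cmod z < 1 -> PS (expcoef a) z = Cexp (PS a z).
Proof.
  intros H.
  destruct (dser_family (fun j n => cpow a j n / INR (fact j))%C) as [D1 D2].
  - intros z Hz.
    assert (E : forall j n, (cpow a j n / INR (fact j) * z ^ n)%C = (/ INR (fact j) * (cpow a j n * z ^ n))%C).
    { intros j n. field. apply INR_fact_C_neq_0. }
    split.
    + intros j. apply asum_ext with (1 := fun n => eq_sym (E j n)). apply asum_scal. apply cpow_sum; auto.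
    + set (M := Series (fun n => Cmod (a n * z ^ n)%C)).
      apply (ex_series_le (K := R_AbsRing) (V := R_CompleteNormedModule) _ (fun j => / INR (fact j) * M ^ j)).
      * intros j. assert (Pf := INR_fact_lt_0 j).
        destruct (cpow_sum a z j H Hz) as [A1 [_ A3]].
        rewrite (Series_ext _ (fun n => / INR (fact j) * Cmod (cpow a j n * z ^ n)%C)).
        -- rewrite Series_scal_l. change (Rabs (/ INR (fact j) * Series (fun n => Cmod (cpow a j n * z ^ n)%C)) <= / INR (fact j) * M ^ j).
           assert (0 < / INR (fact j)) by (apply Rinv_0_lt_compat, Pf).
           rewrite Rabs_pos_eq.
           ++ apply Rmult_le_compat_l; [lra|exact A3].
           ++ apply Rmult_le_pos; [lra|]. apply Series_pos; [intros; apply Cmod_ge_0|exact A1].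
        -- intros n. rewrite E, Cmod_mult. f_equal.
           rewrite Cmod_inv by apply INR_fact_C_neq_0. rewrite Cmod_R, Rabs_pos_eq; [reflexivity|lra].
      * exists (exp M). apply (is_pseries_R (fun n => / INR (fact n))). apply is_exp_Reals.
  - split; [exact D1|]. intros z Hz. unfold expcoef. rewrite D2 by exact Hz.
    rewrite <- Cexp_series. apply CSeries_ext. intros j.
    rewrite (PS_ext _ (fun n => / INR (fact j) * cpow a j n)%C) by (intros; field; apply INR_fact_C_neq_0).
    assert (Dj : dser (cpow a j)) by (intros w Hw; apply cpow_sum; auto).
    rewrite PS_scal by auto. rewrite (proj1 (proj2 (cpow_sum a z j H Hz))). field. apply INR_fact_C_neq_0.
Qed.

(** * The upper half-plane *)

Lemma exp2ipi_plus (x y : C) : exp2ipi (x + y)%C = (exp2ipi x * exp2ipi y)%C.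
Proof. unfold exp2ipi. rewrite <- Cexp_plus. f_equal. ring. Qed.

Lemma exp2ipi_pow n (x : C) : exp2ipi (INR n * x)%C = (exp2ipi x ^ n)%C.
Proof. unfold exp2ipi. rewrite <- Cexp_pow. f_equal. ring. Qed.

Lemma exp2ipi_Z (k : Z) : exp2ipi (IZR k) = 1%C.
Proof. apply Cexp_2PIi_Z. Qed.

Lemma exp2ipi_neq_0 (x : C) : exp2ipi x <> 0%C.
Proof. apply Cexp_neq_0. Qed.

Lemma exp2ipi_opp (x : C) : exp2ipi (- x)%C = (/ exp2ipi x)%C.
Proof. unfold exp2ipi. rewrite <- Cexp_opp. f_equal. ring. Qed.

Lemma Cmod_exp2ipi (x : C) : Cmod (exp2ipi x) = exp (- (2 * PI * Im x)).
Proof.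
  unfold exp2ipi. rewrite Cmod_Cexp. f_equal. destruct x as [a b].
  unfold Re, Im, Ci, RtoC, Cmult; simpl. ring.
Qed.

Lemma Im_div_pos (x : C) h : 0 < h -> Im (x / h)%C = Im x / h.
Proof.
  intros P. destruct x as [a b]. unfold Cdiv, Cinv, Cmult, Im, RtoC; simpl. field. lra.
Qed.

Lemma exp2ipi_upper_lt_1 (x : C) : upper x -> Cmod (exp2ipi x) < 1.
Proof.
  intros U. rewrite Cmod_exp2ipi, <- exp_0. apply exp_increasing.
  assert (P := PI_RGT_0). unfold upper in U. nra.
Qed.

Lemma polar (z : C) : z <> 0%C -> exists x y, z = Cexp (x, y).
Proof.
  intros Nz. assert (Pm : 0 < Cmod z) by (apply Cmod_gt_0, Nz).
  destruct z as [a b]. set (m := Cmod (a, b)) in *.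
  assert (E : a * a + b * b = m * m).
  { unfold m, Cmod. simpl. rewrite sqrt_sqrt; [ring|]. nra. }
  set (c := a / m). set (s := b / m).
  assert (E1 : c * c + s * s = 1).
  { unfold c, s. replace (a / m * (a / m) + b / m * (b / m)) with ((a * a + b * b) / (m * m)) by (field; lra).
    rewrite E. field. lra. }
  assert (Hc : -1 <= c <= 1) by nra.
  assert (Q : exists t, cos t = c /\ sin t = s).
  { assert (Ss : sin (acos c) = sqrt (1 - Rsqr c)) by (apply sin_acos; exact Hc).
    assert (Cc := cos_acos c Hc).
    replace (1 - Rsqr c) with (Rsqr s) in Ss by (unfold Rsqr; lra).
    rewrite sqrt_Rsqr_abs in Ss.
    destruct (Rle_dec 0 s) as [L|L].
    - exists (acos c). rewrite Ss, Rabs_pos_eq by exact L. auto.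
    - exists (- acos c). rewrite cos_neg, sin_neg, Ss, Rabs_left by lra. split; [exact Cc|ring]. }
  destruct Q as [t [Et1 Et2]]. exists (ln m), t.
  unfold Cexp, Re, Im; simpl. rewrite exp_ln, Et1, Et2 by exact Pm.
  unfold c, s. f_equal; field; lra.
Qed.

(** Lets an identity valid for all tau be transported to a punctured disc, where [PS_inj] compares
    coefficients. *)
Lemma exp2ipi_onto (z : C) h : 0 < h -> z <> 0%C -> Cmod z < 1 ->
  exists tau, upper tau /\ exp2ipi (tau / h)%C = z.
Proof.
  intros P Nz Lz. destruct (polar z Nz) as [x [y E]].
  assert (PP := PI_RGT_0).
  exists (h * (y / (2 * PI)), h * (- x / (2 * PI))). split.
  - unfold upper, Im; simpl.
    rewrite E, Cmod_Cexp, <- exp_0 in Lz. apply exp_lt_inv in Lz. unfold Re in Lz; simpl in Lz.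
    apply Rmult_lt_0_compat; [exact P|]. apply Rdiv_lt_0_compat; lra.
  - rewrite E. unfold exp2ipi. f_equal.
    unfold Cdiv, Cinv, Cmult, Ci, RtoC; simpl. f_equal; field; lra.
Qed.

Lemma Cneq_R (x : R) : x <> 0 -> RtoC x <> 0%C.
Proof. intros N E. apply N. injection E. auto. Qed.

Lemma fourier_expansion_dser h f a :
  fourier_expansion h f a <->
  dser a /\ forall tau, upper tau -> f tau = PS a (exp2ipi (tau / IZR (Z.pos h))%C).
Proof.
  assert (Ph : 0 < IZR (Z.pos h)) by (apply IZR_lt; lia).
  assert (L : forall tau, upper tau -> Cmod (exp2ipi (tau / IZR (Z.pos h))%C) < 1).
  { intros tau U. apply exp2ipi_upper_lt_1. unfold upper. rewrite Im_div_pos by exact Ph.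
    apply Rdiv_lt_0_compat; assumption. }
  split.
  - intros H.
    assert (D : dser a).
    { apply dser_of_convergence. intros z Nz Lz.
      destruct (exp2ipi_onto z _ Ph Nz Lz) as [tau [U E]]. exists (f tau).
      rewrite <- E. apply H, U. }
    split; [exact D|]. intros tau U. symmetry. apply is_pseries_PS_eq; auto.
  - intros [D H] tau U. rewrite H by exact U. apply is_pseries_PS; auto.
Qed.

Lemma csum_geom (w : C) N : (csum (fun j => w ^ j) N * (1 - w) = 1 - w ^ N)%C.
Proof.
  induction N as [|N IH]; simpl; [ring|].
  replace ((csum (fun j => w ^ j) N + w ^ N) * (1 - w))%C
    with (csum (fun j => w ^ j) N * (1 - w) + w ^ N * (1 - w))%C by ring.
  rewrite IH. ring.
Qed.

Lemma exp2ipi_real_neq_1 x : 0 < x < 1 -> exp2ipi x <> 1%C.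
Proof.
  intros Hx E. assert (PP := PI_RGT_0).
  unfold exp2ipi, Cexp in E.
  assert (Er : Re (2 * PI * Ci * x)%C = 0) by (unfold Re, Ci, Cmult, RtoC; simpl; ring).
  assert (Ei : Im (2 * PI * Ci * x)%C = 2 * PI * x) by (unfold Im, Ci, Cmult, RtoC; simpl; ring).
  rewrite Er, Ei, exp_0 in E. injection E as E1 E2.
  rewrite Rmult_1_l in E1, E2.
  destruct (sin_eq_O_2PI_0 (2 * PI * x)) as [Z|[Z|Z]]; try nra.
  rewrite Z, cos_PI in E1. lra.
Qed.

Lemma csum_const c N : csum (fun _ => c) N = (INR N * c)%C.
Proof.
  induction N as [|N IH]; [simpl; ring|]. rewrite RtoC_INR_S. simpl csum. rewrite IH. ring.
Qed.

Lemma rsum_const c N : rsum (fun _ => c) N = INR N * c.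
Proof.
  induction N as [|N IH]; [simpl; ring|]. rewrite S_INR. simpl rsum. rewrite IH. ring.
Qed.

(** Averaging [PS a] over the N-th roots of unity isolates a_n, up to a tail of the series. *)
Lemma Cauchy_estimate a r M n : dser a -> 0 < r < 1 ->
  (forall z, Cmod z = r -> Cmod (PS a z) <= M) -> Cmod (a n) * r ^ n <= M.
Proof.
  intros H Hr HM.
  assert (Mr : Cmod (RtoC r) = r) by (rewrite Cmod_R, Rabs_pos_eq; lra).
  assert (Ar : asum (fun n => a n * r ^ n)%C) by (apply H; lra).
  apply Rnot_lt_le. intros L.
  destruct (Series_tail_small _ Ar (Cmod (a n) * r ^ n - M) ltac:(lra)) as [K HK].
  (* N exceeds n, so that n is the only index below N which survives the averaging, and exceeds K,
     so that the remaining tail is smaller than the assumed gap. *)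
  set (N := (K + n + 2)%nat).
  set (om := exp2ipi (1 / INR N)%C).
  assert (PN : 0 < INR N) by (apply lt_0_INR; unfold N; lia).
  assert (NN : RtoC (INR N) <> 0%C) by (apply Cneq_R; lra).
  assert (Eom : forall k, (om ^ k)%C = exp2ipi (INR k / INR N)%R).
  { intros k. unfold om. rewrite <- exp2ipi_pow. f_equal. rewrite RtoC_div by lra. field. exact NN. }
  assert (omN : (om ^ N)%C = 1%C).
  { rewrite Eom. replace (INR N / INR N) with (IZR 1) by (field; lra). apply exp2ipi_Z. }
  assert (omn1 : forall k, (0 < k < N)%nat -> (om ^ k)%C <> 1%C).
  { intros k Hk. rewrite Eom. apply exp2ipi_real_neq_1.
    assert (0 < INR k) by (apply lt_0_INR; lia).
    assert (INR k < INR N) by (apply lt_INR; lia). split.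
    - apply Rdiv_lt_0_compat; lra.
    - apply Rmult_lt_reg_r with (INR N); [lra|]. unfold Rdiv. rewrite Rmult_assoc, Rinv_l by lra. lra. }
  assert (Mom : forall k, Cmod (om ^ k)%C = 1).
  { intros k. rewrite Eom, Cmod_exp2ipi. replace (Im (INR k / INR N)%R) with 0 by reflexivity.
    rewrite Rmult_0_r, Ropp_0. apply exp_0. }
  (* The weight is om^(-j n), since om^N = 1. Summing over j therefore gives N for m = n and 0 for
     the other m < N. *)
  set (f := fun m j => ((om ^ j) ^ (N - n) * (a m * (r * om ^ j) ^ m))%C).
  assert (Mz : forall j, Cmod (r * om ^ j)%C = r) by (intros j; rewrite Cmod_mult, Mom, Mr; ring).
  assert (Af : forall j, asum (fun m => f m j)).
  { intros j. apply asum_scal. apply H. rewrite Mz. lra. }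
  destruct (CSeries_csum f N Af) as [A1 A2].
  set (g := fun m => csum (fun j => (om ^ (N - n + m)) ^ j)%C N).
  assert (Eg : forall m, csum (f m) N = (g m * (a m * r ^ m))%C).
  { intros m. unfold g. rewrite Cmult_comm, <- csum_scal. apply csum_ext. intros j _. unfold f.
    rewrite Cpow_mult_l, <- !Cpow_mult_r, (Nat.mul_add_distr_r (N - n) m j), Cpow_add_r.
    rewrite (Nat.mul_comm j (N - n)), (Nat.mul_comm j m). ring. }
  assert (g0 : forall m, (m < N)%nat -> m <> n -> g m = 0%C).
  { intros m Hm Nm. set (w := (om ^ (N - n + m))%C).
    assert (wN : (w ^ N)%C = 1%C).
    { unfold w. rewrite <- Cpow_mult_r, Nat.mul_comm, Cpow_mult_r, omN. apply Cpow_1_l. }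
    assert (w1 : w <> 1%C).
    { unfold w. destruct (Nat.lt_trichotomy m n) as [L'|[L'|L']]; [|lia|].
      - apply omn1. lia.
      - replace (N - n + m)%nat with (N + (m - n))%nat by (unfold N in *; lia).
        rewrite Cpow_add_r, omN, Cmult_1_l. apply omn1. lia. }
    pose proof (csum_geom w N) as G. rewrite wN in G.
    replace (1 - 1)%C with (RtoC 0) in G by ring.
    apply Cmult_integral in G. destruct G as [G|G]; [exact G|].
    exfalso. apply w1. replace w with (1 - (1 - w))%C by ring. rewrite G. ring. }
  assert (gn : g n = INR N).
  { unfold g. replace (N - n + n)%nat with N by (unfold N; lia). rewrite omN.
    rewrite (csum_ext _ (fun _ => 1%C)) by (intros; apply Cpow_1_l).
    rewrite csum_const. ring. }
  assert (gb : forall m, Cmod (g m) <= INR N).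
  { intros m. apply Rle_trans with (1 := Cmod_csum _ _).
    apply Rle_trans with (rsum (fun _ => 1) N); [|rewrite rsum_const; lra].
    apply rsum_le. intros k _. rewrite Cmod_pow, Mom, pow1. lra. }
  assert (B1 : Cmod (csum (fun j => CSeries (fun m => f m j)) N) <= INR N * M).
  { apply Rle_trans with (1 := Cmod_csum _ _). rewrite <- rsum_const. apply rsum_le.
    intros j _. unfold f. rewrite CSeries_scal by (apply H; rewrite Mz; lra).
    rewrite Cmod_mult, Cmod_pow, Mom, pow1, Rmult_1_l. apply HM, Mz. }
  rewrite <- A2 in B1.
  assert (A1' : asum (fun m => g m * (a m * r ^ m))%C) by (apply asum_ext with (2 := A1); exact Eg).
  rewrite (CSeries_ext _ _ Eg), (CSeries_incr _ N A1') in B1.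
  assert (Ec : csum (fun m => g m * (a m * r ^ m))%C N = (INR N * (a n * r ^ n))%C).
  { replace N with (n + (1 + (N - n - 1)))%nat at 1 by (unfold N; lia).
    rewrite csum_add, csum_add. simpl (csum _ 1).
    rewrite (csum_ext _ (fun _ => 0%C) n) by (intros k Hk; rewrite g0 by (unfold N; lia); ring).
    rewrite (csum_ext _ (fun _ => 0%C) (N - n - 1)) by (intros k Hk; rewrite g0 by (unfold N in *; lia); ring).
    rewrite !csum_zero, Nat.add_0_r, gn. ring. }
  rewrite Ec in B1.
  set (T := CSeries (fun m => g (N + m)%nat * (a (N + m)%nat * r ^ (N + m)))%C) in *.
  assert (Et : ex_series (fun k => Cmod (a (K + k)%nat * r ^ (K + k))%C))
    by (apply (ex_series_incr_n (fun k => Cmod (a k * r ^ k)%C) K), Ar).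
  assert (BT : Cmod T <= INR N * Series (fun k => Cmod (a (K + k)%nat * r ^ (K + k))%C)).
  { assert (EN : ex_series (fun k => Cmod (a (N + k)%nat * r ^ (N + k))%C))
      by (apply (ex_series_incr_n (fun k => Cmod (a k * r ^ k)%C) N), Ar).
    apply Rle_trans with (INR N * Series (fun k => Cmod (a (N + k)%nat * r ^ (N + k))%C)).
    - rewrite <- Series_scal_l. apply Cmod_CSeries_le.
      + intros m. rewrite Cmod_mult. apply Rmult_le_compat_r; [apply Cmod_ge_0|apply gb].
      + apply ex_series_Rscal, EN.
    - apply Rmult_le_compat_l; [lra|].
      rewrite (Series_incr_n (fun k => Cmod (a (K + k)%nat * r ^ (K + k))%C) (N - K)); [|unfold N; lia|exact Et].
      rewrite (Series_ext (fun k => Cmod (a (K + (N - K + k))%nat * r ^ (K + (N - K + k)))%C)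
        (fun k => Cmod (a (N + k)%nat * r ^ (N + k))%C)).
      + rewrite <- sum_n_Reals, sum_n_rsum.
        generalize (rsum_pos (fun k => Cmod (a (K + k)%nat * r ^ (K + k))%C) (S (Nat.pred (N - K))) (fun k => Cmod_ge_0 _)). lra.
      + intros k. replace (K + (N - K + k))%nat with (N + k)%nat by (unfold N; lia). reflexivity. }
  assert (Q : INR N * (Cmod (a n) * r ^ n) <= INR N * M + Cmod T).
  { replace (INR N * (Cmod (a n) * r ^ n)) with (Cmod (INR N * (a n * r ^ n))%C).
    - replace (INR N * (a n * r ^ n))%C with ((INR N * (a n * r ^ n) + T) + (- T))%C by ring.
      eapply Rle_trans; [apply Cmod_triangle|]. rewrite Cmod_opp. lra.
    - rewrite !Cmod_mult, Cmod_pow, Mr, Cmod_R, Rabs_pos_eq by lra. reflexivity. }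
  assert (INR N * (Cmod (a n) * r ^ n - M) <= INR N * Series (fun k => Cmod (a (K + k)%nat * r ^ (K + k))%C)) by lra.
  apply Rmult_le_reg_l in H0; lra.
Qed.

(** * Reduction to Im tau >= 1/2 and functions of negative weight *)

Lemma upper_neq_0 (tau : C) : upper tau -> tau <> 0%C.
Proof. intros U E. rewrite E in U. unfold upper, Im, RtoC in U; simpl in U. lra. Qed.

Lemma Im_neg_inv (tau : C) : upper tau -> Im (- (1) / tau)%C = Im tau / Cmod tau ^ 2.
Proof.
  intros U. rewrite Cmod2_alt. destruct tau as [x y]. unfold upper, Im in U; simpl in U.
  unfold Cdiv, Cinv, Cmult, Copp, RtoC, Im, Re; simpl. field. nra.
Qed.

Lemma upper_neg_inv (tau : C) : upper tau -> upper (- (1) / tau)%C.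
Proof.
  intros U. unfold upper. rewrite Im_neg_inv by exact U.
  apply Rdiv_lt_0_compat; [exact U|]. apply pow_lt. apply Cmod_gt_0, upper_neq_0, U.
Qed.

Lemma Im_plus_R (tau : C) (x : R) : Im (tau + x)%C = Im tau.
Proof. destruct tau. unfold Im; simpl. ring. Qed.

Lemma upper_plus_R (tau : C) (x : R) : upper tau -> upper (tau + x)%C.
Proof. unfold upper. now rewrite Im_plus_R. Qed.

(** Each inversion of a point with |Re| <= 1/2 and Im < 1/2 at least doubles Im. *)
Lemma upper_reduction (P : C -> Prop) :
  (forall tau, / 2 <= Im tau -> P tau) ->
  (forall tau, upper tau -> P (tau + 1)%C -> P tau) ->
  (forall tau, upper tau -> P (tau + (-1)%R)%C -> P tau) ->
  (forall tau, upper tau -> P (- (1) / tau)%C -> P tau) ->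
  forall tau, upper tau -> P tau.
Proof.
  intros H0 Hp Hm Hs.
  assert (HN : forall n tau, upper tau -> P (tau + INR n)%C -> P tau).
  { induction n as [|n IH]; intros tau U Q.
    - simpl in Q. replace (tau + 0)%C with tau in Q by ring. exact Q.
    - apply Hp; [exact U|]. apply IH; [now apply upper_plus_R|].
      rewrite RtoC_INR_S in Q. replace (tau + 1 + INR n)%C with (tau + (INR n + 1))%C by ring. exact Q. }
  assert (HM : forall n tau, upper tau -> P (tau + (- INR n)%R)%C -> P tau).
  { induction n as [|n IH]; intros tau U Q.
    - simpl in Q. replace (tau + (- 0)%R)%C with tau in Q by (rewrite Ropp_0; ring). exact Q.
    - apply Hm; [exact U|]. apply IH; [now apply upper_plus_R|].
      rewrite S_INR in Q. replace (tau + (-1)%R + (- INR n)%R)%C with (tau + (- (INR n + 1))%R)%C; [exact Q|].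
      rewrite <- Cplus_assoc, <- RtoC_plus. do 2 f_equal. ring. }
  assert (HZ : forall k tau, upper tau -> P (tau + IZR k)%C -> P tau).
  { intros k tau U Q. destruct (Z_le_gt_dec 0 k) as [L|L].
    - apply (HN (Z.to_nat k)); [exact U|]. rewrite INR_IZR_INZ, Z2Nat.id by lia. exact Q.
    - apply (HM (Z.to_nat (- k))); [exact U|]. rewrite INR_IZR_INZ, Z2Nat.id, opp_IZR, Ropp_involutive by lia. exact Q. }
  assert (HR : forall n tau, upper tau -> / 2 <= 2 ^ n * Im tau -> P tau).
  { induction n as [|n IH]; intros tau U L.
    - apply H0. simpl in L. lra.
    (* [up x] is the integer in the interval from x (excluded) to x + 1 (included), so k is a
       nearest integer to Re tau. *)
    - set (k := up (Re tau - / 2)).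
      destruct (archimed (Re tau - / 2)) as [K1 K2]. fold k in K1, K2.
      apply (HZ (- k)%Z); [exact U|]. rewrite opp_IZR.
      set (s := (tau + (- IZR k)%R)%C).
      assert (Is : Im s = Im tau) by apply Im_plus_R.
      assert (Us : upper s) by (unfold upper; rewrite Is; exact U).
      assert (Rs : Re s = Re tau - IZR k) by (unfold s, Re; simpl; ring).
      destruct (Rle_dec (/ 2) (Im s)) as [L2|L2]; [now apply H0|].
      apply Hs; [exact Us|]. apply IH; [now apply upper_neg_inv|].
      rewrite Im_neg_inv by exact Us.
      assert (B : Cmod s ^ 2 <= / 2).
      { rewrite Cmod2_alt. unfold upper in Us. nra. }
      assert (Ps : 0 < Cmod s ^ 2) by (apply pow_lt, Cmod_gt_0, upper_neq_0, Us).
      apply Rle_trans with (1 := L). change (2 ^ S n) with (2 * 2 ^ n). rewrite <- Is.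
      replace (2 * 2 ^ n * Im s) with (2 ^ n * (2 * Im s)) by ring.
      apply Rmult_le_compat_l; [apply pow_le; lra|].
      apply Rmult_le_reg_r with (Cmod s ^ 2); [exact Ps|].
      replace (Im s / Cmod s ^ 2 * Cmod s ^ 2) with (Im s) by (field; intros Z; rewrite Z in Ps; simpl in Ps; lra).
      unfold upper in Us. nra. }
  intros tau U.
  destruct (Pow_x_infinity 2 ltac:(rewrite Rabs_pos_eq; lra) (/ (2 * Im tau))) as [n Hn].
  apply (HR n tau U). specialize (Hn n (le_n _)). rewrite Rabs_pos_eq in Hn by (apply pow_le; lra).
  unfold upper in U.
  apply Rle_trans with (/ (2 * Im tau) * Im tau); [right; field; lra|].
  apply Rmult_le_compat_r; lra.
Qed.

(** Weight -2 l: as Im(-1/tau) = Im tau / |tau|^2, the bound M (2 Im tau)^l is transported unchanged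
    by translation and inversion, and where Im tau >= 1/2 it is weaker than M. A family is allowed
    instead of one function, so that an orbit under SL2(Z) can be treated. *)
Lemma negative_weight_growth (F : (C -> C) -> Prop) (l : nat) (M : R) :
  0 <= M ->
  (forall V tau, F V -> / 2 <= Im tau -> Cmod (V tau) <= M) ->
  (forall V (e : R), F V -> (e = 1 \/ e = -1) -> exists V', F V' /\
     forall tau, upper tau -> Cmod (V tau) = Cmod (V' (tau + e)%C)) ->
  (forall V, F V -> exists V', F V' /\
     forall tau, upper tau -> Cmod (V tau) = Cmod tau ^ (2 * l) * Cmod (V' (- (1) / tau)%C)) ->
  forall V tau, F V -> upper tau -> Cmod (V tau) <= M * (2 * Im tau) ^ l.
Proof.
  intros PM HB HT HS V tau FV U. revert V FV.
  apply (upper_reduction (fun tau => forall V, F V -> Cmod (V tau) <= M * (2 * Im tau) ^ l)); [..|exact U]; clear tau U.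
  - intros tau L V FV. apply Rle_trans with (1 := HB V tau FV L).
    rewrite <- (Rmult_1_r M) at 1. apply Rmult_le_compat_l; [exact PM|].
    rewrite <- (pow1 l) at 1. apply pow_incr. lra.
  - intros tau U H V FV. destruct (HT V 1 FV (or_introl eq_refl)) as [V' [FV' E]].
    rewrite E by exact U. rewrite <- (Im_plus_R tau 1). apply H, FV'.
  - intros tau U H V FV. destruct (HT V (-1) FV (or_intror eq_refl)) as [V' [FV' E]].
    rewrite E by exact U. rewrite <- (Im_plus_R tau (-1)). apply H, FV'.
  - intros tau U H V FV. destruct (HS V FV) as [V' [FV' E]].
    rewrite E by exact U. specialize (H V' FV'). rewrite Im_neg_inv in H by exact U.
    assert (Pt : 0 < Cmod tau) by (apply Cmod_gt_0, upper_neq_0, U).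
    apply Rle_trans with (Cmod tau ^ (2 * l) * (M * (2 * (Im tau / Cmod tau ^ 2)) ^ l)).
    + apply Rmult_le_compat_l; [apply pow_le; lra|exact H].
    + right. rewrite pow_mult.
      replace (2 * Im tau) with (Cmod tau ^ 2 * (2 * (Im tau / Cmod tau ^ 2))) by (field; lra).
      rewrite (Rpow_mult_distr (Cmod tau ^ 2)). ring.
Qed.

(** The line Im tau = y is the circle of radius e^(-2 pi y/h) in the disc. Cauchy's estimate there
    bounds |a_n| e^(-2 pi n y/h) by M (2 y)^(l+1), which tends to 0 with y because the exponent is
    positive. *)
Lemma small_growth_zero (V : C -> C) a h l M : 0 < h -> 0 <= M -> dser a ->
  (forall tau, upper tau -> V tau = PS a (exp2ipi (tau / h)%C)) ->
  (forall tau, upper tau -> Cmod (V tau) <= M * (2 * Im tau) ^ S l) ->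
  forall n, a n = 0%C.
Proof.
  intros Ph PM D HV HB n.
  assert (PP := PI_RGT_0).
  assert (Pa := Cmod_ge_0 (a n)). assert (Pn := pos_INR n).
  set (k := 2 * PI / h). assert (Pk : 0 < k) by (apply Rdiv_lt_0_compat; lra).
  assert (Q : forall y, 0 < y <= / 2 -> Cmod (a n) <= y * (2 * M + Cmod (a n) * (k * INR n))).
  { intros y Hy.
    assert (E := Cauchy_estimate a (exp (- (k * y))) (M * (2 * y) ^ S l) n D).
    assert (B : Cmod (a n) * exp (- (k * y)) ^ n <= M * (2 * y) ^ S l).
    { apply E.
      - split; [apply exp_pos|]. rewrite <- exp_0. apply exp_increasing.
        generalize (Rmult_lt_0_compat _ _ Pk (proj1 Hy)). lra.
      - intros z Hz.
        assert (Nz : z <> 0%C) by (apply Cmod_gt_0; rewrite Hz; apply exp_pos).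
        assert (Lz : Cmod z < 1).
        { rewrite Hz, <- exp_0. apply exp_increasing. generalize (Rmult_lt_0_compat _ _ Pk (proj1 Hy)). lra. }
        destruct (exp2ipi_onto z h Ph Nz Lz) as [tau [U Et]].
        assert (Iy : Im tau = y).
        { rewrite <- Et, Cmod_exp2ipi, Im_div_pos in Hz by exact Ph. apply exp_inv in Hz.
          unfold k in Hz. apply Rmult_eq_reg_l with (2 * PI / h).
          - unfold Rdiv in *. lra.
          - apply Rgt_not_eq, Pk. }
        rewrite <- Et, <- HV by exact U. rewrite <- Iy. apply HB, U. }
    assert (L1 : 1 - k * y * INR n <= exp (- (k * y)) ^ n).
    { replace (exp (- (k * y)) ^ n) with (exp (- (k * y * INR n))).
      - generalize (exp_ineq1_le (- (k * y * INR n))). lra.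
      - rewrite <- Rpower_pow by apply exp_pos. unfold Rpower. rewrite ln_exp. f_equal. ring. }
    assert (L2 : (2 * y) ^ S l <= 2 * y).
    { simpl. rewrite <- (Rmult_1_r (2 * y)) at 3. apply Rmult_le_compat_l; [lra|].
      rewrite <- (pow1 l). apply pow_incr. lra. }
    assert (Cmod (a n) * (1 - k * y * INR n) <= Cmod (a n) * exp (- (k * y)) ^ n) by (apply Rmult_le_compat_l; lra).
    assert (M * (2 * y) ^ S l <= M * (2 * y)) by (apply Rmult_le_compat_l; lra).
    lra. }
  apply Cmod_eq_0. apply Rle_antisym; [|exact Pa].
  apply Rnot_lt_le. intros L.
  set (W := 2 * M + Cmod (a n) * (k * INR n)) in *.
  assert (PW : 0 <= W).
  { unfold W. apply Rplus_le_le_0_compat; [lra|]. apply Rmult_le_pos; [lra|]. apply Rmult_le_pos; lra. }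
  assert (Z1 : Rmin (/ 2) (Cmod (a n) / 2 / (W + 1)) <= / 2) by apply Rmin_l.
  assert (Z2 : Rmin (/ 2) (Cmod (a n) / 2 / (W + 1)) <= Cmod (a n) / 2 / (W + 1)) by apply Rmin_r.
  assert (Z3 : 0 < Rmin (/ 2) (Cmod (a n) / 2 / (W + 1))).
  { apply Rmin_pos; [lra|]. repeat apply Rdiv_lt_0_compat; lra. }
  set (y := Rmin (/ 2) (Cmod (a n) / 2 / (W + 1))) in *.
  specialize (Q y ltac:(lra)).
  assert (y * W <= Cmod (a n) / 2 / (W + 1) * (W + 1)) by (apply Rmult_le_compat; lra).
  replace (Cmod (a n) / 2 / (W + 1) * (W + 1)) with (Cmod (a n) / 2) in H by (field; lra).
  lra.
Qed.

(** * Partial fractions of 1/sin^2 and cot *)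

(** sin t >= t (1 - t^2/6), and 1 - (12/5)^2/6 is exactly 1/25. The range 12/5 is 3/5 times the
    crude bound 4 of pi. *)
Lemma sin_lower_bound t : 0 <= t <= 12 / 5 -> t / 25 <= sin t.
Proof.
  intros Ht. assert (P2 := PI2_3_2).
  destruct (sin_bound t 0 ltac:(lra) ltac:(unfold PI2 in *; lra)) as [B _].
  unfold sin_approx, sin_term in B. simpl in B.
  apply Rle_trans with (2 := B).
  replace (1 * (t * 1 / 1) + -1 * 1 * (t * (t * (t * 1)) / (1 + 1 + 1 + 1 + 1 + 1)))
    with (t - t * (t * t) / 6) by field.
  assert (t * t <= 12 / 5 * (12 / 5)) by nra.
  assert (t * (t * t) <= t * (12 / 5 * (12 / 5))) by (apply Rmult_le_compat_l; lra).
  lra.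
Qed.

(** For t < 0, e^t <= 1/(1 - t) gives 1 - e^t >= |t|/(1 + |t|), and 1 + |t| <= 9. The range 8 bounds
    2 pi. *)
Lemma exp_minus_1_bound t : -8 <= t <= 8 -> Rabs t / 9 <= Rabs (1 - exp t).
Proof.
  intros Ht. destruct (Rle_dec 0 t) as [L|L].
  - assert (E := exp_ineq1_le t). rewrite Rabs_pos_eq, (Rabs_left1 (1 - exp t)) by lra. lra.
  - assert (E := exp_ineq1_le (- t)). rewrite exp_Ropp in E.
    rewrite Rabs_left1 by lra. assert (Pe := exp_pos t).
    assert (E' : exp t * (1 - t) <= 1).
    { replace 1 with (exp t * / exp t) by (field; lra). apply Rmult_le_compat_l; [lra|].
      rewrite Rinv_r by lra. lra. }
    assert (L1 : exp t <= 1) by (rewrite <- exp_0; left; apply exp_increasing; lra).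
    rewrite Rabs_pos_eq by lra. nra.
Qed.

Lemma Rabs_square_le x y c : 0 < c -> Rabs x / c <= Rabs y -> x * x / (c * c) <= y * y.
Proof.
  intros Pc H.
  replace (x * x / (c * c)) with ((Rabs x / c) * (Rabs x / c)).
  - replace (y * y) with (Rabs y * Rabs y) by (rewrite <- Rabs_mult; apply Rabs_pos_eq, Rle_0_sqr).
    assert (0 <= Rabs x / c) by (apply Rmult_le_pos; [apply Rabs_pos|left; apply Rinv_0_lt_compat, Pc]).
    apply Rmult_le_compat; assumption.
  - replace (x * x) with (Rabs x * Rabs x) by (rewrite <- Rabs_mult; apply Rabs_pos_eq, Rle_0_sqr).
    field. lra.
Qed.

Lemma one_minus_exp2ipi_lower : exists c, 0 < c /\ forall z : C,
  Rabs (Re z) <= 3 / 5 -> Rabs (Im z) <= 1 -> c * Cmod z <= Cmod (1 - exp2ipi z)%C.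
Proof.
  assert (P2 := PI2_3_2). assert (P4 := PI_4).
  (* For z = a + i b the squared modulus is (1 - E)^2 + 4 E sin(pi a)^2 with E = e^(-2 pi b) >=
     e^(-8). Its two terms are at least b^2/81 and 4 e^(-8) a^2/625, and k is below both
     coefficients. *)
  set (k := exp (- 8) / 200).
  assert (Pe8 : 0 < exp (-8)) by apply exp_pos.
  assert (Le8 : exp (-8) <= 1) by (rewrite <- exp_0; left; apply exp_increasing; lra).
  assert (Pk : 0 < k) by (unfold k; lra).
  exists (sqrt k). split; [apply sqrt_lt_R0, Pk|].
  intros [a b] Ha Hb. unfold Re, Im in Ha, Hb; simpl in Ha, Hb.
  unfold Cmod. rewrite <- sqrt_mult_alt by lra. apply sqrt_le_1_alt.
  assert (Er : Re (2 * PI * Ci * (a, b))%C = - (2 * PI * b)) by (unfold Re, Ci, Cmult, RtoC; simpl; ring).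
  assert (Ei : Im (2 * PI * Ci * (a, b))%C = 2 * (PI * a)) by (unfold Im, Ci, Cmult, RtoC; simpl; ring).
  unfold exp2ipi, Cexp. rewrite Er, Ei.
  unfold Cminus, Cplus, Copp, RtoC. simpl fst. simpl snd.
  set (E := exp (- (2 * PI * b))).
  rewrite cos_2a_sin, sin_2a.
  assert (S2 := sin2_cos2 (PI * a)). unfold Rsqr in S2.
  set (s := sin (PI * a)) in *. set (co := cos (PI * a)) in *.
  replace ((1 + - (E * (1 - 2 * s * s))) ^ 2 + (0 + - (E * (2 * s * co))) ^ 2)
    with ((1 - E) * (1 - E) + 4 * E * (s * s) + 4 * E * E * (s * s) * (s * s + co * co - 1)) by ring.
  rewrite S2.
  assert (Hb' := Hb). apply Rabs_le_between in Hb'.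
  assert (Ha' := Ha). apply Rabs_le_between in Ha'.
  assert (PE : exp (-8) <= E).
  { unfold E. destruct (Req_dec (-8) (- (2 * PI * b))) as [<-|N]; [lra|].
    left. apply exp_increasing. nra. }
  assert (B1 : Rabs (2 * PI * b) / 9 <= Rabs (1 - E)).
  { rewrite <- (Rabs_Ropp (2 * PI * b)). unfold E. apply exp_minus_1_bound. nra. }
  assert (B1' : Rabs b / 9 <= Rabs (1 - E)).
  { apply Rle_trans with (2 := B1). rewrite !Rabs_mult, (Rabs_pos_eq 2), (Rabs_pos_eq PI) by lra.
    generalize (Rabs_pos b). nra. }
  assert (B2 : b * b / (9 * 9) <= (1 - E) * (1 - E)) by (apply Rabs_square_le; lra).
  assert (B3 : Rabs a / 25 <= Rabs s).
  { unfold s. destruct (Rle_dec 0 a) as [L|L].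
    - assert (0 <= PI * a <= 12 / 5) by (split; nra).
      assert (Q := sin_lower_bound (PI * a) H).
      rewrite (Rabs_pos_eq a) by lra. rewrite Rabs_pos_eq by lra. nra.
    - assert (0 <= PI * (- a) <= 12 / 5) by (split; nra).
      assert (Q := sin_lower_bound (PI * (- a)) H).
      rewrite (Rabs_left1 a) by lra. rewrite <- (Rabs_Ropp (sin _)), <- sin_neg.
      replace (- (PI * a)) with (PI * - a) by ring. rewrite Rabs_pos_eq by lra. nra. }
  assert (B4 : a * a / (25 * 25) <= s * s) by (apply Rabs_square_le; lra).
  assert (B5 : 4 * exp (-8) * (a * a / (25 * 25)) <= 4 * E * (s * s)).
  { apply Rmult_le_compat; [lra|nra|lra|exact B4]. }
  unfold k. simpl. nra.
Qed.

Lemma csum_fold g m : csum g (2 * m) = csum (fun k => g k + g (2 * m - 1 - k)%nat)%C m.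
Proof.
  rewrite csum_plus. replace (2 * m)%nat with (m + m)%nat at 1 by lia. rewrite csum_add. f_equal.
  rewrite csum_rev. apply csum_ext. intros k Hk. f_equal. lia.
Qed.

(** Sums over the integers are folded into sums over k >= 0 of the terms k and -1-k. *)
Definition foldZ (f : Z -> C) (k : nat) : C := (f (Z.of_nat k) + f (- 1 - Z.of_nat k)%Z)%C.

Definition ZSum (f : Z -> C) : C := CSeries (foldZ f).

Definition pow2 (n : nat) : R := 2 ^ n.

Lemma pow2_pos n : 0 < pow2 n.
Proof. apply pow_lt; lra. Qed.

Lemma pow2_C n : RtoC (pow2 n) <> 0%C.
Proof. apply Cneq_R. generalize (pow2_pos n). lra. Qed.

Lemma pow2_S n : RtoC (pow2 (S n)) = (2 * pow2 n)%C.
Proof. unfold pow2. simpl. now rewrite RtoC_mult. Qed.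

Lemma pow2_INR n : pow2 n = INR (2 ^ n).
Proof. unfold pow2. rewrite pow_INR. reflexivity. Qed.

(** * Iterated duplication formulas *)

Section Halving.

Variables (psi : C -> C) (kappa : C).
Hypothesis psi_periodic : forall x, psi (x + 1)%C = psi x.
Hypothesis psi_half : forall x, exp2ipi x <> 1%C ->
  psi x = (kappa * (psi (x / 2) + psi ((x + 1) / 2)))%C.

Lemma exp2ipi_half (x : C) : exp2ipi x <> 1%C -> exp2ipi (x / 2)%C <> 1%C.
Proof.
  intros N E. apply N. replace x with (INR 2 * (x / 2))%C by (replace (INR 2) with 2 by (simpl; ring); field).
  rewrite exp2ipi_pow, E. apply Cpow_1_l.
Qed.

Lemma exp2ipi_plus_Z (x : C) (k : Z) : exp2ipi (x + IZR k)%C = exp2ipi x.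
Proof. rewrite exp2ipi_plus, exp2ipi_Z. ring. Qed.

Lemma psi_half' (x : C) : exp2ipi x <> 1%C ->
  psi x = (kappa * (psi (x / 2) + psi ((x - 1) / 2)))%C.
Proof.
  intros H. rewrite psi_half by exact H. do 2 f_equal.
  rewrite <- (psi_periodic ((x - 1) / 2)). f_equal. field.
Qed.

Lemma exp2ipi_pow2 (x : C) n : exp2ipi x <> 1%C -> exp2ipi (x / pow2 n)%C <> 1%C.
Proof.
  induction n as [|n IH]; intros H.
  - unfold pow2; simpl. replace (x / 1)%C with x by field. exact H.
  - rewrite pow2_S. replace (x / (2 * pow2 n))%C with (x / pow2 n / 2)%C by (field; apply pow2_C).
    apply exp2ipi_half, IH, H.
Qed.

Lemma exp2ipi_shift_neq_1 (x : C) (k : Z) : exp2ipi x <> 1%C -> exp2ipi (x + IZR k)%C <> 1%C.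
Proof. now rewrite exp2ipi_plus_Z. Qed.

(** The two forms of the duplication formula keep the range of integers symmetric: k >= 0 splits
    into k and k - 2^(n+1), while -1 - k splits into itself and 2^(n+1) - 1 - k. The new terms are
    the folded partners of index 2^(n+1) - 1 - k, which is the pairing of [csum_fold]. *)
Lemma halving_sum (x : C) n : exp2ipi x <> 1%C ->
  psi x = (kappa ^ S n * csum (fun k => psi ((x + IZR (Z.of_nat k)) / pow2 (S n))
    + psi ((x + IZR (- 1 - Z.of_nat k)) / pow2 (S n))) (2 ^ n))%C.
Proof.
  intros H. induction n as [|n IH].
  - rewrite psi_half' by exact H. unfold pow2; simpl.
    replace ((x + 0) / (2 * 1)%R)%C with (x / 2)%C by (rewrite Rmult_1_r; field).
    assert (E1 : RtoC (-1) = (- (1))%C) by (apply injective_projections; simpl; ring).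
    replace ((x + -1) / (2 * 1)%R)%C with ((x - 1) / 2)%C by (rewrite Rmult_1_r, E1; field).
    ring.
  - rewrite IH. rewrite (Cpow_S _ (S n)), <- Cmult_assoc, (Cmult_comm kappa), <- Cmult_assoc. f_equal.
    change (2 ^ S n)%nat with (2 * 2 ^ n)%nat. rewrite csum_fold, Cmult_comm, <- csum_scal.
    apply csum_ext. intros k Hk.
    assert (N1 : exp2ipi ((x + IZR (Z.of_nat k)) / pow2 (S n))%C <> 1%C)
      by apply exp2ipi_pow2, exp2ipi_shift_neq_1, H.
    assert (N2 : exp2ipi ((x + IZR (- 1 - Z.of_nat k)) / pow2 (S n))%C <> 1%C)
      by apply exp2ipi_pow2, exp2ipi_shift_neq_1, H.
    rewrite (psi_half' _ N1), (psi_half _ N2).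
    assert (Ek : Z.of_nat (2 * 2 ^ n - 1 - k) = (Z.of_nat (2 ^ S n) - 1 - Z.of_nat k)%Z)
      by (simpl; lia).
    rewrite Ek.
    assert (Ep : RtoC (IZR (Z.of_nat (2 ^ S n))) = pow2 (S n)) by (now rewrite <- INR_IZR_INZ, pow2_INR).
    replace (- 1 - (Z.of_nat (2 ^ S n) - 1 - Z.of_nat k))%Z with (Z.of_nat k - Z.of_nat (2 ^ S n))%Z by ring.
    replace (Z.of_nat (2 ^ S n) - 1 - Z.of_nat k)%Z with (Z.of_nat (2 ^ S n) + (- 1 - Z.of_nat k))%Z by ring.
    rewrite (plus_IZR (Z.of_nat (2 ^ S n))), (minus_IZR (Z.of_nat k)), RtoC_plus, RtoC_minus, Ep, (pow2_S (S n)).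
    assert (NP := pow2_C (S n)).
    set (p := RtoC (pow2 (S n))) in *. set (i := RtoC (IZR (Z.of_nat k))). set (j := RtoC (IZR (- 1 - Z.of_nat k))).
    replace ((x + i) / p / 2)%C with ((x + i) / (2 * p))%C by (field; exact NP).
    replace (((x + i) / p - 1) / 2)%C with ((x + (i - p)) / (2 * p))%C by (field; exact NP).
    replace ((x + j) / p / 2)%C with ((x + j) / (2 * p))%C by (field; exact NP).
    replace (((x + j) / p + 1) / 2)%C with ((x + (p + j)) / (2 * p))%C by (field; exact NP).
    ring.
Qed.

End Halving.

Lemma finite_min (u : nat -> R) N : (forall k, 0 < u k) -> exists d, 0 < d /\ forall k, (k < N)%nat -> d <= u k.
Proof.
  intros H. induction N as [|N [d [Pd Hd]]]; [exists 1; split; [lra|intros; lia]|].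
  exists (Rmin d (u N)). split; [apply Rmin_pos; auto|].
  intros k Hk. destruct (Nat.eq_dec k N) as [->|Nk]; [apply Rmin_r|].
  apply Rle_trans with (1 := Rmin_l _ _). apply Hd. lia.
Qed.

Lemma IZR_of_nat_INR k : IZR (Z.of_nat k) = INR k.
Proof. symmetry. apply INR_IZR_INZ. Qed.

Lemma IZR_neg_succ k : IZR (- 1 - Z.of_nat k) = - (1 + INR k).
Proof. rewrite minus_IZR, IZR_of_nat_INR. ring. Qed.

Lemma Cmod_plus_R_lower (x : C) (t : R) : Rabs t - Cmod x <= Cmod (x + t)%C.
Proof.
  generalize (Cmod_triangle (x + t)%C (- x)%C). rewrite Cmod_opp.
  replace (x + t + - x)%C with (RtoC t) by ring. rewrite Cmod_R. lra.
Qed.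

(** As x is not an integer, the finitely many small k are covered by a minimum; once k > 2 |x| + 1
    the triangle inequality gives the constant 1/4. *)
Lemma integer_shift_lower (x : C) : exp2ipi x <> 1%C -> exists d, 0 < d /\ forall k : nat,
  d * (1 + INR k) <= Cmod (x + IZR (Z.of_nat k))%C /\
  d * (1 + INR k) <= Cmod (x + IZR (- 1 - Z.of_nat k))%C.
Proof.
  intros H.
  assert (P : forall k : Z, 0 < Cmod (x + IZR k)%C).
  { intros k. apply Cmod_gt_0. intros E. apply H. rewrite <- (exp2ipi_plus_Z x k), E. apply (exp2ipi_Z 0). }
  set (u := fun k : nat => Rmin (Cmod (x + IZR (Z.of_nat k))%C) (Cmod (x + IZR (- 1 - Z.of_nat k))%C) / (1 + INR k)).
  destruct (INR_archimed 1 (2 * Cmod x + 1) Rlt_0_1) as [N HN]. rewrite Rmult_1_r in HN.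
  destruct (finite_min u N) as [d [Pd Hd]].
  { intros k. unfold u. apply Rdiv_lt_0_compat; [apply Rmin_pos; apply P|generalize (pos_INR k); lra]. }
  exists (Rmin d (/ 4)). split; [apply Rmin_pos; lra|]. intros k.
  assert (Pk := pos_INR k).
  destruct (Nat.lt_ge_cases k N) as [L|L].
  - specialize (Hd k L). unfold u in Hd.
    assert (Q : Rmin d (/ 4) * (1 + INR k) <= Rmin (Cmod (x + IZR (Z.of_nat k))%C) (Cmod (x + IZR (- 1 - Z.of_nat k))%C)).
    { apply Rmult_le_reg_r with (/ (1 + INR k)); [apply Rinv_0_lt_compat; lra|].
      rewrite Rmult_assoc, Rinv_r, Rmult_1_r by lra. apply Rle_trans with (1 := Rmin_l _ _). exact Hd. }
    split; apply Rle_trans with (1 := Q); [apply Rmin_l|apply Rmin_r].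
  - apply le_INR in L. assert (M := Rmin_r d (/ 4)).
    assert (Rmin d (/ 4) * (1 + INR k) <= / 4 * (1 + INR k)) by (apply Rmult_le_compat_r; lra).
    assert (Px := Cmod_ge_0 x).
    rewrite IZR_of_nat_INR, IZR_neg_succ.
    assert (A := Cmod_plus_R_lower x (INR k)). assert (B := Cmod_plus_R_lower x (- (1 + INR k))).
    rewrite Rabs_Ropp in B. rewrite Rabs_pos_eq in A, B by lra. split; lra.
Qed.

Lemma ex_series_inv_square : ex_series (fun k => / ((1 + INR k) * (1 + INR k))).
Proof.
  apply ex_series_rsum_bound with 2.
  - intros k. left. apply Rinv_0_lt_compat. generalize (pos_INR k). nra.
  - assert (Q : forall n, rsum (fun k => / ((1 + INR k) * (1 + INR k))) (S n) <= 2 - / (1 + INR n)).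
    { induction n as [|n IH].
      - simpl. rewrite Rplus_0_r, Rmult_1_l, Rinv_1. lra.
      - change (rsum (fun k => / ((1 + INR k) * (1 + INR k))) (S (S n)))
          with (rsum (fun k => / ((1 + INR k) * (1 + INR k))) (S n) + / ((1 + INR (S n)) * (1 + INR (S n)))).
        rewrite S_INR in *. assert (P := pos_INR n). set (t := INR n) in *.
        assert (E : / ((1 + (t + 1)) * (1 + (t + 1))) <= / (1 + t) - / (1 + (t + 1))).
        { replace (/ (1 + t) - / (1 + (t + 1))) with (/ ((1 + t) * (1 + (t + 1)))) by (field; lra).
          apply Rinv_le_contravar; nra. }
        lra. }
    intros [|n]; [simpl; lra|]. apply Rle_trans with (1 := Q n).
    assert (0 < / (1 + INR n)) by (apply Rinv_0_lt_compat; generalize (pos_INR n); lra). lra.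
Qed.

Lemma Clim_scaled_exp (a : C) :
  Clim (fun n => pow2 (S n) * (Cexp (a / pow2 (S n)) - 1))%C a.
Proof.
  intros eps P. set (m := Cmod a + 1). assert (Pa := Cmod_ge_0 a).
  destruct (Cexp_derive_0 (eps / (2 * m))) as [d [Pd K]].
  { apply Rdiv_lt_0_compat; [exact P|unfold m; lra]. }
  destruct (Pow_x_infinity 2 ltac:(rewrite Rabs_pos_eq; lra) (m / d)) as [N HN].
  exists N. intros n Hn. specialize (HN (S n) ltac:(lia)).
  rewrite Rabs_pos_eq in HN by (apply pow_le; lra). fold (pow2 (S n)) in HN.
  assert (Pp := pow2_pos (S n)). set (p := pow2 (S n)) in *.
  assert (Np : RtoC p <> 0%C) by (apply Cneq_R; lra).
  assert (Ma : Cmod (a / p)%C = Cmod a / p).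
  { rewrite Cmod_div, Cmod_R, Rabs_pos_eq by (auto; lra). reflexivity. }
  assert (L : Cmod (a / p)%C < d).
  { rewrite Ma. apply Rmult_lt_reg_r with p; [exact Pp|]. unfold Rdiv.
    rewrite Rmult_assoc, Rinv_l, Rmult_1_r by lra.
    apply Rlt_le_trans with m; [unfold m; lra|].
    apply Rge_le in HN. replace m with (m / d * d) by (field; lra). rewrite (Rmult_comm d).
    apply Rmult_le_compat_r; lra. }
  specialize (K _ L).
  replace (p * (Cexp (a / p) - 1) - a)%C with (p * (Cexp (a / p) - 1 - a / p))%C by (field; exact Np).
  rewrite Cmod_mult, Cmod_R, Rabs_pos_eq by lra.
  apply Rle_lt_trans with (p * (eps / (2 * m) * Cmod (a / p)%C)); [apply Rmult_le_compat_l; lra|].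
  rewrite Ma. replace (p * (eps / (2 * m) * (Cmod a / p))) with (eps * (Cmod a / (2 * m))) by (field; unfold m; lra).
  rewrite <- (Rmult_1_r eps) at 2. apply Rmult_lt_compat_l; [exact P|].
  apply Rmult_lt_reg_r with (2 * m); [unfold m; lra|].
  unfold Rdiv. rewrite Rmult_assoc, Rinv_l by (unfold m; lra). unfold m. lra.
Qed.

Lemma Clim_val u l l' : l = l' -> Clim u l -> Clim u l'.
Proof. now intros ->. Qed.

Definition twopii : C := (2 * PI * Ci)%C.

Lemma twopii_neq_0 : twopii <> 0%C.
Proof.
  unfold twopii. assert (P := PI_RGT_0). repeat apply Cmult_neq_0.
  - apply Cneq_R; lra.
  - apply Cneq_R; lra.
  - intros E. injection E. lra.
Qed.

Lemma Clim_scaled_exp2ipi (a : C) :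
  Clim (fun n => pow2 (S n) * (exp2ipi (a / pow2 (S n)) - 1))%C (twopii * a)%C.
Proof.
  apply Clim_ext with (2 := Clim_scaled_exp (twopii * a)%C). intros n.
  unfold exp2ipi. replace (2 * PI * Ci * (a / pow2 (S n)))%C with (twopii * a / pow2 (S n))%C; [reflexivity|].
  unfold twopii. field. apply pow2_C.
Qed.

Lemma Clim_inv_pow2 : Clim (fun n => / pow2 (S n))%C 0%C.
Proof.
  intros eps P.
  destruct (Pow_x_infinity 2 ltac:(rewrite Rabs_pos_eq; lra) (/ eps + 1)) as [N HN].
  exists N. intros n Hn. specialize (HN (S n) ltac:(lia)).
  rewrite Rabs_pos_eq in HN by (apply pow_le; lra). fold (pow2 (S n)) in HN.
  assert (Pp := pow2_pos (S n)).
  replace (/ pow2 (S n) - 0)%C with (/ pow2 (S n))%C by ring.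
  rewrite Cmod_inv, Cmod_R, Rabs_pos_eq by (try apply pow2_C; lra).
  assert (0 < / eps) by (apply Rinv_0_lt_compat, P).
  rewrite <- (Rinv_inv eps). apply Rinv_lt_contravar; [|lra]. apply Rmult_lt_0_compat; lra.
Qed.

Lemma Clim_exp2ipi_pow2 (a : C) : Clim (fun n => exp2ipi (a / pow2 (S n)))%C 1%C.
Proof.
  apply Clim_ext with (fun n => / pow2 (S n) * (pow2 (S n) * (exp2ipi (a / pow2 (S n)) - 1)) + 1)%C.
  - intros n. field. apply pow2_C.
  - apply Clim_val with (0 * (twopii * a) + 1)%C; [ring|].
    apply Clim_plus; [|apply Clim_const]. apply Clim_mult; [apply Clim_inv_pow2|apply Clim_scaled_exp2ipi].
Qed.

(** The points (x + k) / 2^(n+1) with -2^n <= k < 2^n lie, for large n, in the strip where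
    [one_minus_exp2ipi_lower] applies. *)
Lemma halving_strip (x : C) : exists N, forall n k, (N <= n)%nat -> (k < 2 ^ n)%nat ->
  forall z, z = (x + IZR (Z.of_nat k))%C \/ z = (x + IZR (- 1 - Z.of_nat k))%C ->
  Rabs (Re (z / pow2 (S n))%C) <= 3 / 5 /\ Rabs (Im (z / pow2 (S n))%C) <= 1.
Proof.
  (* After division by 2^(n+1) the integer contributes at most 1/2 and x at most 1/10, which add up
     to 3/5. *)
  destruct (Pow_x_infinity 2 ltac:(rewrite Rabs_pos_eq; lra) (5 * Cmod x)) as [N HN].
  exists N. intros n k Hn Hk z Hz. specialize (HN n Hn).
  rewrite Rabs_pos_eq in HN by (apply pow_le; lra). fold (pow2 n) in HN.
  assert (Pp := pow2_pos n).
  assert (Sp : pow2 (S n) = 2 * pow2 n) by reflexivity.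
  assert (Lk : 1 + INR k <= pow2 n).
  { rewrite pow2_INR. rewrite Rplus_comm, <- S_INR. apply le_INR. lia. }
  assert (Pk := pos_INR k).
  assert (Bx := re_le_Cmod x). assert (By := im_le_Cmod x).
  assert (Er : Re (z / pow2 (S n))%C = Re z / pow2 (S n)).
  { rewrite Sp. destruct z. unfold Cdiv, Cinv, Cmult, Re, RtoC; simpl. field. lra. }
  rewrite Er, Im_div_pos by (rewrite Sp; lra).
  assert (Z : exists t, Rabs t <= pow2 n /\ z = (x + RtoC t)%C).
  { destruct Hz as [->| ->].
    - exists (IZR (Z.of_nat k)). split; [|reflexivity]. rewrite IZR_of_nat_INR, Rabs_pos_eq; lra.
    - exists (IZR (- 1 - Z.of_nat k)). split; [|reflexivity]. rewrite IZR_neg_succ, Rabs_Ropp, Rabs_pos_eq; lra. }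
  destruct Z as [t [Ht ->]].
  assert (R1 : Re (x + t)%C = Re x + t) by reflexivity.
  rewrite R1, Im_plus_R.
  assert (D : forall u v, Rabs u <= v * pow2 (S n) -> Rabs (u / pow2 (S n)) <= v).
  { intros u v H. unfold Rdiv. rewrite Rabs_mult, Rabs_inv, (Rabs_pos_eq (pow2 (S n))) by (rewrite Sp; lra).
    apply Rmult_le_reg_r with (pow2 (S n)); [rewrite Sp; lra|].
    rewrite Rmult_assoc, Rinv_l, Rmult_1_r by (rewrite Sp; lra). exact H. }
  split; apply D; rewrite Sp.
  - apply Rle_trans with (1 := Rabs_triang _ _). lra.
  - lra.
Qed.

Lemma Clim_div u v a b : Clim u a -> Clim v b -> b <> 0%C ->
  Clim (fun n => u n / v n)%C (a / b)%C.
Proof. intros Hu Hv N. apply Clim_mult; [exact Hu|]. apply Clim_inv; assumption. Qed.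

(** Supplies the summable bound of order 1/(1+k)^2, uniform in n, for the terms of an iterated
    duplication formula: the denominators grow like 1 + k and the numerators stay below e^8, as 2 pi
    <= 8. *)
Lemma halving_lower (x : C) : exp2ipi x <> 1%C -> exists N b, 0 < b /\
  forall n k, (N <= n)%nat -> (k < 2 ^ n)%nat ->
  forall z, z = (x + IZR (Z.of_nat k))%C \/ z = (x + IZR (- 1 - Z.of_nat k))%C ->
  b * (1 + INR k) <= Cmod (pow2 (S n) * (exp2ipi (z / pow2 (S n)) - 1))%C /\
  Cmod (exp2ipi (z / pow2 (S n))%C) <= exp 8.
Proof.
  intros H. destruct (halving_strip x) as [N HN].
  destruct (integer_shift_lower x H) as [d [Pd Hd]].
  destruct one_minus_exp2ipi_lower as [c [Pc Hc]].
  exists N, (c * d). split; [apply Rmult_lt_0_compat; assumption|].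
  intros n k Hn Hk z Hz. destruct (HN n k Hn Hk z Hz) as [B1 B2].
  specialize (Hc _ B1 B2). assert (Pp := pow2_pos (S n)). set (p := pow2 (S n)) in *.
  assert (Np : RtoC p <> 0%C) by (apply Cneq_R; lra).
  assert (D : d * (1 + INR k) <= Cmod z) by (destruct Hz as [->| ->]; apply Hd).
  split.
  - rewrite Cmod_mult, Cmod_R, Rabs_pos_eq by lra.
    replace (Cmod (exp2ipi (z / p) - 1)%C) with (Cmod (1 - exp2ipi (z / p))%C)
      by (rewrite <- Cmod_opp; f_equal; ring).
    rewrite Cmod_div, Cmod_R, (Rabs_pos_eq p) in Hc by (auto; lra).
    apply Rle_trans with (p * (c * (Cmod z / p))); [|apply Rmult_le_compat_l; lra].
    replace (p * (c * (Cmod z / p))) with (c * Cmod z) by (field; lra).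
    rewrite Rmult_assoc. apply Rmult_le_compat_l; lra.
  - rewrite Cmod_exp2ipi. assert (PP := PI_RGT_0). assert (P4 := PI_4).
    apply Rabs_le_between in B2.
    destruct (Req_dec (- (2 * PI * Im (z / p)%C)) 8) as [->|Ne]; [lra|].
    left. apply exp_increasing. nra.
Qed.

Lemma exp2ipi_half_integer : exp2ipi (1 / 2)%C = (- (1))%C.
Proof.
  unfold exp2ipi. replace (2 * PI * Ci * (1 / 2))%C with (PI * Ci)%C by field.
  unfold Cexp, Re, Im, Ci, RtoC, Cmult, Copp; simpl.
  replace (PI * 0 - 0 * 1) with 0 by ring. replace (PI * 1 + 0 * 0) with PI by ring.
  rewrite exp_0, cos_PI, sin_PI. f_equal; ring.
Qed.

Lemma exp2ipi_halves (x : C) :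
  exp2ipi x = (exp2ipi (x / 2) * exp2ipi (x / 2))%C /\
  exp2ipi ((x + 1) / 2)%C = (- exp2ipi (x / 2))%C.
Proof.
  split.
  - rewrite <- exp2ipi_plus. f_equal. field.
  - replace ((x + 1) / 2)%C with (x / 2 + 1 / 2)%C by field.
    rewrite exp2ipi_plus, exp2ipi_half_integer. ring.
Qed.

(** [Rw x] is - 1 / (4 sin(pi x)^2) and [Kw x] is i cot(pi x). *)
Definition Rw (x : C) : C := (exp2ipi x / ((1 - exp2ipi x) * (1 - exp2ipi x)))%C.
Definition Kw (x : C) : C := ((1 + exp2ipi x) / (1 - exp2ipi x))%C.

Lemma Cminus_neq_0 (x y : C) : x <> y -> (x - y)%C <> 0%C.
Proof. intros N E. apply N. replace x with (x - y + y)%C by ring. rewrite E. ring. Qed.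

Lemma Cminus_neq_0_sym (x y : C) : (x - y)%C <> 0%C -> (y - x)%C <> 0%C.
Proof. intros N E. apply N. replace (x - y)%C with (- (y - x))%C by ring. rewrite E. ring. Qed.

Lemma half_neq (x : C) : exp2ipi x <> 1%C ->
  (1 - exp2ipi (x / 2))%C <> 0%C /\ (1 + exp2ipi (x / 2))%C <> 0%C /\ (1 - exp2ipi x)%C <> 0%C.
Proof.
  intros H. destruct (exp2ipi_halves x) as [E _]. repeat split; intros Z; apply H; rewrite E.
  - replace (exp2ipi (x / 2)) with (1 - (1 - exp2ipi (x / 2)))%C by ring. rewrite Z. ring.
  - replace (exp2ipi (x / 2)) with ((1 + exp2ipi (x / 2)) - 1)%C by ring. rewrite Z. ring.
  - rewrite <- E. replace (exp2ipi x) with (1 - (1 - exp2ipi x))%C by ring. rewrite Z. ring.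
Qed.

Lemma exp2ipi_plus_1 (x : C) : exp2ipi (x + 1)%C = exp2ipi x.
Proof. apply (exp2ipi_plus_Z x 1). Qed.

(** With u = e^(pi i x), the points x/2 and (x+1)/2 correspond to u and -u, and the duplication
    formula is an identity of rational functions of u. *)
Lemma Rw_half (x : C) : exp2ipi x <> 1%C -> Rw x = (/ 4 * (Rw (x / 2) + Rw ((x + 1) / 2)))%C.
Proof.
  intros H. destruct (half_neq x H) as [N1 [N2 N3]]. destruct (exp2ipi_halves x) as [E1 E2].
  unfold Rw. rewrite E2. rewrite E1 in *. set (u := exp2ipi (x / 2)) in *.
  field. repeat split; auto. replace (1 - - u)%C with (1 + u)%C by ring. exact N2.
Qed.

Lemma Kw_half (x : C) : exp2ipi x <> 1%C -> Kw x = (/ 2 * (Kw (x / 2) + Kw ((x + 1) / 2)))%C.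
Proof.
  intros H. destruct (half_neq x H) as [N1 [N2 N3]]. destruct (exp2ipi_halves x) as [E1 E2].
  unfold Kw. rewrite E2. rewrite E1 in *. set (u := exp2ipi (x / 2)) in *.
  field. repeat split; auto. replace (1 - - u)%C with (1 + u)%C by ring. exact N2.
Qed.

Lemma pow_inv_pow2 n : ((/ 2) ^ n)%C = (/ pow2 n)%C.
Proof.
  induction n as [|n IH]; [unfold pow2; simpl; field|].
  rewrite Cpow_S, IH, pow2_S. field. apply pow2_C.
Qed.

Lemma pow_inv_4 n : ((/ 4) ^ n)%C = (/ (pow2 n * pow2 n))%C.
Proof.
  replace (/ 4)%C with (/ 2 * / 2)%C by field.
  rewrite Cpow_mult_l, pow_inv_pow2. field. apply pow2_C.
Qed.

(** [Tannery] for finite sums of growing length 2^n, extended by zero; since k < 2^n as soon as n >=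
    k, the truncation does not disturb the termwise limits. *)
Lemma halving_limit (t : nat -> nat -> C) (g : nat -> C) (v : C) (s : nat -> R) N :
  ex_series s ->
  (forall n k, (N <= n)%nat -> (k < 2 ^ n)%nat -> Cmod (t n k) <= s k) ->
  (forall k, 0 <= s k) ->
  (forall k, Clim (fun n => t n k) (g k)) ->
  (forall n, csum (t n) (2 ^ n) = v) ->
  asum g /\ CSeries g = v.
Proof.
  intros Es Hb Ps Hl Hv.
  set (f := fun n k => if (k <? 2 ^ n)%nat then t n k else 0%C).
  destruct (Tannery f g s N Es) as [A L].
  - intros n k Hn. unfold f. destruct (Nat.ltb_spec k (2 ^ n)); [auto|]. rewrite Cmod_0. apply Ps.
  - intros k. apply Clim_ext_loc with (u := fun n => t n k) (N0 := k); [|apply Hl].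
    intros n Hn. unfold f. destruct (Nat.ltb_spec k (2 ^ n)) as [_|H]; [reflexivity|].
    exfalso. assert (k < 2 ^ k)%nat by (apply Nat.pow_gt_lin_r; lia).
    assert (2 ^ k <= 2 ^ n)%nat by (apply Nat.pow_le_mono_r; lia). lia.
  - split; [exact A|]. apply (Clim_unique _ _ _ L).
    apply Clim_ext with (fun _ => v); [|apply Clim_const].
    intros n. rewrite (proj2 (CSeries_finite (f n) (2 ^ n)
      ltac:(intros k Hk; unfold f; rewrite (proj2 (Nat.ltb_ge k (2 ^ n)) Hk); reflexivity))).
    rewrite <- (Hv n). apply csum_ext. intros k Hk. unfold f.
    now rewrite (proj2 (Nat.ltb_lt k (2 ^ n)) Hk).
Qed.

Lemma exp2ipi_neq_1_shift (x : C) (k : Z) : exp2ipi x <> 1%C -> (x + IZR k)%C <> 0%C.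
Proof. intros H E. apply H. rewrite <- (exp2ipi_plus_Z x k), E. apply (exp2ipi_Z 0). Qed.

Lemma scaled_ne_0 (x : C) (k : Z) n : exp2ipi x <> 1%C ->
  (exp2ipi ((x + IZR k) / pow2 n) - 1)%C <> 0%C.
Proof. intros H. apply Cminus_neq_0, exp2ipi_pow2. now rewrite exp2ipi_plus_Z. Qed.

Lemma ex_series_inv_square_scal M : ex_series (fun k => M * / ((1 + INR k) * (1 + INR k))).
Proof. apply ex_series_Rscal, ex_series_inv_square. Qed.

(** The general term 4^(-n-1) [Rw] ((x+k)/2^(n+1)) tends to 1/(2 pi i (x+k))^2, because [Rw] has a
    double pole at 0. This is pi^2/sin(pi x)^2 as the sum of the 1/(x+k)^2. *)
Lemma Lipschitz2 (x : C) : exp2ipi x <> 1%C ->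
  asum (foldZ (fun k => / ((x + IZR k) * (x + IZR k)))%C) /\
  ZSum (fun k => / ((x + IZR k) * (x + IZR k)))%C = (twopii * twopii * Rw x)%C.
Proof.
  intros H. destruct (halving_lower x H) as [N [b [Pb HN]]].
  assert (T0 := twopii_neq_0).
  set (r := fun (n : nat) (z : C) => (exp2ipi (z / pow2 (S n)) /
     ((pow2 (S n) * (exp2ipi (z / pow2 (S n)) - 1)) * (pow2 (S n) * (exp2ipi (z / pow2 (S n)) - 1))))%C).
  set (h := fun z : C => (1 / ((twopii * z) * (twopii * z)))%C).
  assert (Q : asum (fun k => h (x + IZR (Z.of_nat k)) + h (x + IZR (- 1 - Z.of_nat k)))%C /\
    CSeries (fun k => h (x + IZR (Z.of_nat k)) + h (x + IZR (- 1 - Z.of_nat k)))%C = Rw x).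
  { apply (halving_limit (fun n k => r n (x + IZR (Z.of_nat k)) + r n (x + IZR (- 1 - Z.of_nat k)))%C _ _
      (fun k => 2 * (exp 8 / (b * b)) * / ((1 + INR k) * (1 + INR k))) N).
    - apply ex_series_inv_square_scal.
    - intros n k Hn Hk.
      assert (B : forall z, z = (x + IZR (Z.of_nat k))%C \/ z = (x + IZR (- 1 - Z.of_nat k))%C ->
        Cmod (r n z) <= exp 8 / (b * b) * / ((1 + INR k) * (1 + INR k))).
      { intros z Hz. destruct (HN n k Hn Hk z Hz) as [B1 B2]. unfold r.
        set (e := (pow2 (S n) * (exp2ipi (z / pow2 (S n)) - 1))%C) in *.
        assert (Pk := pos_INR k).
        assert (P1 : 0 < b * (1 + INR k)) by (apply Rmult_lt_0_compat; lra).
        assert (Ne : e <> 0%C) by (apply Cmod_gt_0; lra).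
        rewrite Cmod_div, Cmod_mult by (apply Cmult_neq_0; exact Ne).
        replace (exp 8 / (b * b) * / ((1 + INR k) * (1 + INR k)))
          with (exp 8 * / ((b * (1 + INR k)) * (b * (1 + INR k)))) by (field; lra).
        apply Rmult_le_compat; [apply Cmod_ge_0| |exact B2|].
        - left. apply Rinv_0_lt_compat. apply Rmult_lt_0_compat; lra.
        - apply Rinv_le_contravar; [apply Rmult_lt_0_compat; lra|]. apply Rmult_le_compat; lra. }
      apply Rle_trans with (1 := Cmod_triangle _ _).
      assert (U1 := B _ (or_introl eq_refl)). assert (U2 := B _ (or_intror eq_refl)). lra.
    - intros k. assert (Pk := pos_INR k). assert (Pe := exp_pos 8).
      apply Rmult_le_pos.
      + apply Rmult_le_pos; [lra|]. left. apply Rdiv_lt_0_compat; [lra|apply Rmult_lt_0_compat; lra].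
      + left. apply Rinv_0_lt_compat. apply Rmult_lt_0_compat; lra.
    - intros k.
      assert (L : forall z : C, z <> 0%C -> Clim (fun n => r n z) (h z)).
      { intros z Nz. unfold r, h. apply Clim_div; [apply Clim_exp2ipi_pow2| |apply Cmult_neq_0; apply Cmult_neq_0; assumption].
        apply Clim_mult; apply Clim_scaled_exp2ipi. }
      apply Clim_plus; apply L; now apply exp2ipi_neq_1_shift.
    - intros n. rewrite (halving_sum Rw (/ 4)%C) with (n := n).
      + rewrite <- csum_scal. apply csum_ext. intros k Hk. rewrite pow_inv_4. unfold r, Rw.
        assert (N1 := scaled_ne_0 x (Z.of_nat k) (S n) H).
        assert (N2 := scaled_ne_0 x (- 1 - Z.of_nat k) (S n) H).
        assert (NP := pow2_C (S n)).
        set (w1 := exp2ipi _) in *. set (w2 := exp2ipi ((x + IZR (- 1 - Z.of_nat k)) / _)) in *.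
        assert (N1' := Cminus_neq_0_sym _ _ N1). assert (N2' := Cminus_neq_0_sym _ _ N2).
        field. repeat split; auto.
      + intros y. unfold Rw. now rewrite exp2ipi_plus_1.
      + apply Rw_half.
      + exact H. }
  destruct Q as [Q1 Q2].
  assert (E : forall k, foldZ (fun k => / ((x + IZR k) * (x + IZR k)))%C k =
    (twopii * twopii * (h (x + IZR (Z.of_nat k)) + h (x + IZR (- 1 - Z.of_nat k))))%C).
  { intros k. unfold foldZ, h. field. repeat split; auto; now apply exp2ipi_neq_1_shift. }
  split.
  - apply asum_ext with (1 := fun k => eq_sym (E k)). apply asum_scal, Q1.
  - unfold ZSum. rewrite (CSeries_ext _ _ E), CSeries_scal by exact Q1. now rewrite Q2.
Qed.

Lemma Clim_bounded_all u a : Clim u a -> exists M, forall n, Cmod (u n) <= M.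
Proof.
  intros H. destruct (Clim_bounded u a H) as [N HN].
  assert (Q : forall m, exists M, forall n, (n < m)%nat -> Cmod (u n) <= M).
  { induction m as [|m [M HM]]; [exists 0; intros; lia|].
    exists (Rmax M (Cmod (u m))). intros n Hn. destruct (Nat.eq_dec n m) as [->|Nn]; [apply Rmax_r|].
    apply Rle_trans with (2 := Rmax_l _ _). apply HM. lia. }
  destruct (Q N) as [M HM]. exists (Rmax M (Cmod a + 1)). intros n.
  destruct (Nat.lt_ge_cases n N) as [L|L].
  - apply Rle_trans with (2 := Rmax_l _ _). auto.
  - apply Rle_trans with (2 := Rmax_r _ _). auto.
Qed.

(** The partial fractions of cot converge only conditionally; the difference of two of them has
    terms of order 1/k^2, so the same domination argument applies. *)
Lemma cot_difference (x y : C) : exp2ipi x <> 1%C -> exp2ipi y <> 1%C ->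
  asum (foldZ (fun k => / (y + IZR k) - / (x + IZR k))%C) /\
  ZSum (fun k => / (y + IZR k) - / (x + IZR k))%C = (twopii / 2 * (Kw x - Kw y))%C.
Proof.
  intros Hx Hy. destruct (halving_lower x Hx) as [Nx [bx [Pbx HNx]]].
  destruct (halving_lower y Hy) as [Ny [b' [Pby HNy]]].
  assert (T0 := twopii_neq_0).
  (* For u, v the exponentials at x and y, [Kw] x - [Kw] y = 2 (u - v)/((1 - u)(1 - v)), and u - v =
     v (e^(2 pi i (x-y)/2^(n+1)) - 1). The last factor, rescaled, is [dd]: it depends on n alone and
     converges. *)
  set (dd := fun n => (pow2 (S n) * (exp2ipi ((x - y) / pow2 (S n)) - 1))%C).
  assert (Ld : Clim dd (twopii * (x - y))%C) by apply Clim_scaled_exp2ipi.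
  destruct (Clim_bounded_all _ _ Ld) as [M HM].
  assert (PM : 0 <= M) by (apply Rle_trans with (2 := HM 0%nat), Cmod_ge_0).
  set (r := fun (n : nat) (k : Z) => (2 * (exp2ipi ((y + IZR k) / pow2 (S n)) * dd n) /
     ((pow2 (S n) * (exp2ipi ((x + IZR k) / pow2 (S n)) - 1)) * (pow2 (S n) * (exp2ipi ((y + IZR k) / pow2 (S n)) - 1))))%C).
  set (h := fun k : Z => (2 * (1 * (twopii * (x - y))) / ((twopii * (x + IZR k)) * (twopii * (y + IZR k))))%C).
  assert (Q : asum (fun k => h (Z.of_nat k) + h (- 1 - Z.of_nat k)%Z)%C /\
    CSeries (fun k => h (Z.of_nat k) + h (- 1 - Z.of_nat k)%Z)%C = (Kw x - Kw y)%C).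
  { apply (halving_limit (fun n k => r n (Z.of_nat k) + r n (- 1 - Z.of_nat k)%Z)%C _ _
      (fun k => 2 * (2 * (exp 8 * M) / (bx * b')) * / ((1 + INR k) * (1 + INR k))) (Nx + Ny)).
    - apply ex_series_inv_square_scal.
    - intros n k Hn Hk.
      assert (B : forall j, j = Z.of_nat k \/ j = (- 1 - Z.of_nat k)%Z ->
        Cmod (r n j) <= 2 * (exp 8 * M) / (bx * b') * / ((1 + INR k) * (1 + INR k))).
      { intros j Hj.
        destruct (HNx n k ltac:(lia) Hk (x + IZR j)%C ltac:(destruct Hj as [->| ->]; auto)) as [B1 _].
        destruct (HNy n k ltac:(lia) Hk (y + IZR j)%C ltac:(destruct Hj as [->| ->]; auto)) as [B2 B3].
        unfold r.
        set (ex := (pow2 (S n) * (exp2ipi ((x + IZR j) / pow2 (S n)) - 1))%C) in *.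
        set (ey := (pow2 (S n) * (exp2ipi ((y + IZR j) / pow2 (S n)) - 1))%C) in *.
        assert (Pk := pos_INR k).
        assert (P1 : 0 < bx * (1 + INR k)) by (apply Rmult_lt_0_compat; lra).
        assert (P2 : 0 < b' * (1 + INR k)) by (apply Rmult_lt_0_compat; lra).
        assert (Nex : ex <> 0%C) by (apply Cmod_gt_0; lra).
        assert (Ney : ey <> 0%C) by (apply Cmod_gt_0; lra).
        rewrite Cmod_div, !Cmod_mult by (apply Cmult_neq_0; assumption).
        replace (2 * (exp 8 * M) / (bx * b') * / ((1 + INR k) * (1 + INR k)))
          with (2 * (exp 8 * M) * / ((bx * (1 + INR k)) * (b' * (1 + INR k)))) by (field; lra).
        rewrite Cmod_R, (Rabs_pos_eq 2) by lra.
        apply Rmult_le_compat.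
        - apply Rmult_le_pos; [lra|]. apply Rmult_le_pos; apply Cmod_ge_0.
        - left. apply Rinv_0_lt_compat. apply Rmult_lt_0_compat; lra.
        - apply Rmult_le_compat_l; [lra|]. apply Rmult_le_compat; try apply Cmod_ge_0; [exact B3|apply HM].
        - apply Rinv_le_contravar; [apply Rmult_lt_0_compat; lra|]. apply Rmult_le_compat; lra. }
      apply Rle_trans with (1 := Cmod_triangle _ _).
      assert (U1 := B _ (or_introl eq_refl)). assert (U2 := B _ (or_intror eq_refl)). lra.
    - intros k. assert (Pk := pos_INR k). assert (Pe := exp_pos 8).
      apply Rmult_le_pos.
      + apply Rmult_le_pos; [lra|]. apply Rmult_le_pos; [apply Rmult_le_pos; [lra|apply Rmult_le_pos; lra]|].
        left. apply Rinv_0_lt_compat, Rmult_lt_0_compat; lra.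
      + left. apply Rinv_0_lt_compat. apply Rmult_lt_0_compat; lra.
    - intros k.
      assert (L : forall j, Clim (fun n => r n j) (h j)).
      { intros j. unfold r, h. apply Clim_div.
        - apply Clim_scal, Clim_mult; [apply Clim_exp2ipi_pow2|exact Ld].
        - apply Clim_mult; apply Clim_scaled_exp2ipi.
        - apply Cmult_neq_0; apply Cmult_neq_0; try exact T0; now apply exp2ipi_neq_1_shift. }
      apply Clim_plus; apply L.
    - intros n. rewrite (halving_sum Kw (/ 2)%C) with (x := x) (n := n).
      rewrite (halving_sum Kw (/ 2)%C) with (x := y) (n := n).
      + rewrite <- !csum_scal.
        assert (Em : forall a b m, (csum a m - csum b m)%C = csum (fun k => a k - b k)%C m).
        { intros a b m. induction m as [|m IH]; simpl; [ring|]. rewrite <- IH. ring. }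
        rewrite Em. apply csum_ext. intros k Hk. rewrite pow_inv_pow2. unfold r, dd, Kw.
        assert (Ew : forall j, (exp2ipi ((y + IZR j) / pow2 (S n)) * exp2ipi ((x - y) / pow2 (S n)))%C
          = exp2ipi ((x + IZR j) / pow2 (S n))%C).
        { intros j. rewrite <- exp2ipi_plus. f_equal. field. apply pow2_C. }
        assert (Ed : forall j, (exp2ipi ((y + IZR j) / pow2 (S n)) * (pow2 (S n) * (exp2ipi ((x - y) / pow2 (S n)) - 1)))%C
          = (pow2 (S n) * (exp2ipi ((x + IZR j) / pow2 (S n)) - exp2ipi ((y + IZR j) / pow2 (S n))))%C).
        { intros j. rewrite <- Ew. ring. }
        rewrite !Ed.
        assert (N1 := scaled_ne_0 x (Z.of_nat k) (S n) Hx).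
        assert (N2 := scaled_ne_0 x (- 1 - Z.of_nat k) (S n) Hx).
        assert (N3 := scaled_ne_0 y (Z.of_nat k) (S n) Hy).
        assert (N4 := scaled_ne_0 y (- 1 - Z.of_nat k) (S n) Hy).
        assert (NP := pow2_C (S n)).
        clear Em Ew Ed.
        set (w1 := exp2ipi ((x + IZR (Z.of_nat k)) / _)) in *. set (w2 := exp2ipi ((x + IZR (- 1 - Z.of_nat k)) / _)) in *.
        set (w3 := exp2ipi ((y + IZR (Z.of_nat k)) / _)) in *. set (w4 := exp2ipi ((y + IZR (- 1 - Z.of_nat k)) / _)) in *.
        assert (N1' := Cminus_neq_0_sym _ _ N1). assert (N2' := Cminus_neq_0_sym _ _ N2).
        assert (N3' := Cminus_neq_0_sym _ _ N3). assert (N4' := Cminus_neq_0_sym _ _ N4).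
        field. repeat split; auto.
      + intros z. unfold Kw. now rewrite exp2ipi_plus_1.
      + apply Kw_half.
      + exact Hy.
      + intros z. unfold Kw. now rewrite exp2ipi_plus_1.
      + apply Kw_half.
      + exact Hx. }
  destruct Q as [Q1 Q2].
  assert (E : forall k, foldZ (fun k => / (y + IZR k) - / (x + IZR k))%C k =
    (twopii / 2 * (h (Z.of_nat k) + h (- 1 - Z.of_nat k)%Z))%C).
  { intros k. unfold foldZ, h. field. repeat split; auto; now apply exp2ipi_neq_1_shift. }
  split.
  - apply asum_ext with (1 := fun k => eq_sym (E k)). apply asum_scal, Q1.
  - unfold ZSum. rewrite (CSeries_ext _ _ E), CSeries_scal by exact Q1. now rewrite Q2.
Qed.

(** * The Eisenstein series of weight 2 *)

Lemma Cinv_0 : (/ 0)%C = 0%C.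
Proof. unfold Cinv, RtoC; simpl. f_equal; unfold Rdiv; ring. Qed.

Definition isq (z : C) : C := (/ (z * z))%C.
Definition tel (z : C) : C := (/ (z - / 2) - / (z + / 2))%C.

(** The correction [tel z] = 1 / (z^2 - 1/4) makes the lattice sum of 1 / z^2 absolutely convergent.
    At the origin [isq 0] = 0. *)
Definition latt (tau : C) (m n : Z) : C := (isq (IZR m * tau + IZR n) - tel (IZR m * tau + IZR n))%C.

Lemma isq_opp z : isq (- z)%C = isq z.
Proof. unfold isq. f_equal. ring. Qed.

Lemma isq_mult (a z : C) : a <> 0%C -> isq (a * z)%C = (isq a * isq z)%C.
Proof.
  intros Na. unfold isq. destruct (Ceq_dec z 0%C) as [->|Nz].
  - replace (a * 0 * (a * 0))%C with (RtoC 0) by ring. replace (0 * 0)%C with (RtoC 0) by ring.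
    rewrite Cinv_0. ring.
  - field. auto.
Qed.

Lemma Cmod_lattice_lower (tau : C) (m t : R) : upper tau ->
  Rabs m * Im tau <= Cmod (m * tau + t)%C /\
  Rabs t <= Cmod (m * tau + t)%C * (1 + Cmod tau / Im tau).
Proof.
  intros U. unfold upper in U.
  assert (A : Rabs m * Im tau <= Cmod (m * tau + t)%C).
  { apply Rle_trans with (2 := im_le_Cmod _). rewrite Im_plus_R.
    replace (Im (m * tau)%C) with (m * Im tau) by (unfold Im, Cmult; simpl; ring).
    rewrite Rabs_mult, (Rabs_pos_eq (Im tau)) by lra. lra. }
  split; [exact A|].
  assert (B := Cmod_triangle (m * tau + t)%C (- (m * tau))%C).
  rewrite Cmod_opp, Cmod_mult, Cmod_R in B.
  replace (m * tau + t + - (m * tau))%C with (RtoC t) in B by ring. rewrite Cmod_R in B.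
  assert (D : Rabs m * Cmod tau <= Cmod (m * tau + t)%C * (Cmod tau / Im tau)).
  { replace (Rabs m * Cmod tau) with (Rabs m * Im tau * (Cmod tau / Im tau)) by (field; lra).
    apply Rmult_le_compat_r; [|exact A].
    apply Rmult_le_pos; [apply Cmod_ge_0|left; apply Rinv_0_lt_compat, U]. }
  lra.
Qed.

(** One constant for all lattice estimates: it exceeds 2 / Im tau (for the rows m <> 0), 1 + |tau| /
    Im tau (to bound |n| by |m tau + n|) and 2 (for the row m = 0). *)
Definition latc (tau : C) : R := 1 + Cmod tau / Im tau + 2 / Im tau + 2.

Lemma latc_pos tau : upper tau -> 3 <= latc tau /\ 2 / Im tau <= latc tau /\ 1 + Cmod tau / Im tau + 2 <= latc tau.
Proof.
  intros U. unfold upper in U. unfold latc.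
  assert (0 <= Cmod tau / Im tau) by (apply Rmult_le_pos; [apply Cmod_ge_0|left; apply Rinv_0_lt_compat, U]).
  assert (0 < 2 / Im tau) by (apply Rdiv_lt_0_compat; lra).
  lra.
Qed.

Lemma IZR_Rabs_ge_1 (m : Z) : m <> 0%Z -> 1 <= Rabs (IZR m).
Proof. intros N. rewrite <- abs_IZR. apply IZR_le. lia. Qed.

Lemma lattice_unit_lower (tau : C) (m : Z) (t : R) : upper tau -> (m <> 0%Z \/ / 2 <= Rabs t) ->
  1 <= latc tau * Cmod (IZR m * tau + t)%C.
Proof.
  intros U H. destruct (latc_pos tau U) as [L1 [L2 L3]].
  destruct (Cmod_lattice_lower tau (IZR m) t U) as [A B]. unfold upper in U.
  destruct (Z.eq_dec m 0) as [->|Nm].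
  - destruct H as [H|H]; [easy|].
    assert (E : Cmod (IZR 0 * tau + t)%C = Rabs t).
    { replace (IZR 0 * tau + t)%C with (RtoC t) by ring. apply Cmod_R. }
    rewrite E. nra.
  - assert (Q := IZR_Rabs_ge_1 m Nm).
    apply Rle_trans with (2 / Im tau * (Rabs (IZR m) * Im tau)).
    + replace (2 / Im tau * (Rabs (IZR m) * Im tau)) with (2 * Rabs (IZR m)) by (field; lra). lra.
    + apply Rmult_le_compat; try lra.
      * left. apply Rdiv_lt_0_compat; lra.
      * apply Rmult_le_pos; [apply Rabs_pos|lra].
Qed.

(** 1/z^2 - 1/(z^2 - 1/4) = -1/(4 z^2 (z^2 - 1/4)) decays like |z|^(-4), and |z| dominates both 1 +
    j and 1 + k up to a constant, so two powers can be given to each index. *)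
Lemma latt_bound (tau : C) : upper tau -> exists B, 0 <= B /\ forall (m n : Z) (j k : nat),
  (m = Z.of_nat j \/ m = (- 1 - Z.of_nat j)%Z) -> (n = Z.of_nat k \/ n = (- 1 - Z.of_nat k)%Z) ->
  Cmod (latt tau m n) <= B * / ((1 + INR j) * (1 + INR j)) * / ((1 + INR k) * (1 + INR k)).
Proof.
  intros U. destruct (latc_pos tau U) as [L1 [L2 L3]]. set (A := latc tau) in *.
  (* The product term serves all points except the origin; there the summand is - [tel 0] = 4. *)
  set (B := A ^ 4 * 16 * (1 + A) ^ 2 + 4).
  assert (PA : 0 < A ^ 4) by (apply pow_lt; lra).
  assert (PB : 0 <= B). { unfold B. assert (0 <= (1 + A) ^ 2) by apply pow2_ge_0. nra. }
  exists B. split; [exact PB|].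
  intros m n j k Hm Hn.
  assert (Pj := pos_INR j). assert (Pk := pos_INR k).
  set (z := (IZR m * tau + IZR n)%C).
  assert (Mj : 1 + INR j <= 1 + Rabs (IZR m)).
  { destruct Hm as [->| ->]; rewrite ?IZR_of_nat_INR, ?IZR_neg_succ, ?Rabs_Ropp, Rabs_pos_eq; lra. }
  assert (Nk : 1 + INR k <= 1 + Rabs (IZR n)).
  { destruct Hn as [->| ->]; rewrite ?IZR_of_nat_INR, ?IZR_neg_succ, ?Rabs_Ropp, Rabs_pos_eq; lra. }
  unfold latt. fold z.
  assert (E1 : (z - / 2)%C = (IZR m * tau + (IZR n - / 2)%R)%C).
  { unfold z. rewrite RtoC_minus, RtoC_inv by lra. ring. }
  assert (E2 : (z + / 2)%C = (IZR m * tau + (IZR n + / 2)%R)%C).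
  { unfold z. rewrite RtoC_plus, RtoC_inv by lra. ring. }
  assert (H1 : / 2 <= Rabs (IZR n - / 2)).
  { destruct (Z_le_gt_dec n 0) as [L|L].
    - apply IZR_le in L. rewrite Rabs_left1; lra.
    - assert (1 <= IZR n) by (apply IZR_le; lia). rewrite Rabs_pos_eq; lra. }
  assert (H2 : / 2 <= Rabs (IZR n + / 2)).
  { destruct (Z_lt_ge_dec n 0) as [L|L].
    - assert (IZR n <= -1) by (apply IZR_le; lia). rewrite Rabs_left1; lra.
    - assert (0 <= IZR n) by (apply IZR_le; lia). rewrite Rabs_pos_eq; lra. }
  assert (Q1 := lattice_unit_lower tau m _ U (or_intror H1)). rewrite <- E1 in Q1. fold A in Q1.
  assert (Q2 := lattice_unit_lower tau m _ U (or_intror H2)). rewrite <- E2 in Q2. fold A in Q2.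
  assert (Mh : Cmod (/ 2)%C = / 2) by apply Cmod_half.
  assert (T1 : Cmod z <= (1 + A) * Cmod (z - / 2)%C).
  { assert (T := Cmod_triangle (z - / 2)%C (/ 2)%C). replace (z - / 2 + / 2)%C with z in T by ring. lra. }
  assert (T2 : Cmod z <= (1 + A) * Cmod (z + / 2)%C).
  { assert (T := Cmod_triangle (z + / 2)%C (- / 2)%C). replace (z + / 2 + - / 2)%C with z in T by ring.
    rewrite Cmod_opp in T. lra. }
  assert (N1 : (z - / 2)%C <> 0%C) by (intros Z; rewrite Z, Cmod_0 in Q1; lra).
  assert (N2 : (z + / 2)%C <> 0%C) by (intros Z; rewrite Z, Cmod_0 in Q2; lra).
  assert (Pu : 0 < / ((1 + INR j) * (1 + INR j))) by (apply Rinv_0_lt_compat; nra).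
  assert (Pv : 0 < / ((1 + INR k) * (1 + INR k))) by (apply Rinv_0_lt_compat; nra).
  assert (G : 1 <= A * Cmod z -> Cmod (isq z - tel z)%C <= B * / ((1 + INR j) * (1 + INR j)) * / ((1 + INR k) * (1 + INR k))).
  { intros Q0.
    assert (Pz : 0 < Cmod z) by (generalize (Cmod_ge_0 z); intros [P|P]; [exact P|rewrite <- P in Q0; lra]).
    assert (Nz : z <> 0%C) by (apply Cmod_gt_0, Pz).
    destruct (Cmod_lattice_lower tau (IZR m) (IZR n) U) as [C1 C2]. fold z in C1, C2.
    unfold upper in U.
    assert (D1 : 1 + INR j <= 2 * A * Cmod z).
    { apply Rle_trans with (1 := Mj). assert (Rabs (IZR m) <= A * Cmod z); [|lra].
      apply Rle_trans with (2 / Im tau * Cmod z); [|apply Rmult_le_compat_r; lra].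
      apply Rmult_le_reg_r with (Im tau); [exact U|].
      replace (2 / Im tau * Cmod z * Im tau) with (2 * Cmod z) by (field; lra). lra. }
    assert (D2 : 1 + INR k <= 2 * A * Cmod z).
    { apply Rle_trans with (1 := Nk). assert (Rabs (IZR n) <= A * Cmod z); [|lra].
      apply Rle_trans with (1 := C2). rewrite (Rmult_comm A). apply Rmult_le_compat_l; lra. }
    set (M := Cmod z) in *.
    replace (isq z - tel z)%C with (- (/ 4 / (z * z * ((z - / 2) * (z + / 2)))))%C.
    2:{ assert (N3 : (z * 2 + 1)%C <> 0%C).
        { intros Z. apply N2. replace (z + / 2)%C with ((z * 2 + 1) / 2)%C by field. rewrite Z. field. }
        assert (N4 : (z * 2 - 1)%C <> 0%C).
        { intros Z. apply N1. replace (z - / 2)%C with ((z * 2 - 1) / 2)%C by field. rewrite Z. field. }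
        unfold isq, tel. field. repeat split; assumption. }
    rewrite Cmod_opp, Cmod_div, !Cmod_mult by (repeat apply Cmult_neq_0; assumption).
    fold M.
    assert (M4 : Cmod (/ 4)%C = / 4) by (rewrite <- RtoC_inv by lra; rewrite Cmod_R, Rabs_pos_eq; lra).
    rewrite M4.
    assert (X1 : M * M <= (1 + A) ^ 2 * (Cmod (z - / 2)%C * Cmod (z + / 2)%C)).
    { apply Rle_trans with (((1 + A) * Cmod (z - / 2)%C) * ((1 + A) * Cmod (z + / 2)%C)).
      - apply Rmult_le_compat; lra.
      - right; ring. }
    set (X := Cmod (z - / 2)%C * Cmod (z + / 2)%C) in *.
    assert (PA1 : 0 < (1 + A) ^ 2) by (apply pow_lt; lra).
    assert (PX : 0 < X) by (unfold X; apply Rmult_lt_0_compat; apply Cmod_gt_0; assumption).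
    assert (Y1 : (1 + INR j) * (1 + INR j) <= 4 * A ^ 2 * (M * M)).
    { replace (4 * A ^ 2 * (M * M)) with ((2 * A * M) * (2 * A * M)) by ring. apply Rmult_le_compat; lra. }
    assert (Y2 : (1 + INR k) * (1 + INR k) <= 4 * A ^ 2 * (M * M)).
    { replace (4 * A ^ 2 * (M * M)) with ((2 * A * M) * (2 * A * M)) by ring. apply Rmult_le_compat; lra. }
    set (J := (1 + INR j) * (1 + INR j)) in *. set (K := (1 + INR k) * (1 + INR k)) in *.
    assert (PJ : 0 < J) by (unfold J; nra). assert (PK : 0 < K) by (unfold K; nra).
    assert (PMM : 0 < M * M) by nra.
    apply Rmult_le_reg_r with (M * M * X); [apply Rmult_lt_0_compat; assumption|].
    replace (/ 4 / (M * M * X) * (M * M * X)) with (/ 4) by (field; lra).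
    apply Rmult_le_reg_r with (J * K); [apply Rmult_lt_0_compat; assumption|].
    replace (B * / J * / K * (M * M * X) * (J * K)) with (B * (M * M) * X) by (field; lra).
    assert (Y3 : J * K <= (4 * A ^ 2 * (M * M)) * (4 * A ^ 2 * (M * M))) by (apply Rmult_le_compat; lra).
    replace ((4 * A ^ 2 * (M * M)) * (4 * A ^ 2 * (M * M))) with (16 * A ^ 4 * (M * M) * (M * M)) in Y3 by ring.
    assert (Y4 : 16 * A ^ 4 * (M * M) * (M * M) <= 16 * A ^ 4 * (M * M) * ((1 + A) ^ 2 * X)).
    { apply Rmult_le_compat_l; [|exact X1]. apply Rmult_le_pos; lra. }
    replace (16 * A ^ 4 * (M * M) * ((1 + A) ^ 2 * X)) with (A ^ 4 * 16 * (1 + A) ^ 2 * (M * M * X)) in Y4 by ring.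
    assert (Y5 : A ^ 4 * 16 * (1 + A) ^ 2 * (M * M * X) <= B * (M * M * X)).
    { apply Rmult_le_compat_r; [apply Rmult_le_pos; lra|unfold B; lra]. }
    replace (B * (M * M) * X) with (B * (M * M * X)) by ring.
    assert (0 < J * K) by (apply Rmult_lt_0_compat; assumption). lra. }
  destruct (Z.eq_dec m 0) as [Zm|Nm]; [destruct (Z.eq_dec n 0) as [Zn|Nn]|].
  - assert (Zj : INR j = 0).
    { destruct Hm as [Hm|Hm]; rewrite Zm in Hm; [|lia]. replace j with 0%nat by lia. reflexivity. }
    assert (Zk : INR k = 0).
    { destruct Hn as [Hn|Hn]; rewrite Zn in Hn; [|lia]. replace k with 0%nat by lia. reflexivity. }
    rewrite Zj, Zk. replace (B * / ((1 + 0) * (1 + 0)) * / ((1 + 0) * (1 + 0))) with B by field.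
    assert (Ez : z = 0%C) by (unfold z; rewrite Zm, Zn; ring).
    rewrite Ez. unfold isq, tel.
    replace (0 * 0)%C with (RtoC 0) by ring. rewrite Cinv_0.
    replace (0 - (/ (0 - / 2) - / (0 + / 2)))%C with (RtoC 4).
    + rewrite Cmod_R, Rabs_pos_eq by lra. unfold B. assert (0 <= (1 + A) ^ 2) by apply pow2_ge_0. nra.
    + field.
  - apply G. apply (lattice_unit_lower tau m (IZR n) U). right. generalize (IZR_Rabs_ge_1 n Nn). lra.
  - apply G. apply (lattice_unit_lower tau m (IZR n) U). left. exact Nm.
Qed.

Lemma foldZ_plus f g k : foldZ (fun n => f n + g n)%C k = (foldZ f k + foldZ g k)%C.
Proof. unfold foldZ. ring. Qed.

Lemma foldZ_minus f g k : foldZ (fun n => f n - g n)%C k = (foldZ f k - foldZ g k)%C.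
Proof. unfold foldZ. ring. Qed.

Lemma foldZ_scal c f k : foldZ (fun n => c * f n)%C k = (c * foldZ f k)%C.
Proof. unfold foldZ. ring. Qed.

Lemma foldZ_ext f g k : (forall n, f n = g n) -> foldZ f k = foldZ g k.
Proof. intros H. unfold foldZ. now rewrite !H. Qed.

Lemma ZSum_ext f g : (forall n, f n = g n) -> ZSum f = ZSum g.
Proof. intros H. apply CSeries_ext. intros k. now apply foldZ_ext. Qed.

Lemma ZSum_scal c f : asum (foldZ f) -> ZSum (fun n => c * f n)%C = (c * ZSum f)%C.
Proof.
  intros H. unfold ZSum. rewrite (CSeries_ext _ _ (foldZ_scal c f)). now apply CSeries_scal.
Qed.

Lemma exp2ipi_upper_neq_1 x : upper x -> exp2ipi x <> 1%C.
Proof. intros U E. assert (L := exp2ipi_upper_lt_1 x U). rewrite E, Cmod_1 in L. lra. Qed.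

Lemma exp2ipi_lower_neq_1 x : upper (- x)%C -> exp2ipi x <> 1%C.
Proof.
  intros U E. apply (exp2ipi_upper_neq_1 _ U). rewrite exp2ipi_opp, E. field.
Qed.

Lemma Im_scal (t : R) (x : C) : Im (t * x)%C = t * Im x.
Proof. unfold Im, Cmult; simpl. ring. Qed.

Lemma upper_scal (t : R) (x : C) : 0 < t -> upper x -> upper (t * x)%C.
Proof. intros P U. unfold upper. rewrite Im_scal. apply Rmult_lt_0_compat; assumption. Qed.

Lemma exp2ipi_scal_neq_1 (t : R) (x : C) : t <> 0 -> upper x -> exp2ipi (t * x)%C <> 1%C.
Proof.
  intros N U. destruct (Rtotal_order t 0) as [L|[L|L]]; [|easy|].
  - apply exp2ipi_lower_neq_1. replace (- (t * x))%C with ((- t)%R * x)%C by (rewrite RtoC_opp; ring).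
    apply upper_scal; [lra|exact U].
  - apply exp2ipi_upper_neq_1, upper_scal; [lra|exact U].
Qed.

Lemma Rw_opp x : exp2ipi x <> 1%C -> Rw (- x)%C = Rw x.
Proof.
  intros H. unfold Rw. rewrite exp2ipi_opp.
  assert (N0 := exp2ipi_neq_0 x).
  assert (N1 : (1 - exp2ipi x)%C <> 0%C) by (apply Cminus_neq_0; auto).
  assert (N2 := Cminus_neq_0_sym _ _ N1).
  set (w := exp2ipi x) in *. field. auto.
Qed.

(** The bound of [latt_bound] is a product of a summable sequence in m and one in n, which gives the
    double series and all single rows and columns. *)
Lemma latt_rows tau : upper tau ->
  asum2 (fun j k => foldZ (fun m => foldZ (latt tau m) k) j) /\
  (forall m, asum (foldZ (latt tau m))) /\ (forall n, asum (foldZ (fun m => latt tau m n))).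
Proof.
  intros U. destruct (latt_bound tau U) as [B [PB HB]].
  assert (Pu : forall j : nat, 0 < / ((1 + INR j) * (1 + INR j))).
  { intros j. apply Rinv_0_lt_compat. generalize (pos_INR j). nra. }
  assert (Eu := ex_series_inv_square).
  assert (HZ : forall m : Z, exists j, m = Z.of_nat j \/ m = (- 1 - Z.of_nat j)%Z).
  { intros m. destruct (Z_le_gt_dec 0 m) as [L|L].
    - exists (Z.to_nat m). left. lia.
    - exists (Z.to_nat (- 1 - m)). right. lia. }
  split; [|split].
  - apply (asum2_product_bound _ (fun j => 4 * B * / ((1 + INR j) * (1 + INR j)))
      (fun k => / ((1 + INR k) * (1 + INR k)))).
    + intros j k. unfold foldZ.
      assert (H1 := HB _ _ j k (or_introl eq_refl) (or_introl eq_refl)).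
      assert (H2 := HB _ _ j k (or_introl eq_refl) (or_intror eq_refl)).
      assert (H3 := HB _ _ j k (or_intror eq_refl) (or_introl eq_refl)).
      assert (H4 := HB _ _ j k (or_intror eq_refl) (or_intror eq_refl)).
      set (t1 := latt _ _ _) in H1. set (t2 := latt _ _ _) in H2.
      set (t3 := latt _ _ _) in H3. set (t4 := latt _ _ _) in H4.
      fold t1 t2 t3 t4.
      assert (T1 := Cmod_triangle t1 t2). assert (T2 := Cmod_triangle t3 t4).
      assert (T3 := Cmod_triangle (t1 + t2)%C (t3 + t4)%C). lra.
    + intros j. specialize (Pu j). nra.
    + apply (ex_series_inv_square_scal (4 * B)).
    + exact Eu.
  - intros m. destruct (HZ m) as [j Hj].
    apply asum_le with (fun k => 2 * (B * / ((1 + INR j) * (1 + INR j))) * / ((1 + INR k) * (1 + INR k))).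
    + intros k. unfold foldZ. apply Rle_trans with (1 := Cmod_triangle _ _).
      assert (H1 := HB _ _ j k Hj (or_introl eq_refl)).
      assert (H2 := HB _ _ j k Hj (or_intror eq_refl)). lra.
    + apply ex_series_inv_square_scal.
  - intros n. destruct (HZ n) as [k Hk].
    apply asum_le with (fun j => 2 * (B * / ((1 + INR k) * (1 + INR k))) * / ((1 + INR j) * (1 + INR j))).
    + intros j. unfold foldZ. apply Rle_trans with (1 := Cmod_triangle _ _).
      assert (H1 := HB _ _ j k (or_introl eq_refl) Hk).
      assert (H2 := HB _ _ j k (or_intror eq_refl) Hk). lra.
    + apply ex_series_inv_square_scal.
Qed.

Definition row (tau : C) (m : Z) : C := ZSum (fun n => isq (IZR m * tau + IZR n)%C).

(** Eisenstein summation: n first, then m. The double family of the 1/(m tau + n)^2 is not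
    absolutely summable, and the order matters. *)
Definition G2 (tau : C) : C := ZSum (row tau).

Lemma exp2ipi_shift_half (x : C) : exp2ipi (x + / 2)%C = (- exp2ipi x)%C.
Proof.
  rewrite exp2ipi_plus. replace (/ 2)%C with (1 / 2)%C by field.
  rewrite exp2ipi_half_integer. ring.
Qed.

(** The sum is a difference of cotangents at z + 1/2 and z - 1/2, and cot has period 1. *)
Lemma tel_row (z : C) : exp2ipi (z + / 2)%C <> 1%C ->
  asum (foldZ (fun n => tel (z + IZR n)%C)) /\ ZSum (fun n => tel (z + IZR n)%C) = 0%C.
Proof.
  intros H.
  assert (E : exp2ipi (z - / 2)%C = exp2ipi (z + / 2)%C).
  { rewrite <- (exp2ipi_plus_1 (z - / 2)%C). f_equal. field. }
  assert (H' : exp2ipi (z - / 2)%C <> 1%C) by (rewrite E; exact H).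
  destruct (cot_difference _ _ H H') as [A S].
  assert (Ex : forall n : Z, (/ (z - / 2 + IZR n) - / (z + / 2 + IZR n))%C = tel (z + IZR n)%C).
  { intros n. unfold tel. replace (z - / 2 + IZR n)%C with (z + IZR n - / 2)%C by ring.
    replace (z + / 2 + IZR n)%C with (z + IZR n + / 2)%C by ring. reflexivity. }
  split.
  - apply asum_ext with (2 := A). intros k. apply foldZ_ext, Ex.
  - rewrite <- (ZSum_ext _ _ Ex), S. unfold Kw. rewrite E. ring.
Qed.

Lemma row_tel_neq_1 tau m : upper tau -> exp2ipi (IZR m * tau + / 2)%C <> 1%C.
Proof.
  intros U. rewrite exp2ipi_shift_half. intros E.
  assert (E' : exp2ipi (IZR m * tau)%C = (- (1))%C).
  { replace (exp2ipi (IZR m * tau)) with (- - exp2ipi (IZR m * tau))%C by ring. now rewrite E. }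
  destruct (Z.eq_dec m 0) as [->|N].
  - replace (IZR 0 * tau)%C with (RtoC (IZR 0)) in E' by ring. rewrite exp2ipi_Z in E'.
    injection E'. lra.
  - assert (N2 : IZR (2 * m) <> 0) by (apply not_0_IZR; lia).
    apply (exp2ipi_scal_neq_1 _ tau N2 U).
    replace (IZR (2 * m) * tau)%C with (IZR m * tau + IZR m * tau)%C by (rewrite mult_IZR, RtoC_mult; ring).
    rewrite exp2ipi_plus, E'. ring.
Qed.

(** The corrections [tel] cancel along a row, so summing n first sees only the inverse squares.
    Along a column they leave a remainder, and the sum of these remainders is the anomaly. *)
Lemma row_asum tau m : upper tau ->
  asum (foldZ (fun n => isq (IZR m * tau + IZR n)%C)) /\ ZSum (latt tau m) = row tau m.
Proof.
  intros U. destruct (tel_row _ (row_tel_neq_1 tau m U)) as [A S].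
  destruct (latt_rows tau U) as [_ [L _]]. specialize (L m).
  assert (E : forall n, (latt tau m n + tel (IZR m * tau + IZR n))%C = isq (IZR m * tau + IZR n)%C)
    by (intros; unfold latt; ring).
  assert (Q : asum (foldZ (fun n => isq (IZR m * tau + IZR n)%C))).
  { apply asum_ext with (2 := asum_plus _ _ L A). intros k.
    rewrite <- foldZ_plus. apply foldZ_ext, E. }
  split; [exact Q|].
  unfold row. rewrite <- (ZSum_ext _ _ E). unfold ZSum.
  rewrite (CSeries_ext _ _ (foldZ_plus _ _)), CSeries_plus by assumption.
  fold (ZSum (latt tau m)) (ZSum (fun n => tel (IZR m * tau + IZR n)%C)). rewrite S. ring.
Qed.

Lemma row_nonzero tau m : upper tau -> m <> 0%Z -> row tau m = (twopii * twopii * Rw (IZR m * tau))%C.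
Proof.
  intros U N. apply (Lipschitz2 (IZR m * tau)%C). apply exp2ipi_scal_neq_1; [|exact U].
  apply not_0_IZR, N.
Qed.

Lemma row_opp tau m : upper tau -> row tau (- m) = row tau m.
Proof.
  intros U. destruct (Z.eq_dec m 0) as [->|N]; [reflexivity|].
  rewrite !row_nonzero by (auto; lia). f_equal.
  rewrite opp_IZR, RtoC_opp. replace (- IZR m * tau)%C with (- (IZR m * tau))%C by ring.
  apply Rw_opp, exp2ipi_scal_neq_1; [apply not_0_IZR, N|exact U].
Qed.

Lemma G2_rows tau : upper tau ->
  asum (foldZ (row tau)) /\
  G2 tau = CSeries (fun j => CSeries (fun k => foldZ (fun m => foldZ (latt tau m) k) j)).
Proof.
  intros U. destruct (latt_rows tau U) as [L1 [L2 L3]].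
  assert (E : forall j, CSeries (fun k => foldZ (fun m => foldZ (latt tau m) k) j) = foldZ (row tau) j).
  { intros j. unfold foldZ at 1.
    rewrite CSeries_plus by apply L2.
    fold (ZSum (latt tau (Z.of_nat j))) (ZSum (latt tau (- 1 - Z.of_nat j))).
    unfold foldZ. now rewrite !(proj2 (row_asum tau _ U)). }
  split.
  - apply asum_ext with (1 := E). apply (asum2_rows _ L1).
  - unfold G2, ZSum. symmetry. apply CSeries_ext, E.
Qed.

Lemma col_neq_1 tau (t : R) : upper tau -> t <> 0 -> exp2ipi (t / tau)%C <> 1%C.
Proof.
  intros U N. replace (t / tau)%C with ((- t)%R * (- (1) / tau))%C.
  - apply exp2ipi_scal_neq_1; [lra|]. now apply upper_neg_inv.
  - rewrite RtoC_opp. field. apply upper_neq_0, U.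
Qed.

Lemma half_shift_neq_0 n : IZR n - / 2 <> 0 /\ IZR n + / 2 <> 0.
Proof.
  split; intros E.
  - assert (E' : IZR (2 * n) = 1) by (rewrite mult_IZR; lra). apply (eq_IZR (2 * n) 1) in E'. lia.
  - assert (E' : IZR (2 * n) = -1) by (rewrite mult_IZR; lra). apply (eq_IZR (2 * n) (-1)) in E'. lia.
Qed.

(** Equal to -(pi/tau) cot(pi t/tau), formally minus the sum over m of 1/(m tau + t). *)
Definition Kt (tau : C) (t : R) : C := (/ tau * (twopii / 2 * Kw (t / tau)))%C.

Lemma tel_col tau n : upper tau ->
  asum (foldZ (fun m => tel (IZR m * tau + IZR n)%C)) /\
  ZSum (fun m => tel (IZR m * tau + IZR n)%C) = (Kt tau (IZR n + / 2)%R - Kt tau (IZR n - / 2)%R)%C.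
Proof.
  intros U. assert (Nt := upper_neq_0 _ U). destruct (half_shift_neq_0 n) as [N1 N2].
  destruct (cot_difference _ _ (col_neq_1 tau _ U N2) (col_neq_1 tau _ U N1)) as [A S].
  assert (NZ1 : forall m : Z, ((IZR n - / 2)%R / tau + IZR m)%C <> 0%C)
    by (intros; apply exp2ipi_neq_1_shift, col_neq_1; auto).
  assert (NZ2 : forall m : Z, ((IZR n + / 2)%R / tau + IZR m)%C <> 0%C)
    by (intros; apply exp2ipi_neq_1_shift, col_neq_1; auto).
  assert (Ex : forall m : Z, (/ tau * (/ ((IZR n - / 2)%R / tau + IZR m) - / ((IZR n + / 2)%R / tau + IZR m)))%C
     = tel (IZR m * tau + IZR n)%C).
  { intros m. unfold tel.
    replace (IZR m * tau + IZR n - / 2)%C with (tau * ((IZR n - / 2)%R / tau + IZR m))%C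
      by (rewrite RtoC_minus, RtoC_inv by lra; field; exact Nt).
    replace (IZR m * tau + IZR n + / 2)%C with (tau * ((IZR n + / 2)%R / tau + IZR m))%C
      by (rewrite RtoC_plus, RtoC_inv by lra; field; exact Nt).
    specialize (NZ1 m). specialize (NZ2 m).
    set (a := ((IZR n - / 2)%R / tau + IZR m)%C) in *. set (b := ((IZR n + / 2)%R / tau + IZR m)%C) in *.
    field. auto. }
  split.
  - apply asum_ext with (2 := asum_scal (/ tau) _ A). intros k. rewrite <- foldZ_scal. apply foldZ_ext, Ex.
  - rewrite <- (ZSum_ext _ _ Ex), ZSum_scal, S by exact A. unfold Kt. ring.
Qed.

(** m tau + n = tau (- n (-1/tau) + m): the column n at tau is the row -n at -1/tau, and rows are
    even in their index. *)
Lemma isq_col tau n : upper tau ->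
  ZSum (fun m => isq (IZR m * tau + IZR n)%C) = (isq tau * row (- (1) / tau) n)%C.
Proof.
  intros U. assert (Nt := upper_neq_0 _ U). assert (U' := upper_neg_inv _ U).
  assert (E : forall m : Z, isq (IZR m * tau + IZR n)%C = (isq tau * isq (IZR (- n) * (- (1) / tau) + IZR m))%C).
  { intros m. rewrite <- isq_mult by exact Nt. f_equal. rewrite opp_IZR, RtoC_opp. field. exact Nt. }
  rewrite (ZSum_ext _ _ E), ZSum_scal by apply (row_asum _ _ U').
  fold (row (- (1) / tau)%C (- n)). now rewrite row_opp.
Qed.

Lemma latt_col tau n : upper tau ->
  ZSum (fun m => latt tau m n) =
  (isq tau * row (- (1) / tau) n - (Kt tau (IZR n + / 2)%R - Kt tau (IZR n - / 2)%R))%C.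
Proof.
  intros U. destruct (tel_col tau n U) as [A S]. destruct (latt_rows tau U) as [_ [_ L]]. specialize (L n).
  rewrite <- S, <- (isq_col tau n U).
  unfold ZSum. rewrite <- CSeries_minus; [|..|exact A].
  - apply CSeries_ext. intros k. rewrite <- foldZ_minus. reflexivity.
  - apply asum_ext with (2 := asum_plus _ _ L A). intros k. rewrite <- foldZ_plus. apply foldZ_ext.
    intros m. unfold latt. ring.
Qed.

Lemma telescope (h : R -> C) N :
  csum (foldZ (fun n => h (IZR n + / 2)%R - h (IZR n - / 2)%R)%C) N =
  (h (INR N - / 2)%R - h (- INR N - / 2)%R)%C.
Proof.
  induction N as [|N IH].
  - simpl. replace (- 0 - / 2) with (0 - / 2) by ring. ring.
  - simpl csum. rewrite IH. unfold foldZ. rewrite IZR_of_nat_INR, IZR_neg_succ, !S_INR.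
    replace (INR N + 1 - / 2) with (INR N + / 2) by lra.
    replace (- (1 + INR N) + / 2) with (- INR N - / 2) by lra.
    replace (- (INR N + 1) - / 2) with (- (1 + INR N) - / 2) by lra. ring.
Qed.

Lemma Clim_exp2ipi_infinity (sigma : C) (c : R) : upper sigma ->
  Clim (fun N => exp2ipi ((INR N + c)%R * sigma)%C) 0%C.
Proof.
  intros U. assert (L := exp2ipi_upper_lt_1 _ U).
  apply Clim_ext with (fun N => exp2ipi sigma ^ N * exp2ipi (c * sigma))%C.
  - intros N. rewrite <- exp2ipi_pow, <- exp2ipi_plus. f_equal. rewrite RtoC_plus. ring.
  - apply Clim_val with (0 * exp2ipi (c * sigma))%C; [ring|].
    apply Clim_mult; [|apply Clim_const].
    apply (Clim_dominated _ _ (fun n => Cmod (exp2ipi sigma) ^ n)).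
    + intros n. replace (exp2ipi sigma ^ n - 0)%C with (exp2ipi sigma ^ n)%C by ring. rewrite Cmod_pow. lra.
    + apply is_lim_seq_geom. rewrite Rabs_pos_eq; [exact L|apply Cmod_ge_0].
Qed.

Lemma Kw_opp x : exp2ipi x <> 1%C -> Kw (- x)%C = (- Kw x)%C.
Proof.
  intros H. unfold Kw. rewrite exp2ipi_opp.
  assert (N0 := exp2ipi_neq_0 x).
  assert (N1 : (1 - exp2ipi x)%C <> 0%C) by (apply Cminus_neq_0; auto).
  assert (N2 := Cminus_neq_0_sym _ _ N1).
  set (w := exp2ipi x) in *. field. auto.
Qed.

Lemma Clim_Kw (sigma : C) (c : R) : upper sigma ->
  Clim (fun N => Kw ((INR N + c)%R * sigma)%C) 1%C.
Proof.
  intros U. unfold Kw. apply Clim_val with ((1 + 0) / (1 - 0))%C; [field|].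
  assert (H := Clim_exp2ipi_infinity sigma c U).
  apply Clim_div.
  - apply Clim_plus; [apply Clim_const|exact H].
  - apply Clim_minus; [apply Clim_const|exact H].
  - replace (1 - 0)%C with (RtoC 1) by ring. exact C1_nz.
Qed.

Lemma INR_pm_half N : INR N - / 2 <> 0.
Proof. rewrite INR_IZR_INZ. apply half_shift_neq_0. Qed.

(** Rows give G2 at tau; columns give G2 at -1/tau minus a telescoping sum of [Kt]. After N steps
    only t = N - 1/2 and t = -N - 1/2 remain, where t/tau goes to infinity in the lower and in the
    upper half-plane and [Kw] tends to -1 and to 1; together they leave 2 pi i/tau. *)
Theorem G2_inversion tau : upper tau ->
  G2 tau = (isq tau * G2 (- (1) / tau) + twopii / tau)%C.
Proof.
  intros U. assert (Nt := upper_neq_0 _ U). assert (U' := upper_neg_inv _ U).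
  destruct (latt_rows tau U) as [L1 [L2 L3]].
  destruct (G2_rows tau U) as [_ E1]. destruct (G2_rows _ U') as [R1 _].
  rewrite E1, CSeries_swap by exact L1.
  assert (A2 := asum2_rows _ (asum2_swap _ L1)).
  assert (E : forall k, CSeries (fun j => foldZ (fun m => foldZ (latt tau m) k) j) =
    (isq tau * foldZ (row (- (1) / tau)) k
     - foldZ (fun n => Kt tau (IZR n + / 2)%R - Kt tau (IZR n - / 2)%R) k)%C).
  { intros k.
    rewrite (CSeries_ext _ (fun j => foldZ (fun m => latt tau m (Z.of_nat k)) j + foldZ (fun m => latt tau m (- 1 - Z.of_nat k)%Z) j)%C)
      by (intros j; apply foldZ_plus).
    rewrite CSeries_plus by apply L3.
    fold (ZSum (fun m => latt tau m (Z.of_nat k))) (ZSum (fun m => latt tau m (- 1 - Z.of_nat k)%Z)).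
    rewrite !latt_col by exact U. unfold foldZ. ring. }
  apply (Clim_unique (csum (fun k => CSeries (fun j => foldZ (fun m => foldZ (latt tau m) k) j)))).
  - apply Clim_csum, A2.
  - apply Clim_ext with (fun N => isq tau * csum (foldZ (row (- (1) / tau))) N
      + ((- (1)) * (/ tau * (twopii / 2 * Kw ((INR N + (- / 2))%R / tau)))
         + / tau * (twopii / 2 * Kw ((- INR N - / 2)%R / tau))))%C.
    + intros N. symmetry. rewrite (csum_ext _ _ N (fun k _ => E k)).
      rewrite (csum_ext _ (fun k => isq tau * foldZ (row (- (1) / tau)) k
        + (- (1)) * foldZ (fun n => Kt tau (IZR n + / 2)%R - Kt tau (IZR n - / 2)%R) k)%C) by (intros; ring).
      rewrite csum_plus, !csum_scal, telescope. unfold Kt.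
      replace (INR N - / 2) with (INR N + - / 2) by ring. ring.
    + replace (twopii / tau)%C with ((- (1)) * (/ tau * (twopii / 2 * (- (1)))) + / tau * (twopii / 2 * 1))%C
        by (field; exact Nt).
      apply Clim_plus; [apply Clim_scal, Clim_csum, R1|].
      apply Clim_plus; repeat apply Clim_scal.
      * apply Clim_ext with (fun N => (- (1)) * Kw ((INR N + (- / 2))%R * (- (1) / tau)))%C.
        { intros N. replace ((INR N + - / 2)%R / tau)%C with (- ((INR N + - / 2)%R * (- (1) / tau)))%C by (field; exact Nt).
          rewrite Kw_opp; [ring|]. apply exp2ipi_scal_neq_1; [apply INR_pm_half|exact U']. }
        apply Clim_val with ((- (1)) * 1)%C; [ring|]. apply Clim_scal, Clim_Kw, U'.
      * apply Clim_ext with (2 := Clim_Kw (- (1) / tau)%C (/ 2) U').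
        intros N. f_equal. replace (- INR N - / 2) with (- (INR N + / 2)) by ring.
        rewrite RtoC_opp. field. exact Nt.
Qed.

Lemma Rw_half_value : Rw (1 / 2)%C = (- / 4)%C.
Proof. unfold Rw. rewrite exp2ipi_half_integer. field. Qed.

Lemma twopii_sq : (twopii * twopii)%C = RtoC (- (4 * (PI * PI))).
Proof.
  unfold twopii, Ci, RtoC, Cmult; simpl. f_equal; ring.
Qed.

Lemma asum_isq_succ : asum (fun k => isq (INR (S k))).
Proof.
  apply ex_series_ext with (2 := ex_series_inv_square). intros k. unfold isq.
  assert (P := pos_INR k). rewrite S_INR, <- RtoC_mult, <- RtoC_inv, Cmod_R, Rabs_pos_eq.
  - f_equal. ring.
  - left. apply Rinv_0_lt_compat. nra.
  - nra.
Qed.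

(** At x = 1/2 the terms k and -1 - k of [Lipschitz2] coincide, which gives the sum pi^2/8 over the
    odd integers. The even integers contribute a quarter of the whole sum, so the whole is 4/3 of
    the odd part. *)
Lemma zeta_2 : CSeries (fun k => isq (INR (S k))) = RtoC (PI * PI / 6).
Proof.
  assert (H : exp2ipi (1 / 2)%C <> 1%C).
  { rewrite exp2ipi_half_integer. intros E. injection E. lra. }
  destruct (Lipschitz2 _ H) as [A S]. rewrite Rw_half_value, twopii_sq in S.
  assert (A0 := asum_isq_succ).
  assert (E : forall k, foldZ (fun k => / ((1 / 2 + IZR k) * (1 / 2 + IZR k)))%C k
     = (8 * isq (INR (2 * k + 1)))%C).
  { intros k. unfold foldZ. rewrite IZR_of_nat_INR, IZR_neg_succ.
    replace (INR (2 * k + 1)) with (2 * INR k + 1) by (rewrite plus_INR, mult_INR; simpl; ring).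
    assert (P := pos_INR k). unfold isq.
    rewrite RtoC_opp, !RtoC_plus, RtoC_mult. set (x := RtoC (INR k)).
    assert (N : (2 * x + 1)%C <> 0%C).
    { unfold x. rewrite <- RtoC_mult, <- RtoC_plus. apply Cneq_R. lra. }
    replace (1 / 2 + x)%C with ((2 * x + 1) / 2)%C by field.
    replace (1 / 2 + - (1 + x))%C with (- ((2 * x + 1) / 2))%C by field.
    set (y := (2 * x + 1)%C) in *. field. exact N. }
  unfold ZSum in S. rewrite (CSeries_ext _ _ E) in S.
  assert (Ao : asum (fun k => isq (INR (2 * k + 1)))).
  { apply asum_ext with (fun k => / 8 * foldZ (fun k => / ((1 / 2 + IZR k) * (1 / 2 + IZR k))) k)%C.
    - intros k. rewrite E. field.
    - apply asum_scal, A. }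
  rewrite CSeries_scal in S by exact Ao.
  set (O := CSeries (fun k => isq (INR (2 * k + 1)))) in *.
  set (Z := CSeries (fun k => isq (INR (Datatypes.S k)))).
  assert (EZ : Z = (O + / 4 * Z)%C).
  { apply (Clim_unique (fun N => csum (fun k => isq (INR (Datatypes.S k))) (2 * N))).
    - apply (Clim_subseq _ _ (fun N => 2 * N)%nat (Clim_csum _ A0)). intros; lia.
    - apply Clim_ext with (fun N => csum (fun k => isq (INR (2 * k + 1))) N + / 4 * csum (fun k => isq (INR (Datatypes.S k))) N)%C.
      + induction n as [|N IH]; [simpl; ring|].
        replace (2 * Datatypes.S N)%nat with (Datatypes.S (Datatypes.S (2 * N))) by lia.
        cbn [csum]. rewrite <- IH.
        replace (2 * N + 1)%nat with (Datatypes.S (2 * N)) by lia.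
        replace (INR (Datatypes.S (Datatypes.S (2 * N)))) with (2 * INR (Datatypes.S N))
          by (rewrite !S_INR, mult_INR; simpl; ring).
        rewrite RtoC_mult, (isq_mult 2) by (apply Cneq_R; lra).
        replace (isq 2) with (/ 4)%C by (unfold isq; field). ring.
      + apply Clim_plus; [apply Clim_csum, Ao|apply Clim_scal, Clim_csum, A0]. }
  assert (EO : O = (/ 8 * RtoC (PI * PI))%C).
  { replace O with (/ 8 * (8 * O))%C by field. rewrite S.
    rewrite RtoC_opp, RtoC_mult. field. }
  assert (EZ' : Z = (4 / 3 * O)%C).
  { replace (4 / 3 * O)%C with (4 / 3 * (O + / 4 * Z - / 4 * Z))%C by ring. rewrite <- EZ. field. }
  rewrite EZ', EO. rewrite RtoC_div by lra. field.
Qed.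

Lemma row_zero_value tau : row tau 0 = RtoC (PI * PI / 3).
Proof.
  assert (A0 := asum_isq_succ).
  assert (A1 : asum (fun k => isq (INR k))) by (apply (asum_decr _ 1), A0).
  unfold row, ZSum.
  rewrite (CSeries_ext _ (fun k => isq (INR k) + isq (INR (S k)))%C).
  - rewrite CSeries_plus, (CSeries_shift _ A1), zeta_2 by assumption.
    assert (E0 : isq (INR 0) = 0%C).
    { unfold isq. simpl. replace (0 * 0)%C with (RtoC 0) by ring. apply Cinv_0. }
    rewrite E0. rewrite !RtoC_div by lra. field.
  - intros k. unfold foldZ. rewrite IZR_of_nat_INR, IZR_neg_succ, S_INR. f_equal.
    + f_equal. ring.
    + rewrite <- isq_opp. f_equal. rewrite RtoC_opp, !RtoC_plus. ring.
Qed.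

(** * Lambert series *)

(** (n+1)(m+1) >= n + m, which bounds a Lambert double sum by a product of two geometric series. *)
Lemma pow_ge_product (x : R) n m : 0 <= x <= 1 -> x ^ (S n * S m) <= x ^ n * x ^ m.
Proof.
  intros Hx. rewrite <- pow_add.
  replace (S n * S m)%nat with ((n + m) + (S n * S m - (n + m)))%nat by lia.
  rewrite pow_add. rewrite <- (Rmult_1_r (x ^ (n + m))) at 2.
  apply Rmult_le_compat_l; [apply pow_le; lra|].
  rewrite <- (pow1 (S n * S m - (n + m))). apply pow_incr. lra.
Qed.

(** Generalized Lambert series, the coefficients of the sum over n of c_n a(z^(n+1)). The shift by
    one is needed because [dil] requires a positive factor. *)
Definition lamw (c a : nat -> C) (k : nat) : C := CSeries (fun n => c n * dil (S n) a k)%C.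

(** Because a has no constant term, a(z^(n+1)) is of order |z|^n, so the sum over n converges
    geometrically and the double sum may be rearranged. *)
Lemma lamw_spec c a : dser a -> a 0%nat = 0%C -> (forall n, Cmod (c n) <= 1) ->
  dser (lamw c a) /\ forall z, Cmod z < 1 -> PS (lamw c a) z = CSeries (fun n => c n * PS a (z ^ S n))%C.
Proof.
  intros H a0 Hc.
  destruct (dser_family (fun n k => c n * dil (S n) a k)%C) as [D1 D2].
  - intros z Hz. assert (Pz := Cmod_ge_0 z).
    set (Q := Series (fun k => Cmod (a (1 + k)%nat * z ^ k)%C)).
    assert (AQ : asum (fun k => a (1 + k)%nat * z ^ k)%C) by (apply (dser_unshift 1 a H), Hz).
    assert (Hd : forall n, asum (fun k => dil (S n) a k * z ^ k)%C).
    { intros n. apply (dser_dil (S n) a); [lia|exact H|exact Hz]. }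
    split.
    + intros n. apply asum_ext with (fun k => c n * (dil (S n) a k * z ^ k))%C; [intros; ring|].
      apply asum_scal, Hd.
    + apply (ex_series_le (K := R_AbsRing) (V := R_CompleteNormedModule) _ (fun n => Q * Cmod z ^ n)).
      * intros n.
        change (Rabs (Series (fun k => Cmod (c n * dil (S n) a k * z ^ k)%C)) <= Q * Cmod z ^ n).
        assert (Hw : Cmod (z ^ S n)%C < 1) by (apply Cmod_pow_lt_1; [lia|exact Hz]).
        assert (B : Series (fun k => Cmod (a k * (z ^ S n) ^ k)%C) <= Q * Cmod z ^ n).
        { rewrite Series_incr_1 by apply (H _ Hw).
          rewrite a0. replace (Cmod (0 * (z ^ S n) ^ 0)%C) with 0 by (rewrite Cmult_0_l; symmetry; apply Cmod_0).
          rewrite Rplus_0_l, Rmult_comm. unfold Q. rewrite <- Series_scal_l.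
          apply Series_le; [|apply ex_series_Rscal, AQ].
          intros k. split; [apply Cmod_ge_0|].
          rewrite !Cmod_mult, !Cmod_pow, <- pow_mult. change (1 + k)%nat with (S k).
          replace (Cmod z ^ n * (Cmod (a (S k)) * Cmod z ^ k)) with (Cmod (a (S k)) * (Cmod z ^ n * Cmod z ^ k)) by ring.
          apply Rmult_le_compat_l; [apply Cmod_ge_0|]. apply pow_ge_product. lra. }
        assert (A1 : asum (fun k => c n * dil (S n) a k * z ^ k)%C).
        { apply asum_ext with (fun k => c n * (dil (S n) a k * z ^ k))%C; [intros; ring|]. apply asum_scal, Hd. }
        rewrite Rabs_pos_eq by (apply Series_pos; [intros; apply Cmod_ge_0|exact A1]).
        apply Rle_trans with (2 := B).
        destruct (dil_asum (S n) a z ltac:(lia) (H _ Hw)) as [_ [_ B2]].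
        apply Rle_trans with (2 := B2). apply Series_le; [|apply Hd].
        intros k. split; [apply Cmod_ge_0|]. rewrite <- Cmult_assoc, Cmod_mult.
        rewrite <- (Rmult_1_l (Cmod (dil _ _ _ * _)%C)) at 2.
        apply Rmult_le_compat_r; [apply Cmod_ge_0|apply Hc].
      * apply ex_series_Rscal. apply ex_series_Rgeom.
        rewrite Rabs_pos_eq; assumption.
  - split; [exact D1|]. intros z Hz. unfold lamw. rewrite D2 by exact Hz. apply CSeries_ext. intros n.
    rewrite PS_scal by first [exact Hz | apply dser_dil; [lia|exact H]].
    rewrite PS_dil by first [lia | assumption]. reflexivity.
Qed.

(** [gc] is the series of z/(1 - z) and [lc] that of log(1 - z). *)
Definition gc (k : nat) : C := match k with O => 0%C | _ => 1%C end.
Definition lc (k : nat) : C := match k with O => 0%C | _ => (- / INR k)%C end.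

Lemma dser_bounded a : (forall n, Cmod (a n) <= 1) -> dser a.
Proof.
  intros H z Hz. apply asum_le with (fun n => Cmod z ^ n).
  - intros n. rewrite Cmod_mult, Cmod_pow. rewrite <- (Rmult_1_l (Cmod z ^ n)) at 2.
    apply Rmult_le_compat_r; [apply pow_le, Cmod_ge_0|apply H].
  - apply ex_series_Rgeom. rewrite Rabs_pos_eq; [exact Hz|apply Cmod_ge_0].
Qed.

Lemma Cinv_INR_S_le n : Cmod (- / INR (S n))%C <= 1.
Proof.
  assert (P := pos_INR n). rewrite Cmod_opp, <- RtoC_inv, Cmod_R, S_INR by (rewrite S_INR; lra).
  rewrite Rabs_pos_eq by (left; apply Rinv_0_lt_compat; lra).
  rewrite <- Rinv_1. apply Rinv_le_contravar; lra.
Qed.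

Lemma dser_gc : dser gc.
Proof. apply dser_bounded. intros [|n]; simpl; [rewrite Cmod_0|rewrite Cmod_1]; lra. Qed.

Lemma dser_lc : dser lc.
Proof. apply dser_bounded. intros [|n]; [simpl; rewrite Cmod_0; lra|apply Cinv_INR_S_le]. Qed.

Lemma PS_geom z : Cmod z < 1 -> PS (fun _ => 1%C) z = (/ (1 - z))%C.
Proof.
  intros Hz. assert (N : (1 - z)%C <> 0%C).
  { apply Cminus_neq_0. intros E. rewrite <- E, Cmod_1 in Hz. lra. }
  assert (D : dser (fun _ => 1%C)) by (apply dser_bounded; intros; rewrite Cmod_1; lra).
  assert (E : PS (fun _ => 1%C) z = (1 + z * PS (fun _ => 1%C) z)%C).
  { unfold PS at 1. rewrite (CSeries_shift _ (D z Hz)).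
    rewrite (CSeries_ext _ (fun n => z * (1 * z ^ n))%C) by (intros; rewrite Cpow_S; ring).
    rewrite CSeries_scal by apply (D z Hz). simpl. unfold PS. ring. }
  set (p := PS (fun _ => 1%C) z) in *.
  replace p with ((p - z * p) / (1 - z))%C by (field; exact N).
  rewrite E at 1. field. exact N.
Qed.

Lemma PS_INR_gc z : Cmod z < 1 -> PS (fun n => INR n * gc n)%C z = (z / ((1 - z) * (1 - z)))%C.
Proof.
  intros Hz. assert (N : (1 - z)%C <> 0%C).
  { apply Cminus_neq_0. intros E. rewrite <- E, Cmod_1 in Hz. lra. }
  rewrite <- PS_dcoef by (auto using dser_gc).
  assert (D1 : dser (fun _ => 1%C)) by (apply dser_bounded; intros; rewrite Cmod_1; lra).
  rewrite (PS_ext (dcoef gc) (conv (fun _ => 1%C) (fun _ => 1%C))).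
  - rewrite PS_conv, PS_geom by auto. field. exact N.
  - intros n. unfold dcoef, conv, gc.
    rewrite (csum_ext _ (fun _ => 1%C)) by (intros; ring). now rewrite csum_const.
Qed.

(** The quotient of the two sides has derivative zero, as the derivative of [lc] is -1/(1 - z), and
    equals 1 at the origin. *)
Lemma Cexp_PS_lc z : Cmod z < 1 -> Cexp (PS lc z) = (1 - z)%C.
Proof.
  intros Hz.
  assert (N : forall w : C, Cmod w < 1 -> (1 - w)%C <> 0%C).
  { intros w Hw. apply Cminus_neq_0. intros E. rewrite <- E, Cmod_1 in Hw. lra. }
  assert (E : (Cexp (PS lc 0) / (1 - 0))%C = (Cexp (PS lc z) / (1 - z))%C).
  { apply (Cderive_zero_const (fun w => Cexp (PS lc w) / (1 - w))%C). intros t Ht.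
    assert (Hv := Cmod_segment z t Ht). set (v := (0 + t * (z - 0))%C) in *.
    assert (Lv : Cmod v < 1) by lra.
    apply Cderive_val with (((PS (dcoef lc) v * Cexp (PS lc v)) * (1 - v) - Cexp (PS lc v) * (0 - 1)) / ((1 - v) * (1 - v)))%C.
    - rewrite (PS_ext (dcoef lc) (fun _ => - (1) * 1)%C).
      + rewrite PS_scal, PS_geom by (auto; apply dser_bounded; intros; rewrite Cmod_1; lra).
        field. apply N, Lv.
      + intros n. unfold dcoef, lc. field. apply Cneq_R. rewrite S_INR. generalize (pos_INR n). lra.
    - apply (Cderive_div (fun w => Cexp (PS lc w)) (fun w => (1 - w)%C)).
      + apply N, Lv.
      + apply Cderive_Cexp_comp, Cderive_PS; [apply dser_lc|exact Lv].
      + apply (Cderive_minus (fun _ => 1%C) (fun w => w)); [apply Cderive_const|apply Cderive_id]. }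
  rewrite PS_0 in E. simpl in E. rewrite Cexp_0 in E.
  replace (Cexp (PS lc z)) with (Cexp (PS lc z) / (1 - z) * (1 - z))%C by (field; apply N, Hz).
  rewrite <- E. field.
Qed.

(** [Lc] is the power series of log prod (1 - z^n) = - sum_n z^n / (n (1 - z^n)). *)
Definition Lc : nat -> C := lamw (fun n => - / INR (S n))%C gc.

Lemma dser_Lc : dser Lc.
Proof. apply (lamw_spec _ gc dser_gc eq_refl Cinv_INR_S_le). Qed.

(** The double sum of -z^(n m)/n, taken over m first, is the Lambert series that defines [Lc]; taken
    over n first, it is the sum of the logarithms of 1 - z^m. The first form has known coefficients,
    the second gives the Euler product. *)
Lemma PS_Lc_log z : Cmod z < 1 ->
  asum (fun m => PS lc (z ^ S m)) /\ PS Lc z = CSeries (fun m => PS lc (z ^ S m)%C).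
Proof.
  intros Hz. assert (Pz := Cmod_ge_0 z).
  assert (L : forall n, Cmod (z ^ S n)%C < 1) by (intros; apply Cmod_pow_lt_1; [lia|exact Hz]).
  set (f := fun n m => (- / INR (S n) * (z ^ S n) ^ S m)%C).
  assert (A : asum2 f).
  { assert (Eg : ex_series (fun n => Cmod z ^ n)) by (apply ex_series_Rgeom; rewrite Rabs_pos_eq; assumption).
    apply (asum2_product_bound _ (fun n => Cmod z ^ n) (fun n => Cmod z ^ n)); [|intros; apply pow_le, Pz|exact Eg|exact Eg].
    intros n m. unfold f. rewrite Cmod_mult, !Cmod_pow, <- pow_mult.
    apply Rle_trans with (1 * (Cmod z ^ (S n * S m))).
    - apply Rmult_le_compat_r; [apply pow_le, Pz|apply Cinv_INR_S_le].
    - rewrite Rmult_1_l. apply pow_ge_product. lra. }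
  assert (E1 : forall n, CSeries (f n) = (- / INR (S n) * PS gc (z ^ S n))%C).
  { intros n. rewrite <- (PS_scal _ gc) by (auto using dser_gc).
    symmetry. unfold PS. rewrite CSeries_shift by (apply (dser_scal _ gc dser_gc), L).
    unfold f. simpl gc. rewrite Cmult_0_r, Cmult_0_l, Cplus_0_l. apply CSeries_ext. intros m. ring. }
  assert (E2 : forall m, CSeries (fun n => f n m) = PS lc (z ^ S m)%C).
  { intros m. symmetry. unfold PS. rewrite CSeries_shift by (apply dser_lc, L).
    simpl (lc 0). rewrite Cmult_0_l, Cplus_0_l. apply CSeries_ext. intros n. unfold f, lc.
    rewrite <- !Cpow_mult_r, (Nat.mul_comm (S m)). reflexivity. }
  split.
  - apply asum_ext with (1 := E2). apply (asum2_rows _ (asum2_swap _ A)).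
  - unfold Lc. rewrite (proj2 (lamw_spec _ gc dser_gc eq_refl Cinv_INR_S_le)) by exact Hz.
    rewrite <- (CSeries_ext _ _ E1), <- (CSeries_ext _ _ E2). apply (CSeries_swap _ A).
Qed.

(** In the coefficient of index k = n m the factor k cancels the 1/n and leaves m, hence a Lambert
    series of z/(1 - z)^2. Its terms are the [Rw] (n tau) found in the rows of the Eisenstein
    series. *)
Lemma PS_INR_Lc z : Cmod z < 1 ->
  PS (fun k => INR k * Lc k)%C z = (- CSeries (fun n => z ^ S n / ((1 - z ^ S n) * (1 - z ^ S n))))%C.
Proof.
  intros Hz.
  assert (L : forall n, Cmod (z ^ S n)%C < 1) by (intros; apply Cmod_pow_lt_1; [lia|exact Hz]).
  set (ic := fun n => (INR n * gc n)%C).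
  assert (Di : dser ic) by (apply dser_INR, dser_gc).
  assert (i0 : ic 0%nat = 0%C) by (unfold ic; simpl; ring).
  assert (H1 : forall n : nat, Cmod (- (1))%C <= 1) by (intros; rewrite Cmod_m1; lra).
  destruct (lamw_spec (fun _ => - (1))%C ic Di i0 H1) as [D E].
  rewrite (PS_ext _ (lamw (fun _ => - (1))%C ic)).
  - rewrite E by exact Hz.
    rewrite (CSeries_ext _ (fun n => - (z ^ S n / ((1 - z ^ S n) * (1 - z ^ S n))))%C).
    + rewrite (CSeries_ext _ (fun n => - (1) * (z ^ S n / ((1 - z ^ S n) * (1 - z ^ S n))))%C) by (intros; ring).
      rewrite CSeries_scal; [ring|].
      assert (Ai : asum (fun n => PS ic (z ^ S n)%C)).
      { assert (B1 : forall n : nat, Cmod 1 <= 1) by (intros; rewrite Cmod_1; lra).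
        assert (B : exists M, forall n, Cmod (PS ic (z ^ S n)%C) <= M * Cmod z ^ n).
        { exists (Series (fun k => Cmod (ic (1 + k)%nat * z ^ k)%C)). intros n.
          rewrite (PS_unshift 1 ic _ Di (L n)) by (intros k Lk; replace k with 0%nat by lia; exact i0).
          rewrite Cmod_mult, Cmod_pow, Rmult_comm. apply Rmult_le_compat.
          - apply Cmod_ge_0.
          - apply pow_le, Cmod_ge_0.
          - apply Cmod_CSeries_le; [|apply (dser_unshift 1 ic Di z Hz)].
            intros k. rewrite !Cmod_mult, !Cmod_pow. apply Rmult_le_compat_l; [apply Cmod_ge_0|].
            apply pow_incr. split; [apply pow_le, Cmod_ge_0|].
            change (Cmod z ^ S n) with (Cmod z * Cmod z ^ n).
            assert (Q : Cmod z ^ n <= 1) by (rewrite <- (pow1 n); apply pow_incr; split; [apply Cmod_ge_0|lra]).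
            generalize (Cmod_ge_0 z). nra.
          - rewrite pow_1, Cmod_pow. change (Cmod z ^ S n) with (Cmod z * Cmod z ^ n).
            rewrite <- (Rmult_1_l (Cmod z ^ n)) at 2.
            apply Rmult_le_compat_r; [apply pow_le, Cmod_ge_0|lra]. }
        destruct B as [M HM]. apply asum_le with (1 := HM).
        apply ex_series_Rscal, ex_series_Rgeom.
        rewrite Rabs_pos_eq; [exact Hz|apply Cmod_ge_0]. }
      apply asum_ext with (2 := Ai). intros n. apply PS_INR_gc, L.
    + intros n. unfold ic. rewrite PS_INR_gc by apply L. ring.
  - intros k. unfold Lc, lamw. rewrite <- CSeries_scal.
    + apply CSeries_ext. intros n. unfold dil, ic. destruct (Nat.eqb_spec (k mod S n) 0) as [Z|Z]; [|ring].
      apply Nat.Div0.div_exact in Z. set (m := (k / S n)%nat) in *. rewrite Z at 1.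
      rewrite mult_INR, RtoC_mult. field. apply Cneq_R. rewrite S_INR. generalize (pos_INR n). lra.
    + apply (CSeries_finite _ (S k)). intros n Hn. unfold dil.
      destruct (Nat.eqb_spec (k mod S n) 0) as [Z|Z]; [|ring].
      rewrite Nat.mod_small in Z by lia. rewrite Z, Nat.Div0.div_0_l. simpl. ring.
Qed.

(** * Dedekind's eta function *)

(** A logarithm of eta given by a series, so that no branch has to be chosen. *)
Definition leta (tau : C) : C := (twopii / 24 * tau + PS Lc (exp2ipi tau))%C.

Lemma Cprod_Cexp (u : nat -> C) (l : nat -> C) n :
  (forall m, u (S m) = Cexp (l m)) -> Cprod u n = Cexp (csum l n).
Proof.
  intros H. induction n as [|n IH]; simpl; [now rewrite Cexp_0|].
  now rewrite IH, H, Cexp_plus.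
Qed.

Lemma Clim_Cexp u l : Clim u l -> Clim (fun n => Cexp (u n)) (Cexp l).
Proof.
  intros H. destruct (Cderive_continuous_bound _ _ _ (Cderive_Cexp l)) as [d [Pd K]].
  intros eps P. set (M := Cmod (Cexp l) + 1) in *.
  assert (PM : 0 < M) by (unfold M; generalize (Cmod_ge_0 (Cexp l)); lra).
  destruct (H (Rmin d (eps / M))) as [N HN].
  { apply Rmin_pos; [exact Pd|apply Rdiv_lt_0_compat; assumption]. }
  exists N. intros n Hn. specialize (HN n Hn).
  assert (h1 := Rlt_le_trans _ _ _ HN (Rmin_l _ _)).
  assert (h2 := Rlt_le_trans _ _ _ HN (Rmin_r _ _)).
  specialize (K _ h1). replace (l + (u n - l))%C with (u n) in K by ring.
  apply Rle_lt_trans with (1 := K).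
  replace eps with (M * (eps / M)) by (field; lra). apply Rmult_lt_compat_l; assumption.
Qed.

Lemma Euler_product_Clim z : Cmod z < 1 -> Clim (Cprod (fun m => 1 - z ^ m)%C) (Cexp (PS Lc z)).
Proof.
  intros Hz. destruct (PS_Lc_log z Hz) as [A E].
  apply Clim_ext with (fun n => Cexp (csum (fun m => PS lc (z ^ S m)%C) n)).
  - intros n. symmetry. apply Cprod_Cexp. intros m. symmetry. apply Cexp_PS_lc.
    apply Cmod_pow_lt_1; [lia|exact Hz].
  - rewrite E. apply Clim_Cexp, Clim_csum, A.
Qed.

Lemma eta_Cexp tau : upper tau -> eta tau = Cexp (leta tau).
Proof.
  intros U. assert (L := exp2ipi_upper_lt_1 _ U).
  unfold eta, leta. rewrite (Climit_eq _ _ (Euler_product_Clim _ L)), Cexp_plus. f_equal.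
  unfold exp2ipi, twopii. f_equal. field.
Qed.

Lemma Cderive_exp2ipi z : Cderive exp2ipi z (twopii * exp2ipi z)%C.
Proof.
  unfold exp2ipi. apply (Cderive_Cexp_comp (fun x => (2 * PI * Ci * x)%C)).
  apply Cderive_val with (2 * PI * Ci * 1)%C; [unfold twopii; ring|].
  apply Cderive_scal, Cderive_id.
Qed.

(** As rows are even in m, the index -1 - k of the folded sum is the row k + 1: every row m >= 1
    occurs twice and the row 0, equal to pi^2/3, once. *)
Lemma asum_Rw tau : upper tau -> asum (fun k => Rw (INR (S k) * tau)%C) /\
  G2 tau = (RtoC (PI * PI / 3) + 2 * (twopii * twopii) * CSeries (fun k => Rw (INR (S k) * tau)))%C.
Proof.
  intros U. destruct (G2_rows tau U) as [R E].
  assert (T0 := twopii_neq_0).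
  assert (Er : forall k, row tau (Z.of_nat (S k)) = (twopii * twopii * Rw (INR (S k) * tau))%C).
  { intros k. rewrite row_nonzero by (auto; lia). now rewrite IZR_of_nat_INR. }
  assert (Em : forall k : nat, row tau (- 1 - Z.of_nat k) = row tau (Z.of_nat (S k))).
  { intros k. rewrite <- row_opp by exact U. f_equal. lia. }
  assert (A : asum (fun k => Rw (INR (S k) * tau)%C)).
  { assert (L := exp2ipi_upper_lt_1 _ U).
    assert (B : forall k, exp2ipi (INR (S k) * tau)%C = (exp2ipi tau ^ S k)%C) by (intros; apply exp2ipi_pow).
    set (z := exp2ipi tau) in *. assert (Pz := Cmod_ge_0 z).
    apply asum_le with (fun k => / ((1 - Cmod z) * (1 - Cmod z)) * Cmod z ^ k).
    - intros k. unfold Rw. rewrite B.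
      assert (Lk : Cmod (z ^ S k)%C <= Cmod z).
      { rewrite Cmod_pow. simpl. assert (Cmod z ^ k <= 1) by (rewrite <- (pow1 k); apply pow_incr; lra). nra. }
      assert (Q : 1 - Cmod z <= Cmod (1 - z ^ S k)%C).
      { generalize (Cmod_triangle (1 - z ^ S k)%C (z ^ S k)%C).
        replace (1 - z ^ S k + z ^ S k)%C with (RtoC 1) by ring. rewrite Cmod_1. lra. }
      assert (N : (1 - z ^ S k)%C <> 0%C) by (apply Cmod_gt_0; lra).
      rewrite Cmod_div, Cmod_mult by (apply Cmult_neq_0; exact N). unfold Rdiv.
      rewrite Rmult_comm. apply Rmult_le_compat.
      + left. apply Rinv_0_lt_compat. apply Rmult_lt_0_compat; lra.
      + apply Cmod_ge_0.
      + apply Rinv_le_contravar; [apply Rmult_lt_0_compat; lra|]. apply Rmult_le_compat; lra.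
      + rewrite Cmod_pow. simpl. assert (0 <= Cmod z ^ k) by (apply pow_le; lra). nra.
    - apply ex_series_Rscal, ex_series_Rgeom.
      rewrite Rabs_pos_eq; assumption. }
  split; [exact A|].
  assert (A1 : asum (fun k => row tau (Z.of_nat (S k)))).
  { apply asum_ext with (1 := fun k => eq_sym (Er k)). apply asum_scal, A. }
  assert (A0 : asum (fun k => row tau (Z.of_nat k))) by (apply (asum_decr _ 1), A1).
  unfold G2, ZSum.
  rewrite (CSeries_ext _ (fun k => row tau (Z.of_nat k) + row tau (Z.of_nat (S k)))%C)
    by (intros k; unfold foldZ; now rewrite Em).
  rewrite CSeries_plus, (CSeries_shift _ A0) by assumption.
  simpl (Z.of_nat 0). rewrite row_zero_value, (CSeries_ext _ _ Er), CSeries_scal by exact A. ring.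
Qed.

(** The rows m <> 0 match the Lambert series of z d/dz [Lc], and the row 0 matches the exponent
    1/24: (pi^2/3)/(4 pi i) = -2 pi i/24. *)
Lemma Cderive_leta tau : upper tau -> Cderive leta tau (- G2 tau / (2 * twopii))%C.
Proof.
  intros U. assert (L := exp2ipi_upper_lt_1 _ U). assert (T0 := twopii_neq_0).
  destruct (asum_Rw tau U) as [A EG].
  apply Cderive_val with (twopii / 24 * 1 + (twopii * exp2ipi tau) * PS (dcoef Lc) (exp2ipi tau))%C.
  - rewrite <- Cmult_assoc, PS_dcoef, PS_INR_Lc by (auto using dser_Lc).
    rewrite (CSeries_ext _ (fun k => Rw (INR (S k) * tau)))
      by (intros n; unfold Rw; now rewrite exp2ipi_pow).
    rewrite EG. replace (RtoC (PI * PI / 3)) with (- (twopii * twopii) / 12)%C.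
    + field. exact T0.
    + rewrite twopii_sq, RtoC_opp, RtoC_mult, RtoC_div by lra. field.
  - apply (Cderive_plus (fun x => (twopii / 24 * x)%C) (fun x => PS Lc (exp2ipi x))).
    + apply Cderive_scal, Cderive_id.
    + apply (Cderive_comp (PS Lc) exp2ipi); [|apply Cderive_exp2ipi].
      apply Cderive_PS; [apply dser_Lc|exact L].
Qed.

Lemma upper_segment z0 z1 t : upper z0 -> upper z1 -> 0 <= t <= 1 -> upper (z0 + t * (z1 - z0))%C.
Proof.
  unfold upper. destruct z0 as [x0 y0], z1 as [x1 y1]. unfold Im; simpl. intros H0 H1 Ht.
  replace (y0 + (t * (y1 + - y0) + 0 * (x1 + - x0))) with ((1 - t) * y0 + t * y1) by ring.
  destruct (Req_dec t 0) as [->|Nt]; [lra|].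
  assert (0 < t * y1) by (apply Rmult_lt_0_compat; lra).
  assert (0 <= (1 - t) * y0) by (apply Rmult_le_pos; lra). lra.
Qed.

Lemma Ci_sq : (Ci * Ci)%C = (- (1))%C.
Proof. unfold Ci, Cmult, Copp, RtoC; simpl. f_equal; ring. Qed.

Lemma upper_Ci : upper Ci.
Proof. unfold upper, Im, Ci; simpl. lra. Qed.

(** [G2_inversion] says that tau^2 eta(tau)^4 and eta(-1/tau)^4 have the same logarithmic
    derivative; the constant is read off at tau = i. *)
Theorem eta4_inversion tau : upper tau ->
  Cexp (4 * leta (- (1) / tau))%C = (- (tau * tau) * Cexp (4 * leta tau))%C.
Proof.
  intros U. assert (T0 := twopii_neq_0). assert (Nt := upper_neq_0 _ U).
  (* For the fourth power the anomaly 2 pi i/t contributes 2/t to the logarithmic derivative, which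
     is that of t^2; a lower power such as eta itself would bring in a square root of t. *)
  set (f := fun t : C => (Cexp (4 * leta (- (1) / t) - 4 * leta t) / (t * t))%C).
  assert (E : f Ci = f tau).
  { apply Cderive_zero_const. intros s Hs.
    assert (Us := upper_segment _ _ s upper_Ci U Hs). set (t := (Ci + s * (tau - Ci))%C) in *.
    assert (N := upper_neq_0 _ Us). assert (Us' := upper_neg_inv _ Us).
    set (X := fun t : C => (4 * leta (- (1) / t) - 4 * leta t)%C).
    apply Cderive_val with ((((4 * ((/ (t * t)) * (- G2 (- (1) / t) / (2 * twopii))) - 4 * (- G2 t / (2 * twopii)))
        * Cexp (X t)) * (t * t) - Cexp (X t) * (1 * t + t * 1)) / ((t * t) * (t * t)))%C.
    - rewrite (G2_inversion t Us). unfold isq. field. auto.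
    - apply (Cderive_div (fun t => Cexp (X t)) (fun t => (t * t)%C)).
      + apply Cmult_neq_0; exact N.
      + apply Cderive_Cexp_comp. unfold X.
        apply (Cderive_minus (fun t => (4 * leta (- (1) / t))%C) (fun t => (4 * leta t)%C)).
        * apply (Cderive_scal 4 (fun t => leta (- (1) / t)%C)).
          apply (Cderive_comp leta (fun t => (- (1) / t)%C)); [apply Cderive_leta, Us'|].
          apply Cderive_val with ((- (1)) * (- / (t * t)))%C; [field; exact N|].
          apply (Cderive_scal (- (1)) Cinv). apply Cderive_inv, N.
        * apply Cderive_scal, Cderive_leta, Us.
      + apply (Cderive_mult (fun t => t) (fun t => t)); apply Cderive_id. }
  unfold f in E. rewrite Ci_sq in E.
  assert (Ni : Ci <> 0%C) by (apply upper_neq_0, upper_Ci).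
  replace (- (1) / Ci)%C with Ci in E by (rewrite <- Ci_sq; field; exact Ni).
  replace (4 * leta Ci - 4 * leta Ci)%C with (RtoC 0) in E by ring.
  rewrite Cexp_0, Cexp_minus in E.
  assert (Ne := Cexp_neq_0 (4 * leta tau)%C).
  set (a := Cexp (4 * leta (- (1) / tau))%C) in *. set (b := Cexp (4 * leta tau)%C) in *.
  replace a with (a / b / (tau * tau) * (b * (tau * tau)))%C by (field; auto).
  rewrite <- E. field.
Qed.

(** * Jacobi's quartic identity *)

Definition EP (z : C) (n : nat) : C := Cprod (fun m => 1 - z ^ m)%C n.

Lemma EP_S z n : EP z (S n) = (EP z n * (1 - z ^ S n))%C.
Proof. reflexivity. Qed.

Lemma Cpow_opp_even (z : C) n : ((- z) ^ (2 * n))%C = (z ^ (2 * n))%C.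
Proof. rewrite !Cpow_mult_r. f_equal. simpl. ring. Qed.

(** The factors of z and -z with odd m multiply to 1 - z^(2m), those with even m to (1 - z^m)^2; the
    odd ones are completed by the powers of z^4. The lengths 2N, 2N, N and N, N, 2N make the finite
    products agree exactly. *)
Lemma EP_identity z N :
  (EP z (2 * N) * EP (- z) (2 * N) * EP (z ^ 4) N = EP (z ^ 2) N * EP (z ^ 2) N * EP (z ^ 2) (2 * N))%C.
Proof.
  induction N as [|N IH]; [unfold EP; simpl; ring|].
  replace (2 * S N)%nat with (S (S (2 * N))) by lia. rewrite !EP_S.
  set (x := (z ^ S (2 * N))%C).
  assert (X1 : ((- z) ^ S (2 * N))%C = (- x)%C) by (unfold x; rewrite !Cpow_S, Cpow_opp_even; ring).
  assert (X2 : ((- z) ^ S (S (2 * N)))%C = (z * x)%C) by (unfold x; rewrite !Cpow_S, Cpow_opp_even; ring).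
  assert (X3 : (z ^ S (S (2 * N)))%C = (z * x)%C) by (unfold x; rewrite !Cpow_S; ring).
  assert (X4 : ((z ^ 2) ^ S N)%C = (z * x)%C).
  { unfold x. rewrite <- Cpow_mult_r, <- Cpow_S. f_equal. lia. }
  assert (X5 : ((z ^ 4) ^ S N)%C = (z * x * (z * x))%C).
  { rewrite <- X4, <- !Cpow_mult_r, <- Cpow_add_r. f_equal. lia. }
  assert (X6 : ((z ^ 2) ^ S (2 * N))%C = (x * x)%C).
  { unfold x. rewrite <- Cpow_mult_r, <- Cpow_add_r. f_equal. lia. }
  assert (X7 : ((z ^ 2) ^ S (S (2 * N)))%C = (z * x * (z * x))%C).
  { rewrite Cpow_S, X6. simpl. ring. }
  rewrite X1, X2, X3, X4, X5, X6, X7.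
  transitivity ((EP z (2 * N) * EP (- z) (2 * N) * EP (z ^ 4) N) *
    ((1 - x) * (1 - z * x) * (1 + x) * (1 - z * x) * (1 - z * x * (z * x))))%C; [ring|].
  rewrite IH. ring.
Qed.

Lemma Euler_product_opp z : Cmod z < 1 ->
  (Cexp (PS Lc z) * Cexp (PS Lc (- z)) * Cexp (PS Lc (z ^ 4)) =
   Cexp (PS Lc (z ^ 2)) * Cexp (PS Lc (z ^ 2)) * Cexp (PS Lc (z ^ 2)))%C.
Proof.
  intros Hz.
  assert (H1 : Cmod (- z)%C < 1) by (rewrite Cmod_opp; exact Hz).
  assert (H2 : Cmod (z ^ 2)%C < 1) by (apply Cmod_pow_lt_1; [lia|exact Hz]).
  assert (H4 : Cmod (z ^ 4)%C < 1) by (apply Cmod_pow_lt_1; [lia|exact Hz]).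
  assert (D : forall w, Cmod w < 1 -> Clim (fun N => EP w (2 * N)) (Cexp (PS Lc w))).
  { intros w Hw. apply (Clim_subseq _ _ (fun N => 2 * N)%nat (Euler_product_Clim w Hw)). intros; lia. }
  apply (Clim_unique (fun N => EP z (2 * N) * EP (- z) (2 * N) * EP (z ^ 4) N)%C).
  - repeat apply Clim_mult; auto. apply (Euler_product_Clim _ H4).
  - apply Clim_ext with (fun N => EP (z ^ 2) N * EP (z ^ 2) N * EP (z ^ 2) (2 * N))%C.
    + intros N. symmetry. apply EP_identity.
    + repeat apply Clim_mult; auto; apply (Euler_product_Clim _ H2).
Qed.

(** [e4] is eta^4 (not an Eisenstein series). *)
Definition e4 (t : C) : C := Cexp (4 * leta t)%C.

Lemma e4_neq_0 t : e4 t <> 0%C.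
Proof. apply Cexp_neq_0. Qed.

Lemma e4_inversion t : upper t -> e4 (- (1) / t)%C = (- (t * t) * e4 t)%C.
Proof. apply eta4_inversion. Qed.

(** A primitive twelfth root of unity; its square is the multiplier of eta^4 under translation by
    1. *)
Definition nu : C := Cexp (twopii / 12)%C.

Lemma nu_6 : (nu ^ 6)%C = (- (1))%C.
Proof.
  unfold nu. rewrite <- Cexp_pow, <- exp2ipi_half_integer. unfold exp2ipi, twopii. f_equal.
  replace (INR 6) with 6 by (simpl; ring). field.
Qed.

Lemma e4_translation t : e4 (t + 1)%C = (nu ^ 2 * e4 t)%C.
Proof.
  unfold e4, nu, leta. rewrite exp2ipi_plus_1, <- Cexp_pow, <- Cexp_plus. f_equal.
  replace (INR 2) with 2 by (simpl; ring). field.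
Qed.

Lemma e4_translation_2 t : e4 (2 * (t + 1))%C = (nu ^ 4 * e4 (2 * t))%C.
Proof.
  replace (2 * (t + 1))%C with (2 * t + 1 + 1)%C by ring. rewrite !e4_translation. simpl. ring.
Qed.

(** Translation by 1 moves t/2 by a half period, so its nome p becomes -p; [Euler_product_opp]
    expresses the product at -p by those at p, p^2 and p^4. *)
Lemma e4_half_translation t : upper t ->
  (e4 ((t + 1) / 2) * (e4 (t / 2) * e4 (2 * t)) = nu * (e4 t * e4 t * e4 t))%C.
Proof.
  intros U. set (p := exp2ipi (t / 2)%C).
  assert (Uh : upper (t / 2)%C).
  { unfold upper. rewrite Im_div_pos by lra. unfold upper in U. lra. }
  assert (Lp : Cmod p < 1) by (apply exp2ipi_upper_lt_1, Uh).
  assert (E1 : exp2ipi ((t + 1) / 2)%C = (- p)%C) by apply exp2ipi_halves.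
  assert (E2 : exp2ipi t = (p ^ 2)%C).
  { unfold p. rewrite <- exp2ipi_pow. f_equal. replace (INR 2) with 2 by (simpl; ring). field. }
  assert (E3 : exp2ipi (2 * t)%C = (p ^ 4)%C).
  { unfold p. rewrite <- exp2ipi_pow. f_equal. replace (INR 4) with 4 by (simpl; ring). field. }
  assert (X : forall x w, Cexp (4 * (twopii / 24 * x + w))%C = (Cexp (twopii / 6 * x) * Cexp w ^ 4)%C).
  { intros x w. rewrite <- Cexp_pow, <- Cexp_plus. f_equal. replace (INR 4) with 4 by (simpl; ring). field. }
  unfold e4, leta. rewrite !X, E1, E2, E3. fold p.
  assert (Q := Euler_product_opp p Lp).
  set (P1 := Cexp (PS Lc p)) in *. set (P2 := Cexp (PS Lc (- p))) in *.
  set (P3 := Cexp (PS Lc (p ^ 2))) in *. set (P4 := Cexp (PS Lc (p ^ 4))) in *.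
  assert (Y : (Cexp (twopii / 6 * ((t + 1) / 2)) * (Cexp (twopii / 6 * (t / 2)) * Cexp (twopii / 6 * (2 * t))))%C
    = (nu * (Cexp (twopii / 6 * t) * Cexp (twopii / 6 * t) * Cexp (twopii / 6 * t)))%C).
  { unfold nu. rewrite <- !Cexp_plus. f_equal. field. }
  transitivity (Cexp (twopii / 6 * ((t + 1) / 2)) * (Cexp (twopii / 6 * (t / 2)) * Cexp (twopii / 6 * (2 * t)))
     * (P1 * P2 * P4) ^ 4)%C; [simpl; ring|].
  rewrite Q, Y. simpl. ring.
Qed.

(** With nomes q = e^(pi i t): theta_4^4, theta_2^4 / 16 and theta_3^4 as eta quotients. *)
Definition thA (t : C) : C := (e4 (t / 2) ^ 2 / e4 t)%C.
Definition thB (t : C) : C := (e4 (2 * t) ^ 2 / e4 t)%C.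
Definition thG (t : C) : C := (e4 t ^ 5 / (e4 (t / 2) ^ 2 * e4 (2 * t) ^ 2))%C.
Definition thU (t : C) : C := (thA t + 16 * thB t - thG t)%C.

Lemma upper_half t : upper t -> upper (t / 2)%C.
Proof. intros U. unfold upper in *. rewrite Im_div_pos by lra. lra. Qed.

Lemma upper_double t : upper t -> upper (2 * t)%C.
Proof. intros U. apply upper_scal; [lra|exact U]. Qed.

(** The inversion exchanges [thA] with 16 [thB], the 16 coming from the factor (2 t)^2 of e4 at 2t,
    squared, and fixes [thG], each up to the factor -t^2. *)
Lemma thU_inversion t : upper t -> thU (- (1) / t)%C = (- (t * t) * thU t)%C.
Proof.
  intros U. assert (Nt := upper_neq_0 _ U). unfold thU, thA, thB, thG.
  replace (- (1) / t / 2)%C with (- (1) / (2 * t))%C by (field; exact Nt).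
  replace (2 * (- (1) / t))%C with (- (1) / (t / 2))%C by (field; exact Nt).
  rewrite !e4_inversion by auto using upper_half, upper_double.
  assert (N1 := e4_neq_0 t). assert (N2 := e4_neq_0 (t / 2)%C). assert (N3 := e4_neq_0 (2 * t)%C).
  field. auto.
Qed.

(** The translation exchanges [thA] with [thG] and negates [thB], as nu^6 = -1. *)
Lemma thU_translation t : upper t -> thU (t + 1)%C = (- thU t)%C.
Proof.
  intros U. unfold thU, thA, thB, thG.
  rewrite e4_translation, e4_translation_2.
  assert (H := e4_half_translation t U). assert (H6 := nu_6).
  assert (N1 := e4_neq_0 t). assert (N2 := e4_neq_0 (t / 2)%C). assert (N3 := e4_neq_0 (2 * t)%C).
  assert (N0 : nu <> 0%C) by apply Cexp_neq_0.
  assert (E : e4 ((t + 1) / 2)%C = (nu * (e4 t * e4 t * e4 t) / (e4 (t / 2) * e4 (2 * t)))%C).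
  { rewrite <- H. field. auto. }
  rewrite E.
  set (A := e4 (t / 2)%C) in *. set (B := e4 t) in *. set (D := e4 (2 * t)%C) in *.
  transitivity (B ^ 5 / (A ^ 2 * D ^ 2) + 16 * (nu ^ 6 * (D ^ 2 / B)) - A ^ 2 / B)%C.
  - field. auto.
  - rewrite H6. field. auto.
Qed.

Definition Lcomb (c1 c2 c4 : C) (n : nat) : C := (c1 * Lc n + (c2 * dil 2 Lc n + c4 * dil 4 Lc n))%C.

Lemma dser_Lcomb c1 c2 c4 : dser (Lcomb c1 c2 c4).
Proof.
  assert (D := dser_Lc). unfold Lcomb.
  assert (D2 : dser (dil 2 Lc)) by (apply dser_dil; [lia|exact D]).
  assert (D4 : dser (dil 4 Lc)) by (apply dser_dil; [lia|exact D]).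
  apply dser_plus; [apply dser_scal, D|].
  apply dser_plus; apply dser_scal; assumption.
Qed.

Lemma PS_Lcomb c1 c2 c4 z : Cmod z < 1 ->
  PS (Lcomb c1 c2 c4) z = (c1 * PS Lc z + c2 * PS Lc (z ^ 2) + c4 * PS Lc (z ^ 4))%C.
Proof.
  intros Hz. assert (D := dser_Lc).
  assert (D2 : dser (dil 2 Lc)) by (apply dser_dil; auto; lia).
  assert (D4 : dser (dil 4 Lc)) by (apply dser_dil; auto; lia).
  unfold Lcomb. rewrite PS_plus, PS_plus, !PS_scal by auto using dser_plus, dser_scal.
  rewrite !PS_dil by (auto; lia). ring.
Qed.

(** The product over n of (1 - z^n)^c1 (1 - z^(2n))^c2 (1 - z^(4n))^c4: an eta quotient stripped of
    its leading power. *)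
Definition ecomb (c1 c2 c4 : C) : nat -> C := expcoef (Lcomb c1 c2 c4).

Lemma dser_ecomb c1 c2 c4 : dser (ecomb c1 c2 c4).
Proof. apply expcoef_spec, dser_Lcomb. Qed.

Lemma PS_ecomb c1 c2 c4 z : Cmod z < 1 ->
  PS (ecomb c1 c2 c4) z = Cexp (c1 * PS Lc z + c2 * PS Lc (z ^ 2) + c4 * PS Lc (z ^ 4))%C.
Proof.
  intros Hz. unfold ecomb. rewrite (proj2 (expcoef_spec _ (dser_Lcomb c1 c2 c4))) by exact Hz.
  now rewrite PS_Lcomb.
Qed.

Lemma Lc_0 : Lc 0%nat = 0%C.
Proof.
  unfold Lc, lamw. rewrite (CSeries_ext _ (fun _ => 0%C)); [apply CSeries_zero|].
  intros n. unfold dil. rewrite Nat.Div0.mod_0_l, Nat.Div0.div_0_l. simpl. ring.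
Qed.

Lemma ecomb_0 c1 c2 c4 : ecomb c1 c2 c4 0%nat = 1%C.
Proof.
  rewrite <- PS_0, PS_ecomb by (rewrite Cmod_0; lra).
  replace (0 ^ 2)%C with (RtoC 0) by (simpl; ring). replace (0 ^ 4)%C with (RtoC 0) by (simpl; ring).
  rewrite PS_0, Lc_0, <- Cexp_0. f_equal. ring.
Qed.

Lemma e4_series t (p : C) : upper t -> p = exp2ipi (t / 2)%C ->
  e4 (t / 2)%C = Cexp (twopii / 12 * t + 4 * PS Lc p)%C /\
  e4 t = Cexp (twopii / 6 * t + 4 * PS Lc (p ^ 2))%C /\
  e4 (2 * t)%C = Cexp (twopii / 3 * t + 4 * PS Lc (p ^ 4))%C.
Proof.
  intros U ->.
  assert (E2 : exp2ipi t = (exp2ipi (t / 2) ^ 2)%C).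
  { rewrite <- exp2ipi_pow. f_equal. replace (INR 2) with 2 by (simpl; ring). field. }
  assert (E4 : exp2ipi (2 * t)%C = (exp2ipi (t / 2) ^ 4)%C).
  { rewrite <- exp2ipi_pow. f_equal. replace (INR 4) with 4 by (simpl; ring). field. }
  unfold e4, leta. rewrite <- E2, <- E4.
  split; [|split]; f_equal; field.
Qed.

Lemma thABG_series t (p : C) : upper t -> p = exp2ipi (t / 2)%C ->
  thA t = Cexp (8 * PS Lc p + -4 * PS Lc (p ^ 2) + 0 * PS Lc (p ^ 4))%C /\
  thB t = (p * Cexp (0 * PS Lc p + -4 * PS Lc (p ^ 2) + 8 * PS Lc (p ^ 4)))%C /\
  thG t = Cexp (-8 * PS Lc p + 20 * PS Lc (p ^ 2) + -8 * PS Lc (p ^ 4))%C.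
Proof.
  intros U Ep. destruct (e4_series t p U Ep) as [E1 [E2 E3]].
  assert (Ep' : p = Cexp (twopii * (t / 2))%C) by exact Ep.
  unfold thA, thB, thG. rewrite E1, E2, E3, <- !Cexp_pow, <- Cexp_plus, <- !Cexp_minus.
  set (l1 := PS Lc p). set (l2 := PS Lc (p ^ 2)%C). set (l4 := PS Lc (p ^ 4)%C).
  rewrite Ep', <- Cexp_plus.
  replace (INR 2) with 2 by (simpl; ring). replace (INR 5) with 5 by (simpl; ring).
  split; [|split]; f_equal; field.
Qed.

Definition Useries (n : nat) : C := (ecomb 8 (-4) 0 n + (16 * shift 1 (ecomb 0 (-4) 8) n - ecomb (-8) 20 (-8) n))%C.

Lemma dser_Useries : dser Useries.
Proof.
  apply dser_plus; [apply dser_ecomb|]. apply dser_minus; [|apply dser_ecomb].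
  apply dser_scal, dser_shift, dser_ecomb.
Qed.

Lemma thU_series t : upper t -> thU t = PS Useries (exp2ipi (t / 2)%C).
Proof.
  intros U. set (p := exp2ipi (t / 2)%C).
  assert (Lp : Cmod p < 1) by (apply exp2ipi_upper_lt_1, upper_half, U).
  unfold Useries. rewrite PS_plus, PS_minus, PS_scal, PS_shift, !PS_ecomb
    by auto using dser_ecomb, dser_minus, dser_scal, dser_shift.
  destruct (thABG_series t p U eq_refl) as [E1 [E2 E3]].
  unfold thU. rewrite E1, E2, E3. simpl (p ^ 1)%C. ring.
Qed.

(** V = thU / eta^12 has weight -4 and trivial character on SL2(Z), and is holomorphic at infinity. *)
Definition Vseries : nat -> C := conv (fun n => Useries (1 + n)%nat) (ecomb 0 (-12) 0).

Lemma dser_Vseries : dser Vseries.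
Proof. apply dser_conv; [apply (dser_unshift 1), dser_Useries|apply dser_ecomb]. Qed.

Lemma thV_series t : upper t -> (thU t / e4 t ^ 3)%C = PS Vseries (exp2ipi (t / 2)%C).
Proof.
  intros U. set (p := exp2ipi (t / 2)%C).
  assert (Lp : Cmod p < 1) by (apply exp2ipi_upper_lt_1, upper_half, U).
  assert (Np : p <> 0%C) by apply exp2ipi_neq_0.
  unfold Vseries.
  rewrite (PS_conv _ _ _ (dser_unshift 1 _ dser_Useries) (dser_ecomb 0 (-12) 0) Lp), PS_ecomb by exact Lp.
  rewrite thU_series by exact U. fold p.
  rewrite (PS_unshift 1 Useries p dser_Useries Lp).
  (* [thA] and [thG] both begin with 1 and [thB] has no constant term. This single zero suffices,
     because eta^12 is p times a series without zeros. *)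
  2:{ intros n L. replace n with 0%nat by lia. unfold Useries.
      rewrite !ecomb_0, shift_small by lia. ring. }
  destruct (e4_series t p U eq_refl) as [_ [E2 _]]. rewrite E2.
  rewrite <- Cexp_pow. replace (INR 3) with 3 by (simpl; ring).
  replace (3 * (twopii / 6 * t + 4 * PS Lc (p ^ 2)))%C with (twopii * (t / 2) + 12 * PS Lc (p ^ 2))%C by field.
  rewrite Cexp_plus. replace (Cexp (twopii * (t / 2))%C) with p by reflexivity.
  replace (0 * PS Lc p + -12 * PS Lc (p ^ 2) + 0 * PS Lc (p ^ 4))%C with (- (12 * PS Lc (p ^ 2)))%C by ring.
  rewrite Cexp_opp. simpl (p ^ 1)%C. field. split; [apply Cexp_neq_0|exact Np].
Qed.

Lemma PS_bounded a r : dser a -> 0 <= r < 1 -> exists M, 0 <= M /\ forall z, Cmod z <= r -> Cmod (PS a z) <= M.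
Proof.
  intros H Hr. assert (Mr : Cmod (RtoC r) = r) by (rewrite Cmod_R, Rabs_pos_eq; lra).
  assert (A : asum (fun n => a n * r ^ n)%C) by (apply H; lra).
  exists (Series (fun n => Cmod (a n * r ^ n)%C)). split.
  - apply Series_pos; [intros; apply Cmod_ge_0|exact A].
  - intros z Hz. apply Cmod_CSeries_le; [|exact A]. intros n. rewrite !Cmod_mult, !Cmod_pow, Mr.
    apply Rmult_le_compat_l; [apply Cmod_ge_0|]. apply pow_incr. split; [apply Cmod_ge_0|exact Hz].
Qed.

(** For Im t >= 1/2 the parameter stays in the closed disc of radius e^(-pi/h), where an absolutely
    convergent series is bounded. *)
Lemma PS_bounded_at_infinity a h : 0 < h -> dser a -> exists M, 0 <= M /\
  forall t, / 2 <= Im t -> Cmod (PS a (exp2ipi (t / h)%C)) <= M.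
Proof.
  intros Ph H. assert (PP := PI_RGT_0).
  assert (Q : 0 < PI / h) by (apply Rdiv_lt_0_compat; lra).
  destruct (PS_bounded a (exp (- (PI / h))) H) as [M [PM HM]].
  { split; [left; apply exp_pos|]. rewrite <- exp_0. apply exp_increasing. lra. }
  exists M. split; [exact PM|]. intros t Ht. apply HM. rewrite Cmod_exp2ipi, Im_div_pos by exact Ph.
  assert (L : PI / h <= 2 * PI * (Im t / h)).
  { replace (2 * PI * (Im t / h)) with (PI / h * (2 * Im t)) by (field; lra).
    rewrite <- (Rmult_1_r (PI / h)) at 1. apply Rmult_le_compat_l; lra. }
  destruct (Req_dec (2 * PI * (Im t / h)) (PI / h)) as [->|N]; [lra|].
  left. apply exp_increasing. lra.
Qed.

Theorem Jacobi_quartic t : upper t -> (thA t + 16 * thB t)%C = thG t.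
Proof.
  set (V := fun t => (thU t / e4 t ^ 3)%C).
  destruct (PS_bounded_at_infinity Vseries 2 ltac:(lra) dser_Vseries) as [M [PM HM]].
  assert (HV : forall t, upper t -> V t = PS Vseries (exp2ipi (t / 2)%C)) by apply thV_series.
  assert (VT : forall t, upper t -> V (t + 1)%C = V t).
  { intros s Us. unfold V. rewrite thU_translation, e4_translation by exact Us.
    assert (N1 := e4_neq_0 s). assert (N0 : nu <> 0%C) by apply Cexp_neq_0.
    transitivity (- thU s / (nu ^ 6 * e4 s ^ 3))%C; [field; auto|]. rewrite nu_6. field. auto. }
  assert (VS : forall t, upper t -> V t = (t ^ 4 * V (- (1) / t))%C).
  { intros s Us. assert (Ns := upper_neq_0 _ Us). unfold V.
    rewrite thU_inversion, e4_inversion by exact Us. assert (N1 := e4_neq_0 s). field. auto. }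
  (* Weight -4, hence l = 2. The signs of [thU] and of eta^12 have cancelled, so the family consists
     of V alone. *)
  assert (G : forall s, upper s -> Cmod (V s) <= M * (2 * Im s) ^ 2).
  { intros s Us. apply (negative_weight_growth (fun W => W = V) 2 M PM); [..|reflexivity|exact Us].
    - intros W w -> Hw. rewrite HV by (unfold upper; lra). apply HM, Hw.
    - intros W e -> He. exists V. split; [reflexivity|]. intros w Uw. f_equal. destruct He as [->| ->].
      + symmetry. apply VT, Uw.
      + rewrite <- (VT (w + (-1)%R)%C) by now apply upper_plus_R. f_equal.
        replace (RtoC (-1)) with (- (1))%C by (apply injective_projections; simpl; ring). ring.
    - intros W ->. exists V. split; [reflexivity|]. intros w Uw. rewrite (VS w Uw) at 1.
      rewrite Cmod_mult, Cmod_pow. reflexivity. }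
  assert (Z := small_growth_zero V Vseries 2 1 M ltac:(lra) PM dser_Vseries HV G).
  intros U. assert (E : V t = 0%C).
  { rewrite HV by exact U. unfold PS. rewrite (CSeries_ext _ (fun _ => 0%C)); [apply CSeries_zero|].
    intros n. rewrite Z. ring. }
  assert (E' : thU t = 0%C).
  { replace (thU t) with (V t * e4 t ^ 3)%C by (unfold V; field; apply e4_neq_0). rewrite E. ring. }
  unfold thU in E'. replace (thA t + 16 * thB t)%C with (thA t + 16 * thB t - thG t + thG t)%C by ring.
  rewrite E'. ring.
Qed.

Lemma eta_pow tau n : upper tau -> (eta tau ^ (4 * n))%C = (e4 tau ^ n)%C.
Proof.
  intros U. rewrite eta_Cexp, Cpow_mult_r by exact U. unfold e4. f_equal.
  rewrite <- Cexp_pow. f_equal. f_equal. simpl. f_equal. ring.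
Qed.

(** [E24_0] and [E24_1] at tau are [thA] and [thB] at 2 tau, so the bracket becomes [thG] at 2 tau;
    its denominator cancels the factors at tau and 4 tau and leaves eta(2 tau) to the power 20 -
    8. *)
Theorem F64_1_eta tau : upper tau -> F64_1 tau = (e4 (2 * tau) ^ 3)%C.
Proof.
  intros U. assert (U2 := upper_double _ U).
  assert (U4 : upper (4 * tau)%C) by (apply upper_scal; [lra|exact U]).
  assert (J := Jacobi_quartic _ U2). unfold thA, thB, thG in J.
  replace (2 * tau / 2)%C with tau in J by field. replace (2 * (2 * tau))%C with (4 * tau)%C in J by ring.
  unfold F64_1, E24_1, E24_0, Delta4.
  change 8%nat with (4 * 2)%nat. change 4%nat with (4 * 1)%nat.
  rewrite !eta_pow by assumption.
  assert (N1 := e4_neq_0 tau). assert (N2 := e4_neq_0 (2 * tau)%C). assert (N3 := e4_neq_0 (4 * tau)%C).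
  replace (e4 (2 * tau) ^ 1)%C with (e4 (2 * tau)) by (simpl; ring).
  rewrite J. field. auto.
Qed.

(** * The modular group *)

Definition smul (g h : SL2Z) : SL2Z.
Proof.
  refine (mkSL2Z (ma g * ma h + mb g * mc h) (ma g * mb h + mb g * md h)
    (mc g * ma h + md g * mc h) (mc g * mb h + md g * md h) _).
  transitivity ((ma g * md g - mb g * mc g) * (ma h * md h - mb h * mc h))%Z; [ring|].
  now rewrite !SL2Z_det.
Defined.

Lemma denominator_neq_0 (a b c d : Z) (tau : C) : (a * d - b * c = 1)%Z -> upper tau ->
  (IZR c * tau + IZR d)%C <> 0%C.
Proof.
  intros D U E. unfold upper in U.
  assert (Ei : Im (IZR c * tau + IZR d)%C = 0) by (rewrite E; reflexivity).
  rewrite Im_plus_R, Im_scal in Ei. apply Rmult_integral in Ei. destruct Ei as [Ei|Ei]; [|lra].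
  apply eq_IZR_R0 in Ei. subst c.
  assert (Er : Re (IZR 0 * tau + IZR d)%C = 0) by (rewrite E; reflexivity).
  unfold Re in Er; simpl in Er. assert (Ed : IZR d = 0) by lra. apply eq_IZR_R0 in Ed. subst d. lia.
Qed.

Lemma autfactor_neq_0 g tau : upper tau -> autfactor g tau <> 0%C.
Proof. intros U. apply (denominator_neq_0 (ma g) (mb g)); [apply SL2Z_det|exact U]. Qed.

Lemma Im_div (n m : C) : m <> 0%C -> Im (n / m)%C = (Im n * Re m - Re n * Im m) / Cmod m ^ 2.
Proof.
  intros N. assert (P : 0 < Cmod m ^ 2) by (apply pow_lt, Cmod_gt_0, N).
  rewrite Cmod2_alt in *. destruct n as [n1 n2], m as [m1 m2]. unfold Re, Im in *; simpl in *.
  unfold Cdiv, Cinv, Cmult; simpl. field. lra.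
Qed.

Lemma Im_fractional_linear (a b c d : Z) (tau : C) : (a * d - b * c = 1)%Z -> upper tau ->
  Im ((IZR a * tau + IZR b) / (IZR c * tau + IZR d))%C = Im tau / Cmod (IZR c * tau + IZR d)%C ^ 2.
Proof.
  intros D U. assert (N := denominator_neq_0 a b c d tau D U).
  rewrite Im_div by exact N. f_equal.
  assert (D' : IZR a * IZR d - IZR b * IZR c = 1) by (rewrite <- !mult_IZR, <- minus_IZR, D; reflexivity).
  transitivity ((IZR a * IZR d - IZR b * IZR c) * Im tau); [|rewrite D'; ring].
  destruct tau as [x y]. unfold Re, Im; simpl. ring.
Qed.

Lemma upper_fractional_linear (a b c d : Z) (tau : C) : (a * d - b * c = 1)%Z -> upper tau ->
  upper ((IZR a * tau + IZR b) / (IZR c * tau + IZR d))%C.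
Proof.
  intros D U. unfold upper. rewrite Im_fractional_linear by assumption.
  apply Rdiv_lt_0_compat; [exact U|]. apply pow_lt, Cmod_gt_0, (denominator_neq_0 a b); assumption.
Qed.

Lemma upper_mobius g tau : upper tau -> upper (mobius g tau).
Proof. intros U. apply upper_fractional_linear; [apply SL2Z_det|exact U]. Qed.

Lemma autfactor_smul g h tau : upper tau ->
  autfactor (smul g h) tau = (autfactor g (mobius h tau) * autfactor h tau)%C.
Proof.
  intros U. assert (N := autfactor_neq_0 h tau U). unfold autfactor, mobius in *. simpl.
  rewrite !plus_IZR, !mult_IZR, !RtoC_plus, !RtoC_mult. field. exact N.
Qed.

Lemma mobius_smul g h tau : upper tau -> mobius (smul g h) tau = mobius g (mobius h tau).
Proof.
  intros U. assert (N := autfactor_neq_0 h tau U).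
  assert (N' := autfactor_neq_0 g _ (upper_mobius h tau U)).
  assert (N2 := autfactor_neq_0 (smul g h) tau U).
  unfold autfactor, mobius in *. simpl in *.
  rewrite !plus_IZR, !mult_IZR, !RtoC_plus, !RtoC_mult in *. field.
  repeat split; try assumption.
  intros Z. apply N2. rewrite <- Z. ring.
Qed.

Lemma slash_smul w f g h tau : upper tau ->
  slash w f (smul g h) tau = slash w (slash w f g) h tau.
Proof.
  intros U. unfold slash. rewrite mobius_smul, autfactor_smul, Cpow_mult_l by exact U.
  assert (N := autfactor_neq_0 h tau U). assert (N' := autfactor_neq_0 g _ (upper_mobius h tau U)).
  field. split; apply Cpow_nz; assumption.
Qed.

(** Elements of [SL2Z] carry determinant proofs, so identities between matrices are used entry by
    entry. *)
Lemma slash_entries w f g h tau : ma g = ma h -> mb g = mb h -> mc g = mc h -> md g = md h ->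
  slash w f g tau = slash w f h tau.
Proof. intros E1 E2 E3 E4. unfold slash, mobius, autfactor. now rewrite E1, E2, E3, E4. Qed.

Lemma slash_ext w f f' g tau : eq_upper f f' -> upper tau -> slash w f g tau = slash w f' g tau.
Proof. intros E U. unfold slash. rewrite E; [reflexivity|]. now apply upper_mobius. Qed.

Section SL2Z_induction.

Variable P : Z -> Z -> Z -> Z -> Prop.
Hypothesis P_up : forall a b c d, (a * d - b * c = 1)%Z -> P (a + c) (b + d) c d -> P a b c d.
Hypothesis P_down : forall a b c d, (a * d - b * c = 1)%Z -> P (a - c) (b - d) c d -> P a b c d.
Hypothesis P_inv : forall a b c d, (a * d - b * c = 1)%Z -> P (- c) (- d) a b -> P a b c d.
Hypothesis P_one : P 1 0 0 1.

Lemma SL2Z_shift k a b c d : (a * d - b * c = 1)%Z -> P (a + k * c) (b + k * d) c d -> P a b c d.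
Proof.
  assert (HN : forall n a b c d, (a * d - b * c = 1)%Z ->
    P (a + Z.of_nat n * c) (b + Z.of_nat n * d) c d -> P a b c d).
  { induction n as [|n IH]; intros a' b' c' d' D H.
    - replace (a' + Z.of_nat 0 * c')%Z with a' in H by (simpl; ring).
      replace (b' + Z.of_nat 0 * d')%Z with b' in H by (simpl; ring). exact H.
    - apply P_up; [exact D|]. apply IH; [lia|].
      replace (a' + c' + Z.of_nat n * c')%Z with (a' + Z.of_nat (S n) * c')%Z by lia.
      replace (b' + d' + Z.of_nat n * d')%Z with (b' + Z.of_nat (S n) * d')%Z by lia. exact H. }
  assert (HM : forall n a b c d, (a * d - b * c = 1)%Z ->
    P (a - Z.of_nat n * c) (b - Z.of_nat n * d) c d -> P a b c d).
  { induction n as [|n IH]; intros a' b' c' d' D H.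
    - replace (a' - Z.of_nat 0 * c')%Z with a' in H by (simpl; ring).
      replace (b' - Z.of_nat 0 * d')%Z with b' in H by (simpl; ring). exact H.
    - apply P_down; [exact D|]. apply IH; [lia|].
      replace (a' - c' - Z.of_nat n * c')%Z with (a' - Z.of_nat (S n) * c')%Z by lia.
      replace (b' - d' - Z.of_nat n * d')%Z with (b' - Z.of_nat (S n) * d')%Z by lia. exact H. }
  intros D H. destruct (Z_le_gt_dec 0 k) as [L|L].
  - apply (HN (Z.to_nat k)); [exact D|]. now rewrite Z2Nat.id.
  - apply (HM (Z.to_nat (- k))); [exact D|]. rewrite Z2Nat.id by lia.
    replace (a - - k * c)%Z with (a + k * c)%Z by ring. now replace (b - - k * d)%Z with (b + k * d)%Z by ring.
Qed.

(** The Euclidean algorithm on the first column: translations replace a by its remainder modulo c,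
    the inversion moves that remainder into the place of c, and |c| drops. For c = 0 a translation
    up to sign remains, and two inversions produce the sign. *)
Lemma SL2Z_ind a b c d : (a * d - b * c = 1)%Z -> P a b c d.
Proof.
  assert (H : forall n a b c d, (Z.abs c <= Z.of_nat n)%Z -> (a * d - b * c = 1)%Z -> P a b c d).
  { clear a b c d. induction n as [|n IH]; intros a b c d L D.
    - assert (c = 0)%Z by lia. subst c.
      assert (E : (a * d = 1)%Z) by lia.
      destruct (Z.eq_mul_1 a d E) as [Ea|Ea]; subst a.
      + assert (d = 1)%Z by lia. subst d.
        apply (SL2Z_shift (- b)); [lia|].
        replace (1 + - b * 0)%Z with 1%Z by ring. replace (b + - b * 1)%Z with 0%Z by ring. exact P_one.
      + assert (d = -1)%Z by lia. subst d.
        apply (SL2Z_shift b); [lia|].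
        replace (- (1) + b * 0)%Z with (-1)%Z by ring. replace (b + b * -1)%Z with 0%Z by ring.
        apply P_inv; [reflexivity|]. simpl. apply P_inv; [reflexivity|]. exact P_one.
    - destruct (Z.eq_dec c 0) as [->|Nc]; [apply IH; lia|].
      apply (SL2Z_shift (- (a / c))); [exact D|].
      assert (Ea := Z_div_mod_eq_full a c).
      replace (a + - (a / c) * c)%Z with (a mod c)%Z by lia.
      assert (Lr : (Z.abs (a mod c) < Z.abs c)%Z).
      { destruct (Z_lt_le_dec 0 c) as [Pc|Pc].
        - assert (B := Z.mod_pos_bound a c Pc). lia.
        - assert (B := Z.mod_neg_bound a c ltac:(lia)). lia. }
      set (r := (a mod c)%Z) in *. set (k := (a / c)%Z) in *.
      assert (D' : (r * d - (b + - k * d) * c = 1)%Z) by (replace r with (a - c * k)%Z by lia; lia).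
      apply P_inv; [exact D'|]. apply IH; lia. }
  intros D. apply (H (Z.to_nat (Z.abs c))); [lia|exact D].
Qed.

End SL2Z_induction.

(** The sign of a matrix modulo 2, as a permutation of the three nonzero vectors of F_2^2. *)
Definition sign2 (a b c d : Z) : C :=
  if (Z.odd (a + d) || (Z.even b && Z.even c))%bool then 1%C else (- (1))%C.

Lemma sign2_cases a b c d : (a * d - b * c = 1)%Z ->
  sign2 (a + c) (b + d) c d = (- sign2 a b c d)%C /\
  sign2 (a - c) (b - d) c d = (- sign2 a b c d)%C /\
  sign2 (- c) (- d) a b = (- sign2 a b c d)%C.
Proof.
  (* The determinant leaves six of the sixteen parity classes, the elements of SL2(F_2); the
     translations and the inversion are transpositions there. *)
  intros D. assert (O : Z.odd (a * d - b * c) = true) by now rewrite D.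
  rewrite Z.odd_sub, !Z.odd_mul in O.
  unfold sign2. rewrite <- !Z.negb_odd, ?Z.odd_add, ?Z.odd_sub, ?Z.odd_opp, ?Z.odd_add.
  assert (M1 : (- - (1))%C = 1%C) by ring.
  destruct (Z.odd a), (Z.odd b), (Z.odd c), (Z.odd d); simpl in *; try discriminate;
    rewrite ?M1; auto.
Qed.

Lemma e4_cube_translation t : (e4 (t + 1) ^ 3 = - e4 t ^ 3)%C.
Proof.
  rewrite e4_translation. transitivity (nu ^ 6 * e4 t ^ 3)%C; [simpl; ring|]. rewrite nu_6. ring.
Qed.

(** Under translation eta^12 changes sign because nu^6 = -1, and under inversion it acquires
    (-tau^2)^3 = -tau^6. The multiplier thus takes the value -1 on each generator, as [sign2]
    does. *)
Lemma e4_cube_modular (a b c d : Z) : (a * d - b * c = 1)%Z -> forall tau, upper tau ->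
  (e4 ((IZR a * tau + IZR b) / (IZR c * tau + IZR d)) ^ 3 =
   sign2 a b c d * (IZR c * tau + IZR d) ^ 6 * e4 tau ^ 3)%C.
Proof.
  revert a b c d.
  refine (SL2Z_ind (fun a b c d => forall tau, upper tau ->
   (e4 ((IZR a * tau + IZR b) / (IZR c * tau + IZR d)) ^ 3 =
   sign2 a b c d * (IZR c * tau + IZR d) ^ 6 * e4 tau ^ 3)%C) _ _ _ _).
  - intros a b c d D H tau U. specialize (H tau U).
    assert (N := denominator_neq_0 a b c d tau D U).
    rewrite (proj1 (sign2_cases a b c d D)) in H.
    replace ((IZR (a + c) * tau + IZR (b + d)) / (IZR c * tau + IZR d))%C
      with ((IZR a * tau + IZR b) / (IZR c * tau + IZR d) + 1)%C in H
      by (rewrite !plus_IZR, !RtoC_plus; field; exact N).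
    rewrite e4_cube_translation in H.
    set (x := (e4 _ ^ 3)%C) in *. replace x with (- - x)%C by ring. rewrite H. ring.
  - intros a b c d D H tau U. specialize (H tau U).
    assert (N := denominator_neq_0 a b c d tau D U).
    rewrite (proj1 (proj2 (sign2_cases a b c d D))) in H.
    replace ((IZR a * tau + IZR b) / (IZR c * tau + IZR d))%C
      with ((IZR (a - c) * tau + IZR (b - d)) / (IZR c * tau + IZR d) + 1)%C
      by (rewrite !minus_IZR, !RtoC_minus; field; exact N).
    rewrite e4_cube_translation, H. ring.
  - intros a b c d D H tau U. specialize (H tau U).
    assert (N := denominator_neq_0 a b c d tau D U).
    assert (N' := denominator_neq_0 (- c) (- d) a b tau ltac:(lia) U).
    assert (Ug := upper_fractional_linear a b c d tau D U).
    rewrite (proj2 (proj2 (sign2_cases a b c d D))) in H.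
    replace ((IZR (- c) * tau + IZR (- d)) / (IZR a * tau + IZR b))%C
      with (- (1) / ((IZR a * tau + IZR b) / (IZR c * tau + IZR d)))%C in H
      by (rewrite !opp_IZR, !RtoC_opp; field; auto).
    rewrite e4_inversion in H by exact Ug.
    set (x := e4 ((IZR a * tau + IZR b) / (IZR c * tau + IZR d))%C) in *.
    set (n := (IZR a * tau + IZR b)%C) in *. set (m := (IZR c * tau + IZR d)%C) in *.
    transitivity (- ((m / n) ^ 6 * (- (n / m * (n / m)) * x) ^ 3))%C; [field; auto|].
    rewrite H. field. auto.
  - intros tau U. unfold sign2. simpl.
    replace ((1 * tau + 0) / (0 * tau + 1))%C with tau by field. ring.
Qed.

(** * The cusps of Gamma0(4) *)

(** Conjugation by tau |-> 2 tau turns a matrix of Gamma0(4) into one with entries a, 2b, c/2, d. As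
    4 divides c, this is the identity modulo 2, so its sign is 1. *)
Lemma F64_1_weakly_modular : weakly_modular 4 6 F64_1.
Proof.
  intros g [k Hk] tau U. assert (Ug := upper_mobius g tau U).
  assert (N := autfactor_neq_0 g tau U).
  unfold slash. rewrite !F64_1_eta by assumption.
  assert (D : (ma g * md g - (2 * mb g) * (2 * k) = 1)%Z).
  { transitivity (ma g * md g - mb g * mc g)%Z; [rewrite Hk; ring|apply SL2Z_det]. }
  assert (Q := e4_cube_modular (ma g) (2 * mb g) (2 * k) (md g) D (2 * tau)%C (upper_double _ U)).
  unfold mobius, autfactor in *. rewrite Hk in *.
  assert (Es : sign2 (ma g) (2 * mb g) (2 * k) (md g) = 1%C).
  { unfold sign2. rewrite !Z.even_mul. simpl. now rewrite Bool.orb_true_r. }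
  rewrite Es in Q.
  rewrite !mult_IZR, !RtoC_mult in *.
  replace (2 * IZR k * (2 * tau) + IZR (md g))%C with (IZR k * IZR 4 * tau + IZR (md g))%C in Q by ring.
  replace (2 * ((IZR (ma g) * tau + IZR (mb g)) / (IZR k * IZR 4 * tau + IZR (md g))))%C
    with ((IZR (ma g) * (2 * tau) + 2 * IZR (mb g)) / (IZR k * IZR 4 * tau + IZR (md g)))%C
    by (field; exact N).
  rewrite Q. field. exact N.
Qed.

(** The matrices [rI], [rS] and [rR] send infinity to infinity, 0 and -1/2; the last is a translate
    of 1/2. *)
Definition rI : SL2Z := mkSL2Z 1 0 0 1 eq_refl.
Definition rS : SL2Z := mkSL2Z 0 (-1) 1 0 eq_refl.
Definition rR : SL2Z := mkSL2Z 1 0 (-2) 1 eq_refl.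

Definition Tpow (k : Z) : SL2Z := mkSL2Z 1 k 0 1 (f_equal (Z.sub 1) (Z.mul_0_r k)).

Lemma slash_Tpow w f k tau : slash w f (Tpow k) tau = f (tau + IZR k)%C.
Proof.
  unfold slash, mobius, autfactor; simpl.
  replace ((1 * tau + IZR k) / (0 * tau + 1))%C with (tau + IZR k)%C by field.
  replace (0 * tau + 1)%C with (RtoC 1) by ring. rewrite Cpow_1_l. field.
Qed.

Lemma slash_rI w f tau : slash w f rI tau = f tau.
Proof.
  transitivity (slash w f (Tpow 0) tau); [now apply slash_entries|].
  rewrite slash_Tpow. f_equal. ring.
Qed.

(** Representatives of the three cusps of Gamma0(4): infinity, 0 and 1/2. *)
Definition cusp_rep (r : SL2Z) : Prop := r = rI \/ r = rS \/ r = rR.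

Lemma slash_coset w f gam r j g tau : weakly_modular 4 w f -> Gamma0 4 gam -> upper tau ->
  ma g = ma (smul gam (smul r (Tpow j))) -> mb g = mb (smul gam (smul r (Tpow j))) ->
  mc g = mc (smul gam (smul r (Tpow j))) -> md g = md (smul gam (smul r (Tpow j))) ->
  slash w f g tau = slash w f r (tau + IZR j)%C.
Proof.
  intros W Hg U E1 E2 E3 E4.
  rewrite (slash_entries w f g _ tau E1 E2 E3 E4), slash_smul by exact U.
  rewrite (slash_ext w _ f) by (auto; exact (W gam Hg)).
  rewrite slash_smul by exact U. apply slash_Tpow.
Qed.

(** The cusp depends only on c modulo 4: c odd gives 0, c = 2 modulo 4 gives 1/2, and c divisible by
    4 gives infinity. The decomposition does not depend on the form, so a form and F can be reduced
    with the same r and j. *)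
Lemma coset_decomposition g : exists r j, cusp_rep r /\
  forall w f tau, weakly_modular 4 w f -> upper tau ->
  slash w f g tau = slash w f r (tau + IZR j)%C.
Proof.
  assert (D := SL2Z_det g). set (a := ma g) in *. set (b := mb g) in *. set (c := mc g) in *. set (d := md g) in *.
  destruct (Z.odd c) eqn:Oc.
  (* The lower left entry of the Gamma0(4) factor is -(d - j c) = -d (1 - c^2), divisible by 4 since
     c is odd. *)
  - set (j := (c * d)%Z).
    assert (Dg : ((b - j * a) * - c - - a * (d - j * c) = 1)%Z) by lia.
    exists rS, j. split; [right; left; reflexivity|]. intros w f tau W U.
    assert (Dg' : ((- (b - j * a)) * c - a * (- (d - j * c)) = 1)%Z) by lia.
    apply (slash_coset w f (mkSL2Z (- (b - j * a)) a (- (d - j * c)) c Dg')); auto;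
      [|cbn [ma mb mc md smul Tpow rS rR rI]; unfold a, b, c, d; ring..].
    unfold Gamma0; cbn [mc]. unfold j.
    assert (Hc : exists m, c = (2 * m + 1)%Z) by (apply Zodd_ex, Zodd_bool_iff; exact Oc).
    destruct Hc as [m Hm]. exists (d * (m * m + m))%Z. rewrite Hm. ring.
  - assert (Hc : exists m, c = (2 * m)%Z).
    { apply Zeven_ex, Zeven_bool_iff. rewrite <- Z.negb_odd, Oc. reflexivity. }
    destruct Hc as [m Hm].
    destruct (Z.odd m) eqn:Om.
    + assert (Hm' : exists k, m = (2 * k + 1)%Z) by (apply Zodd_ex, Zodd_bool_iff; exact Om).
      destruct Hm' as [k Hk].
      assert (Hd : exists l, d = (2 * l + 1)%Z).
      { apply Zodd_ex, Zodd_bool_iff. assert (O : Z.odd (a * d - b * c) = true) by now rewrite D.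
        rewrite Z.odd_sub, !Z.odd_mul, Oc, Bool.andb_false_r, Bool.xorb_false_r in O.
        apply Bool.andb_true_iff in O. apply O. }
      destruct Hd as [l Hl].
      (* Here c/2 and d are both odd, so c + 2 d is divisible by 4. *)
      exists rR, 0%Z. split; [right; right; reflexivity|]. intros w f tau W U.
      assert (Dg : ((a + 2 * b) * d - b * (c + 2 * d) = 1)%Z) by lia.
      apply (slash_coset w f (mkSL2Z (a + 2 * b) b (c + 2 * d) d Dg)); auto;
        [|cbn [ma mb mc md smul Tpow rS rR rI]; unfold a, b, c, d; ring..].
      unfold Gamma0; cbn [mc]. exists (k + l + 1)%Z. rewrite Hm, Hk, Hl. ring.
    + assert (Hm' : exists k, m = (2 * k)%Z).
      { apply Zeven_ex, Zeven_bool_iff. rewrite <- Z.negb_odd, Om. reflexivity. }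
      destruct Hm' as [k Hk].
      exists rI, 0%Z. split; [left; reflexivity|]. intros w f tau W U.
      apply (slash_coset w f g); auto; [|cbn [ma mb mc md smul Tpow rS rR rI]; unfold a, b, c, d; ring..].
      exists k. fold c. rewrite Hm, Hk. ring.
Qed.

Lemma slash_rI_periodic w f tau : weakly_modular 4 w f -> upper tau ->
  slash w f rI (tau + 1)%C = slash w f rI tau.
Proof.
  intros W U. rewrite !slash_rI. rewrite <- (slash_Tpow w f 1). apply W; [|exact U].
  unfold Gamma0; simpl. apply Z.divide_0_r.
Qed.

(** The cusp 1/2 has width 1 like infinity: [rR] times the unit translation equals [gam] times
    [rR]. *)
Lemma slash_rR_periodic w f tau : weakly_modular 4 w f -> upper tau ->
  slash w f rR (tau + 1)%C = slash w f rR tau.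
Proof.
  intros W U. rewrite <- (slash_Tpow w (slash w f rR) 1), <- slash_smul by exact U.
  set (gam := mkSL2Z 3 1 (-4) (-1) eq_refl).
  assert (Hg : Gamma0 4 gam) by (exists (-1)%Z; reflexivity).
  rewrite (slash_entries w f _ (smul gam rR)) by reflexivity.
  rewrite slash_smul by exact U. apply slash_ext; [exact (W gam Hg)|exact U].
Qed.

(** A common parameter for all cusps, matching the expansions in tau/4 of the definition of modular
    forms. At a cusp of width 1 the true local parameter is its fourth power. *)
Definition q4 (tau : C) : C := exp2ipi (tau / 4)%C.

Lemma upper_quarter tau : upper tau -> upper (tau / 4)%C.
Proof. intros U. unfold upper in *. rewrite Im_div_pos by lra. lra. Qed.

Lemma q4_lt_1 tau : upper tau -> Cmod (q4 tau) < 1.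
Proof. intros U. apply exp2ipi_upper_lt_1, upper_quarter, U. Qed.

Definition i4 (j : Z) : C := exp2ipi (IZR j / 4)%C.

Lemma q4_shift tau j : q4 (tau + IZR j)%C = (i4 j * q4 tau)%C.
Proof. unfold q4, i4. rewrite <- exp2ipi_plus. f_equal. field. Qed.

Lemma Cmod_i4 j : Cmod (i4 j) = 1.
Proof.
  unfold i4. rewrite Cmod_exp2ipi, Im_div_pos by lra. unfold Im; simpl.
  replace (- (2 * PI * (0 / 4))) with 0 by field. apply exp_0.
Qed.

Lemma q4_pow tau n : (q4 tau ^ n)%C = exp2ipi (INR n * (tau / 4))%C.
Proof. unfold q4. now rewrite exp2ipi_pow. Qed.

Lemma q4_onto (z : C) : z <> 0%C -> Cmod z < 1 -> exists tau, upper tau /\ q4 tau = z.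
Proof. intros N L. apply (exp2ipi_onto z 4); [lra|exact N|exact L]. Qed.

Lemma i4_small n : (0 < n < 4)%nat -> (i4 1 ^ n)%C <> 1%C.
Proof.
  intros Hn. unfold i4. rewrite <- exp2ipi_pow.
  replace (INR n * (1 / 4))%C with (RtoC (INR n / 4)) by (rewrite RtoC_div by lra; field).
  apply exp2ipi_real_neq_1.
  assert (1 <= INR n) by (apply (le_INR 1); lia).
  assert (INR n <= 3) by (replace 3 with (INR 3) by (simpl; ring); apply le_INR; lia). lra.
Qed.

(** tau |-> tau + 1 multiplies [q4] by i, so period 1 forces a_n i^n = a_n and kills every a_n with
    n not divisible by 4. A cusp form therefore has order at least 4 in [q4] at a cusp of width
    1. *)
Lemma periodic_coeffs (f : C -> C) a : dser a ->
  (forall tau, upper tau -> f tau = PS a (q4 tau)) ->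
  (forall tau, upper tau -> f (tau + 1)%C = f tau) -> a 0%nat = 0%C ->
  forall n, (n < 4)%nat -> a n = 0%C.
Proof.
  intros D E P a0 n Hn. destruct n as [|n]; [exact a0|].
  assert (M := Cmod_i4 1).
  assert (Dt : dser (fun n => a n * i4 1 ^ n)%C) by (apply dser_twist; [lra|exact D]).
  assert (Q : (a (S n) * i4 1 ^ S n)%C = a (S n)).
  { apply (PS_inj _ _ Dt D). intros z Nz Lz. destruct (q4_onto z Nz Lz) as [tau [U Ez]].
    rewrite PS_twist, <- Ez, <- q4_shift, <- !E by (auto using upper_plus_R). apply P, U. }
  assert (N := i4_small (S n) ltac:(lia)).
  assert (Z : (a (S n) * (i4 1 ^ S n - 1))%C = 0%C).
  { replace (a (S n) * (i4 1 ^ S n - 1))%C with (a (S n) * i4 1 ^ S n - a (S n))%C by ring. rewrite Q. ring. }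
  apply Cmult_integral in Z. destruct Z as [Z|Z]; [exact Z|].
  exfalso. revert Z. apply Cminus_neq_0, N.
Qed.

Lemma e4_cube_series t : upper t -> (e4 t ^ 3)%C = (exp2ipi (t / 2) * Cexp (12 * PS Lc (exp2ipi t)))%C.
Proof.
  intros U. unfold e4, leta. rewrite <- Cexp_pow. replace (INR 3) with 3 by (simpl; ring).
  unfold exp2ipi at 2. rewrite <- Cexp_plus. f_equal. unfold twopii. field.
Qed.

(** The product over n of (1 - z^(k n))^c. It is used with c = 12 for F and with c = -12 for its
    inverse. *)
Definition euler12 (k : nat) (c : C) : nat -> C := dil k (ecomb c 0 0).

Lemma dser_euler12 k c : (0 < k)%nat -> dser (euler12 k c).
Proof. intros P. apply dser_dil; [exact P|apply dser_ecomb]. Qed.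

Lemma PS_euler12 k c z : (0 < k)%nat -> Cmod z < 1 -> PS (euler12 k c) z = Cexp (c * PS Lc (z ^ k))%C.
Proof.
  intros P L. unfold euler12. rewrite (PS_dil k _ z P (dser_ecomb c 0 0) L).
  rewrite PS_ecomb by (apply Cmod_pow_lt_1; assumption). f_equal. ring.
Qed.

Lemma euler12_0 k c : euler12 k c 0%nat = 1%C.
Proof. unfold euler12, dil. rewrite Nat.Div0.mod_0_l, Nat.Div0.div_0_l. apply ecomb_0. Qed.

Lemma F64_1_infinity tau : upper tau ->
  F64_1 tau = (q4 tau ^ 4 * PS (euler12 8 12) (q4 tau))%C.
Proof.
  intros U. rewrite F64_1_eta, e4_cube_series by auto using upper_double.
  rewrite PS_euler12 by (try lia; apply q4_lt_1, U). rewrite !q4_pow.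
  f_equal.
  - f_equal. replace (INR 4) with 4 by (simpl; ring). field.
  - do 4 f_equal. replace (INR 8) with 8 by (simpl; ring). field.
Qed.

(** 2 (-1/tau) = -1/(tau/2), so the inversion formula gives -(tau/2)^6 and hence the constant -1/64.
    The form left over is eta^12 at tau/2, of order exactly 1 in [q4]. *)
Lemma F64_1_slash_rS tau : upper tau ->
  slash 6 F64_1 rS tau = (- / 64 * (q4 tau * PS (euler12 2 12) (q4 tau)))%C.
Proof.
  intros U. assert (Nt := upper_neq_0 _ U). assert (Uh := upper_half _ U).
  unfold slash. rewrite F64_1_eta by now apply upper_mobius.
  unfold mobius, autfactor; simpl.
  replace (2 * ((0 * tau + -1) / (1 * tau + 0)))%C with (- (1) / (tau / 2))%C.
  2:{ replace (RtoC (-1)) with (- (1))%C by (apply injective_projections; simpl; ring). field. exact Nt. }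
  rewrite e4_inversion by exact Uh.
  assert (E := e4_cube_series _ Uh).
  rewrite PS_euler12 by (try lia; apply q4_lt_1, U). rewrite q4_pow.
  replace (INR 2 * (tau / 4))%C with (tau / 2)%C by (replace (INR 2) with 2 by (simpl; ring); field).
  unfold q4. replace (tau / 4)%C with (tau / 2 / 2)%C by field.
  rewrite <- E. field. exact Nt.
Qed.

Lemma F64_1_slash_rR tau : upper tau -> slash 6 F64_1 rR tau = (- F64_1 tau)%C.
Proof.
  intros U. assert (N := autfactor_neq_0 rR tau U).
  unfold slash. rewrite !F64_1_eta by (try exact U; now apply upper_mobius).
  assert (Q := e4_cube_modular 1 0 (-1) 1 eq_refl (2 * tau)%C (upper_double _ U)).
  unfold mobius, autfactor in *. cbn [ma mb mc md rR] in N |- *.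
  replace (sign2 1 0 (-1) 1) with (- (1))%C in Q by reflexivity.
  assert (Em1 : RtoC (-1) = (- (1))%C) by (apply injective_projections; simpl; ring).
  assert (Em2 : RtoC (-2) = (- (2))%C) by (apply injective_projections; simpl; ring).
  rewrite Em1 in Q. rewrite Em2 in *.
  replace (- (1) * (2 * tau) + 1)%C with (- (2) * tau + 1)%C in Q by ring.
  replace (2 * ((1 * tau + 0) / (- (2) * tau + 1)))%C with ((1 * (2 * tau) + 0) / (- (2) * tau + 1))%C by (field; intros Z; apply N; rewrite <- Z; ring).
  rewrite Q. field. intros Z. apply N. rewrite <- Z. ring.
Qed.

(** Dividing by F: F has no zero on the upper half-plane and, at each cusp, the smallest order of
    vanishing that a cusp form can have. *)
Lemma division_at_reps w f r : weakly_modular 4 w f -> cusp_rep r ->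
  (forall g, exists a, fourier_expansion 4 (slash w f g) a /\ a 0%nat = 0%C) ->
  exists b, dser b /\ forall tau, upper tau ->
    slash w f r tau = (PS b (q4 tau) * slash 6 F64_1 r tau)%C.
Proof.
  intros W Hr Hc. destruct (Hc r) as [a [Ha a0]].
  apply fourier_expansion_dser in Ha. destruct Ha as [Da Ea].
  change (forall tau, upper tau -> slash w f r tau = PS a (q4 tau)) in Ea.
  assert (D8 : dser (conv (fun n => a (4 + n)%nat) (euler12 8 (-12))))
    by (apply dser_conv; [apply (dser_unshift 4 a Da)|apply dser_euler12; lia]).
  (* Common to the two cusps of width 1, where F is the same up to sign: four powers of [q4] are
     removed and the Euler product is inverted. *)
  assert (X : (forall tau, upper tau -> slash w f r (tau + 1)%C = slash w f r tau) ->
    forall tau, upper tau ->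
    slash w f r tau = (PS (conv (fun n => a (4 + n)%nat) (euler12 8 (-12))) (q4 tau) * F64_1 tau)%C).
  { intros Per tau U. assert (L := q4_lt_1 _ U).
    rewrite Ea, F64_1_infinity by exact U.
    rewrite (PS_unshift 4 a _ Da L (periodic_coeffs _ a Da Ea Per a0)).
    rewrite (PS_conv _ _ _ (dser_unshift 4 a Da) (dser_euler12 8 (-12) ltac:(lia)) L).
    rewrite !PS_euler12 by (try lia; exact L).
    assert (E1 : (Cexp (-12 * PS Lc (q4 tau ^ 8)) * Cexp (12 * PS Lc (q4 tau ^ 8)))%C = 1%C).
    { rewrite <- Cexp_plus, <- Cexp_0. f_equal. ring. }
    set (x := Cexp (-12 * _)%C) in *. set (y := Cexp (12 * _)%C) in *.
    set (P := PS _ _). transitivity (q4 tau ^ 4 * P * (x * y))%C; [rewrite E1; ring|ring]. }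
  destruct Hr as [->|[->| ->]].
  - exists (conv (fun n => a (4 + n)%nat) (euler12 8 (-12))). split; [exact D8|].
    intros tau U. rewrite X by (auto; intros; now apply slash_rI_periodic). now rewrite slash_rI.
  (* At the cusp 0 one power of [q4] is enough; -64 inverts the leading constant of F there. *)
  - exists (conv (fun n => - (64) * a (1 + n)%nat)%C (euler12 2 (-12))).
    assert (D1 : dser (fun n => - (64) * a (1 + n)%nat)%C) by (apply dser_scal, (dser_unshift 1 a Da)).
    split; [apply dser_conv; [exact D1|apply dser_euler12; lia]|].
    intros tau U. assert (L := q4_lt_1 _ U).
    rewrite Ea, F64_1_slash_rS by exact U.
    rewrite (PS_unshift 1 a _ Da L) by (intros n Hn; replace n with 0%nat by lia; exact a0).
    rewrite (PS_conv _ _ _ D1 (dser_euler12 2 (-12) ltac:(lia)) L).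
    rewrite (PS_scal _ (fun n => a (1 + n)%nat) _ (dser_unshift 1 a Da) L).
    rewrite !PS_euler12 by (try lia; exact L).
    assert (E1 : (Cexp (-12 * PS Lc (q4 tau ^ 2)) * Cexp (12 * PS Lc (q4 tau ^ 2)))%C = 1%C).
    { rewrite <- Cexp_plus, <- Cexp_0. f_equal. ring. }
    set (x := Cexp (-12 * _)%C) in *. set (y := Cexp (12 * _)%C) in *.
    set (P := PS _ _). transitivity (q4 tau * P * (x * y))%C; [rewrite E1; simpl; ring|field].
  - exists (fun n => - (1) * conv (fun n => a (4 + n)%nat) (euler12 8 (-12)) n)%C.
    split; [apply dser_scal, D8|].
    intros tau U. rewrite X by (auto; intros; now apply slash_rR_periodic).
    rewrite PS_scal, F64_1_slash_rR by (auto; now apply q4_lt_1). ring.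
Qed.

(** * Division by F *)

Lemma fourier_expansion_4 f a :
  fourier_expansion 4 f a <-> dser a /\ forall tau, upper tau -> f tau = PS a (q4 tau).
Proof. apply fourier_expansion_dser. Qed.

Lemma F64_1_neq_0 tau : upper tau -> F64_1 tau <> 0%C.
Proof. intros U. rewrite F64_1_eta by exact U. apply Cpow_nz, e4_neq_0. Qed.

Lemma slash_F64_1_neq_0 g tau : upper tau -> slash 6 F64_1 g tau <> 0%C.
Proof.
  intros U. unfold slash. apply Cmult_neq_0; [apply F64_1_neq_0, upper_mobius, U|].
  intros E. assert (N := Cpow_nz _ 6 (autfactor_neq_0 g tau U)).
  apply C1_nz. rewrite <- (Cinv_r _ N), E. ring.
Qed.

Lemma expansion_shift (f : C -> C) a j : dser a ->
  (forall tau, upper tau -> f tau = PS a (q4 tau)) ->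
  dser (fun n => a n * i4 j ^ n)%C /\
  forall tau, upper tau -> f (tau + IZR j)%C = PS (fun n => a n * i4 j ^ n)%C (q4 tau).
Proof.
  intros D E. split; [apply dser_twist; [rewrite Cmod_i4; lra|exact D]|].
  intros tau U. rewrite PS_twist, <- q4_shift. apply E, upper_plus_R, U.
Qed.

(** The bound M does not depend on g: three representatives account for every g, and the remaining
    translation leaves Im tau unchanged. This uniformity is what [negative_weight_growth] requires
    of an SL2(Z) orbit. *)
Lemma division w f : weakly_modular 4 w f ->
  (forall g, exists a, fourier_expansion 4 (slash w f g) a /\ a 0%nat = 0%C) ->
  exists M, 0 <= M /\ forall g, exists b, dser b /\
    (forall tau, upper tau -> slash w f g tau = (PS b (q4 tau) * slash 6 F64_1 g tau)%C) /\
    (forall tau, / 2 <= Im tau -> Cmod (PS b (q4 tau)) <= M).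
Proof.
  intros W Hc.
  assert (Hrep : forall r, cusp_rep r -> exists b M, dser b /\ 0 <= M /\
    (forall tau, upper tau -> slash w f r tau = (PS b (q4 tau) * slash 6 F64_1 r tau)%C) /\
    (forall tau, / 2 <= Im tau -> Cmod (PS b (q4 tau)) <= M)).
  { intros r Hr. destruct (division_at_reps w f r W Hr Hc) as [b [D E]].
    destruct (PS_bounded_at_infinity b 4 ltac:(lra) D) as [M [PM HM]].
    exists b, M. auto. }
  destruct (Hrep rI (or_introl eq_refl)) as [bI [MI [DI [PI' [EI BI]]]]].
  destruct (Hrep rS (or_intror (or_introl eq_refl))) as [bS [MS [DS [PS' [ES BS]]]]].
  destruct (Hrep rR (or_intror (or_intror eq_refl))) as [bR [MR [DR [PR' [ER BR]]]]].
  exists (MI + MS + MR). split; [lra|]. intros g.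
  destruct (coset_decomposition g) as [r [j [Hr Hg]]].
  assert (Q : exists b, dser b /\
    (forall tau, upper tau -> slash w f r tau = (PS b (q4 tau) * slash 6 F64_1 r tau)%C) /\
    (forall tau, / 2 <= Im tau -> Cmod (PS b (q4 tau)) <= MI + MS + MR)).
  { destruct Hr as [->|[->| ->]].
    - exists bI. split; [exact DI|]. split; [exact EI|]. intros tau L. specialize (BI tau L). lra.
    - exists bS. split; [exact DS|]. split; [exact ES|]. intros tau L. specialize (BS tau L). lra.
    - exists bR. split; [exact DR|]. split; [exact ER|]. intros tau L. specialize (BR tau L). lra. }
  destruct Q as [b [D [E B]]].
  exists (fun n => b n * i4 j ^ n)%C.
  split; [apply dser_twist; [rewrite Cmod_i4; lra|exact D]|]. split.
  - intros tau U. rewrite (Hg w f tau W U), (Hg 6%nat F64_1 tau F64_1_weakly_modular U).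
    rewrite E by now apply upper_plus_R. now rewrite PS_twist, <- q4_shift.
  - intros tau L. rewrite PS_twist, <- q4_shift. apply B. now rewrite Im_plus_R.
Qed.

Lemma upper_ball tau h : upper tau -> Cmod h < Im tau -> upper (tau + h)%C.
Proof.
  intros U L. unfold upper in *. assert (B := im_le_Cmod h). apply Rabs_le_between in B.
  replace (Im (tau + h)%C) with (Im tau + Im h) by reflexivity. lra.
Qed.

Lemma Cderive_upper_ext f g tau l : eq_upper f g -> upper tau -> Cderive f tau l -> Cderive g tau l.
Proof.
  intros E U. apply (Cderive_ext_ball f g tau l (Im tau) U).
  intros h Hh. apply E, upper_ball; assumption.
Qed.

Lemma F64_1_holomorphic : holomorphic_upper F64_1.
Proof.
  intros tau U. assert (U2 := upper_double _ U).
  exists (2 * (- G2 (2 * tau) / (2 * twopii) * 12) * Cexp (12 * leta (2 * tau)))%C.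
  apply (Cderive_upper_ext (fun t => Cexp (12 * leta (2 * t)))%C); [|exact U|].
  - intros t Ut. rewrite F64_1_eta by exact Ut. unfold e4. rewrite <- Cexp_pow. f_equal.
    replace (INR 3) with 3 by (simpl; ring). ring.
  - apply (Cderive_Cexp_comp (fun t => 12 * leta (2 * t))%C).
    apply Cderive_val with (12 * ((2 * 1) * (- G2 (2 * tau) / (2 * twopii))))%C; [ring|].
    apply Cderive_scal. apply (Cderive_comp leta (fun t => (2 * t)%C)); [apply Cderive_leta, U2|].
    apply Cderive_scal, Cderive_id.
Qed.

Lemma F64_1_expansion_rep r : cusp_rep r -> exists a, dser a /\ a 0%nat = 0%C /\
  forall tau, upper tau -> slash 6 F64_1 r tau = PS a (q4 tau).
Proof.
  assert (D8 : dser (shift 4 (euler12 8 12))) by (apply dser_shift, dser_euler12; lia).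
  assert (D2 : dser (shift 1 (euler12 2 12))) by (apply dser_shift, dser_euler12; lia).
  intros [->|[->| ->]].
  - exists (shift 4 (euler12 8 12)). split; [exact D8|]. split; [apply shift_small; lia|].
    intros tau U. rewrite slash_rI, F64_1_infinity by exact U.
    rewrite PS_shift; [reflexivity|apply dser_euler12; lia|apply q4_lt_1, U].
  - exists (fun n => - / 64 * shift 1 (euler12 2 12) n)%C. split; [apply dser_scal, D2|].
    split; [rewrite shift_small by lia; ring|].
    intros tau U. rewrite F64_1_slash_rS, PS_scal by (auto; now apply q4_lt_1).
    rewrite PS_shift; [simpl; ring|apply dser_euler12; lia|apply q4_lt_1, U].
  - exists (fun n => - (1) * shift 4 (euler12 8 12) n)%C. split; [apply dser_scal, D8|].
    split; [rewrite shift_small by lia; ring|].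
    intros tau U. rewrite F64_1_slash_rR, F64_1_infinity, PS_scal by (auto; now apply q4_lt_1).
    rewrite PS_shift; [ring|apply dser_euler12; lia|apply q4_lt_1, U].
Qed.

Lemma F64_1_cusp_form : cusp_form 4 6 F64_1.
Proof.
  split; [apply F64_1_holomorphic|]. split; [apply F64_1_weakly_modular|]. intros g.
  destruct (coset_decomposition g) as [r [j [Hr Hg]]].
  destruct (F64_1_expansion_rep r Hr) as [a [D [a0 E]]].
  destruct (expansion_shift _ a j D E) as [Dj Ej].
  exists (fun n => a n * i4 j ^ n)%C. split; [|rewrite a0; ring].
  apply fourier_expansion_4. split; [exact Dj|].
  intros tau U. rewrite (Hg 6%nat F64_1 tau F64_1_weakly_modular U). apply Ej, U.
Qed.

Lemma slash_mult w1 w2 f1 f2 g tau : upper tau ->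
  slash (w1 + w2) (fun t => f1 t * f2 t)%C g tau = (slash w1 f1 g tau * slash w2 f2 g tau)%C.
Proof.
  intros U. unfold slash. rewrite Cpow_add_r. assert (N := autfactor_neq_0 g tau U).
  field. split; apply Cpow_nz, N.
Qed.

Lemma holomorphic_mult f1 f2 : holomorphic_upper f1 -> holomorphic_upper f2 ->
  holomorphic_upper (fun t => f1 t * f2 t)%C.
Proof.
  intros H1 H2 tau U. destruct (H1 tau U) as [l1 L1]. destruct (H2 tau U) as [l2 L2].
  exists (l1 * f2 tau + f1 tau * l2)%C. apply (Cderive_mult f1 f2); assumption.
Qed.

Lemma weakly_modular_mult w1 w2 f1 f2 : weakly_modular 4 w1 f1 -> weakly_modular 4 w2 f2 ->
  weakly_modular 4 (w1 + w2) (fun t => f1 t * f2 t)%C.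
Proof.
  intros H1 H2 g Hg tau U. rewrite slash_mult by exact U.
  now rewrite (H1 g Hg tau U), (H2 g Hg tau U).
Qed.

Lemma fourier_expansion_4_mult f1 f2 a1 a2 :
  fourier_expansion 4 f1 a1 -> fourier_expansion 4 f2 a2 ->
  fourier_expansion 4 (fun t => f1 t * f2 t)%C (conv a1 a2).
Proof.
  rewrite !fourier_expansion_4. intros [D1 E1] [D2 E2].
  split; [now apply dser_conv|]. intros tau U. rewrite E1, E2, PS_conv by (auto; now apply q4_lt_1).
  reflexivity.
Qed.

Lemma fourier_expansion_ext h f1 f2 a : eq_upper f1 f2 ->
  fourier_expansion h f1 a -> fourier_expansion h f2 a.
Proof. intros E H tau U. rewrite <- E by exact U. apply H, U. Qed.

Lemma conv_0 a b : conv a b 0%nat = (a 0%nat * b 0%nat)%C.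
Proof. unfold conv. simpl. ring. Qed.

Lemma cusp_form_mult w1 w2 f1 f2 : cusp_form 4 w1 f1 -> modular_form 4 w2 f2 ->
  cusp_form 4 (w1 + w2) (fun t => f1 t * f2 t)%C.
Proof.
  intros [H1 [W1 C1]] [H2 [W2 C2]].
  split; [now apply holomorphic_mult|]. split; [now apply weakly_modular_mult|].
  intros g. destruct (C1 g) as [a1 [E1 Z1]]. destruct (C2 g) as [a2 E2].
  exists (conv a1 a2). split.
  - apply fourier_expansion_ext with (2 := fourier_expansion_4_mult _ _ _ _ E1 E2).
    intros tau U. symmetry. now apply slash_mult.
  - rewrite conv_0, Z1. ring.
Qed.

(** F has no zero on the half-plane, and [division] supplies the expansion of the quotient for every
    g. This inverts the multiplication by F. *)
Lemma quotient_modular w f : cusp_form 4 (6 + w) f -> modular_form 4 w (fun t => f t / F64_1 t)%C.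
Proof.
  intros [H [W Hc]].
  assert (ES : forall g tau, upper tau -> slash w (fun t => f t / F64_1 t)%C g tau =
    (slash (6 + w) f g tau / slash 6 F64_1 g tau)%C).
  { intros g tau U. unfold slash. rewrite Cpow_add_r. assert (N := autfactor_neq_0 g tau U).
    assert (NF := F64_1_neq_0 _ (upper_mobius g tau U)).
    assert (Nw := Cpow_nz _ w N).
    field. repeat split; assumption. }
  split; [|split].
  - intros tau U. destruct (H tau U) as [l1 L1]. destruct (F64_1_holomorphic tau U) as [l2 L2].
    exists ((l1 * F64_1 tau - f tau * l2) / (F64_1 tau * F64_1 tau))%C.
    apply (Cderive_div f F64_1); [apply F64_1_neq_0, U|exact L1|exact L2].
  - intros g Hg tau U. rewrite ES, (W g Hg tau U), (F64_1_weakly_modular g Hg tau U) by exact U. reflexivity.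
  - intros g. destruct (division _ f W Hc) as [M [_ Q]]. destruct (Q g) as [b [D [E _]]].
    exists b. apply fourier_expansion_4. split; [exact D|].
    intros tau U. rewrite ES, E by exact U. field. now apply slash_F64_1_neq_0.
Qed.

(** If both series were nonzero, removing the lowest powers z^i and z^j would leave a product that
    vanishes off the origin but has constant term a_i b_j <> 0. *)
Lemma dser_integral a b : dser a -> dser b ->
  (forall z : C, z <> 0%C -> Cmod z < 1 -> (PS a z * PS b z)%C = 0%C) ->
  (forall n, a n = 0%C) \/ (forall n, b n = 0%C).
Proof.
  intros Da Db H.
  assert (Hmin : forall c : nat -> C, (forall n, c n = 0%C) \/
    exists k, c k <> 0%C /\ forall n, (n < k)%nat -> c n = 0%C).
  { intros c. assert (Q : forall k, (forall n, (n < k)%nat -> c n = 0%C) \/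
      exists k, c k <> 0%C /\ forall n, (n < k)%nat -> c n = 0%C).
    { induction k as [|k [IH|IH]]; [left; intros; lia| |right; exact IH].
      destruct (Ceq_dec (c k) 0%C) as [E|N].
      - left. intros n Hn. destruct (Nat.eq_dec n k) as [->|Nk]; [exact E|apply IH; lia].
      - right. exists k. auto. }
    (* Whether some coefficient is nonzero is decided by excluded middle. *)
    destruct (Classical_Prop.classic (exists k, c k <> 0%C /\ forall n, (n < k)%nat -> c n = 0%C)) as [E|N]; [right; exact E|].
    left. intros n. destruct (Q (S n)) as [R|R]; [apply R; lia|contradiction]. }
  destruct (Hmin a) as [Ha|[i [Ni Hi]]]; [left; exact Ha|].
  destruct (Hmin b) as [Hb|[j [Nj Hj]]]; [right; exact Hb|].
  exfalso. assert (Da' := dser_unshift i a Da). assert (Db' := dser_unshift j b Db).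
  assert (Z : conv (fun n => a (i + n)%nat) (fun n => b (j + n)%nat) 0%nat = 0%C).
  { apply PS_zero_coeffs; [now apply dser_conv|]. intros z Nz Lz.
    specialize (H z Nz Lz). rewrite (PS_unshift i a z Da Lz Hi), (PS_unshift j b z Db Lz Hj) in H.
    rewrite PS_conv by assumption.
    assert (N1 := Cpow_nz z i Nz). assert (N2 := Cpow_nz z j Nz).
    set (x := PS (fun n => a (i + n)%nat) z) in *. set (y := PS (fun n => b (j + n)%nat) z) in *.
    replace (x * y)%C with ((z ^ i * x * (z ^ j * y)) / (z ^ i * z ^ j))%C by (field; auto).
    rewrite H. field. auto. }
  rewrite conv_0, !Nat.add_0_r in Z. apply Cmult_integral in Z. tauto.
Qed.

Lemma slash_0 f g tau : slash 0 f g tau = f (mobius g tau).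
Proof. unfold slash. simpl. field. Qed.

Theorem modular_form_weight_0 h : modular_form 4 0 h -> exists c, forall tau, upper tau -> h tau = c.
Proof.
  intros [Hh [Wh Ch]].
  assert (Hrep : forall r, exists a, dser a /\ forall tau, upper tau -> slash 0 h r tau = PS a (q4 tau)).
  { intros r. destruct (Ch r) as [a E]. exists a. apply fourier_expansion_4, E. }
  destruct (Hrep rI) as [aI [DI EI]]. destruct (Hrep rS) as [aS [DS ES]]. destruct (Hrep rR) as [aR [DR ER]].
  set (cI := aI 0%nat). set (cS := aS 0%nat). set (cR := aR 0%nat).
  (* Whichever cusp g leads to, one of the three factors has constant term 0 there, so p vanishes at
     all cusps although its weight is 0. *)
  set (p := fun t => ((h t - cI) * ((h t - cS) * (h t - cR)))%C).
  assert (Wp : weakly_modular 4 0 p).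
  { intros g Hg tau U. rewrite slash_0. unfold p. rewrite <- !(slash_0 h).
    now rewrite (Wh g Hg tau U). }
  assert (Cp : forall g, exists a, fourier_expansion 4 (slash 0 p g) a /\ a 0%nat = 0%C).
  { intros g. destruct (coset_decomposition g) as [r [j [Hr Hg]]].
    assert (Q : exists a, dser a /\ (forall tau, upper tau -> slash 0 h r tau = PS a (q4 tau)) /\
      (a 0%nat = cI \/ a 0%nat = cS \/ a 0%nat = cR)).
    { destruct Hr as [->|[->| ->]]; [exists aI|exists aS|exists aR]; auto. }
    destruct Q as [a [D [E a0]]]. destruct (expansion_shift _ a j D E) as [Dj Ej].
    set (aj := fun n => (a n * i4 j ^ n)%C) in *.
    assert (aj0 : aj 0%nat = a 0%nat) by (unfold aj; simpl; ring).
    assert (Dc : forall c, dser (fun n => aj n - cst c n)%C) by (intros; apply dser_minus; [exact Dj|apply dser_cst]).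
    exists (conv (fun n => aj n - cst cI n)%C (conv (fun n => aj n - cst cS n)%C (fun n => aj n - cst cR n)%C)).
    split.
    - apply fourier_expansion_4. split; [exact (dser_conv _ _ (Dc cI) (dser_conv _ _ (Dc cS) (Dc cR)))|].
      intros tau U. assert (L := q4_lt_1 _ U).
      rewrite (PS_conv _ _ _ (Dc cI) (dser_conv _ _ (Dc cS) (Dc cR)) L), (PS_conv _ _ _ (Dc cS) (Dc cR) L).
      rewrite !(PS_minus aj (cst _) _ Dj (dser_cst _) L), !PS_cst.
      rewrite <- Ej, <- (Hg 0%nat h tau Wh U), !slash_0 by exact U. reflexivity.
    - rewrite !conv_0, aj0. simpl. destruct a0 as [->|[->| ->]]; ring. }
  destruct (division 0 p Wp Cp) as [M [PM HM]].
  (* The SL2(Z) orbit of p/F, of weight -6, hence l = 3 below. *)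
  set (F := fun V : C -> C => exists g, forall tau, upper tau -> V tau = (slash 0 p g tau / slash 6 F64_1 g tau)%C).
  set (W := fun g tau => (slash 0 p g tau / slash 6 F64_1 g tau)%C).
  destruct (HM rI) as [b [Db [Eb Bb]]].
  assert (HV : forall tau, upper tau -> W rI tau = PS b (q4 tau)).
  { intros tau U. unfold W. rewrite Eb by exact U. field. now apply slash_F64_1_neq_0. }
  assert (G : forall tau, upper tau -> Cmod (W rI tau) <= M * (2 * Im tau) ^ 3).
  { intros tau U. apply (negative_weight_growth F 3 M PM); [..|exists rI; reflexivity|exact U].
    - intros V t [g Hg] Ht. assert (Ut : upper t) by (unfold upper; lra).
      destruct (HM g) as [bg [Dg [Eg Bg]]]. rewrite Hg, Eg by exact Ut.
      replace (PS bg (q4 t) * slash 6 F64_1 g t / slash 6 F64_1 g t)%C with (PS bg (q4 t))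
        by (field; now apply slash_F64_1_neq_0). apply Bg, Ht.
    - intros V e [g Hg] He.
      assert (Hk : exists k : Z, e = IZR k) by (destruct He as [->| ->]; [exists 1%Z|exists (-1)%Z]; reflexivity).
      destruct Hk as [k ->].
      exists (W (smul g (Tpow (- k)))). split; [exists (smul g (Tpow (- k))); reflexivity|].
      intros t Ut. rewrite Hg by exact Ut. f_equal. unfold W.
      rewrite !slash_smul, !slash_Tpow by now apply upper_plus_R.
      replace (t + IZR k + IZR (- k))%C with t by (rewrite opp_IZR, RtoC_opp; ring). reflexivity.
    - intros V [g Hg].
      (* The inverse of t |-> -1/t, so that the slash by g S' at -1/t returns to the slash by g at
         t. *)
      set (S' := mkSL2Z 0 1 (-1) 0 eq_refl).
      exists (W (smul g S')). split; [exists (smul g S'); reflexivity|].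
      intros t Ut. rewrite Hg by exact Ut. assert (Nt := upper_neq_0 _ Ut). assert (Ut' := upper_neg_inv _ Ut).
      rewrite <- Cmod_pow, <- Cmod_mult. f_equal. unfold W. rewrite !slash_smul by exact Ut'.
      assert (Em1 : RtoC (-1) = (- (1))%C) by (apply injective_projections; simpl; ring).
      assert (Em : mobius S' (- (1) / t)%C = t).
      { unfold mobius, S'. cbn [ma mb mc md]. rewrite Em1. field. exact Nt. }
      assert (Ea : autfactor S' (- (1) / t)%C = (/ t)%C).
      { unfold autfactor, S'. cbn [ma mb mc md]. rewrite Em1. field. exact Nt. }
      unfold slash at 3 5. rewrite Em, Ea.
      assert (NF := slash_F64_1_neq_0 g t Ut).
      rewrite Cpow_inv by exact Nt. simpl (2 * 3)%nat. simpl ((/ t) ^ 0)%C.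
      set (x := slash 0 p g t). set (y := slash 6 F64_1 g t) in *. field. auto. }
  assert (Z := small_growth_zero (W rI) b 4 2 M ltac:(lra) PM Db HV G).
  assert (P0 : forall tau, upper tau -> p tau = 0%C).
  { intros tau U. rewrite <- (slash_rI 0 p tau), Eb by exact U.
    unfold PS. rewrite (CSeries_ext _ (fun _ => 0%C)) by (intros; rewrite Z; ring).
    rewrite CSeries_zero. ring. }
  assert (EI' : forall tau, upper tau -> h tau = PS aI (q4 tau)) by (intros tau U; now rewrite <- EI, slash_rI).
  assert (Dc : forall c, dser (fun n => aI n - cst c n)%C) by (intros; apply dser_minus; [exact DI|apply dser_cst]).
  assert (Fin : forall c, (forall n, (aI n - cst c n)%C = 0%C) -> exists c, forall tau, upper tau -> h tau = c).
  { intros c Hc. exists c. intros tau U. rewrite EI' by exact U.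
    rewrite <- (PS_cst c (q4 tau)). apply PS_ext. intros n.
    replace (aI n) with (aI n - cst c n + cst c n)%C by ring. rewrite Hc. ring. }
  (* Since p = 0, one of the three series h - c vanishes identically, and h is that constant. *)
  destruct (dser_integral _ _ (Dc cI) (dser_conv _ _ (Dc cS) (Dc cR))) as [H1|H1].
  - intros z Nz Lz. destruct (q4_onto z Nz Lz) as [tau [U <-]].
    assert (L := q4_lt_1 _ U).
    rewrite (PS_conv _ _ _ (Dc cS) (Dc cR) L), !(PS_minus aI (cst _) _ DI (dser_cst _) L), !PS_cst.
    rewrite <- EI' by exact U. apply P0, U.
  - apply (Fin cI H1).
  - destruct (dser_integral _ _ (Dc cS) (Dc cR)) as [H2|H2].
    + intros z Nz Lz. rewrite <- PS_conv by auto. unfold PS.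
      rewrite (CSeries_ext _ (fun _ => 0%C)) by (intros; rewrite H1; ring). apply CSeries_zero.
    + apply (Fin cS H2).
    + apply (Fin cR H2).
Qed.

(** * Bases *)

Lemma exp2ipi_1 tau : exp2ipi (tau / IZR 1)%C = exp2ipi tau.
Proof. f_equal. field. Qed.

Lemma fourier_expansion_1 f a :
  fourier_expansion 1 f a <-> dser a /\ forall tau, upper tau -> f tau = PS a (exp2ipi tau).
Proof.
  rewrite fourier_expansion_dser. split; intros [D E]; split; auto; intros tau U.
  - rewrite E, exp2ipi_1 by exact U. reflexivity.
  - rewrite exp2ipi_1. apply E, U.
Qed.

Lemma fourier_expansion_1_unique f a b : fourier_expansion 1 f a -> fourier_expansion 1 f b ->
  forall n, a n = b n.
Proof.
  rewrite !fourier_expansion_1. intros [Da Ea] [Db Eb]. apply PS_inj; auto.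
  intros z Nz Lz. destruct (exp2ipi_onto z 1 Rlt_0_1 Nz Lz) as [tau [U E]].
  replace (tau / 1)%C with tau in E by field. rewrite <- E, <- Ea, <- Eb by exact U. reflexivity.
Qed.

Lemma leading_term_unique f v w c d : leading_term f v c -> leading_term f w d -> v = w /\ c = d.
Proof.
  intros [a [Ea [Za [Ca Na]]]] [b [Eb [Zb [Cb Nb]]]].
  assert (E := fourier_expansion_1_unique f a b Ea Eb).
  destruct (Nat.lt_trichotomy v w) as [L|[->|L]].
  - exfalso. apply Na. rewrite <- Ca, E. apply Zb, L.
  - split; [reflexivity|]. now rewrite <- Ca, <- Cb, E.
  - exfalso. apply Nb. rewrite <- Cb, <- E. apply Za, L.
Qed.

Lemma F64_1_q_expansion tau : upper tau ->
  F64_1 tau = (exp2ipi tau * PS (euler12 2 12) (exp2ipi tau))%C.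
Proof.
  intros U. rewrite F64_1_eta, e4_cube_series by auto using upper_double.
  rewrite PS_euler12 by (try lia; apply exp2ipi_upper_lt_1, U). rewrite <- exp2ipi_pow.
  f_equal.
  - f_equal. field.
Qed.

(** F = q times a series with constant term 1, so multiplication by F raises every valuation by
    exactly one and keeps the leading coefficient. *)
Lemma F64_1_mult_leading f v c : leading_term f v c -> leading_term (fun t => F64_1 t * f t)%C (S v) c.
Proof.
  intros [a [Ea [Za [Ca Na]]]]. apply fourier_expansion_1 in Ea. destruct Ea as [Da Ea].
  assert (De := dser_euler12 2 12 ltac:(lia)).
  assert (Dv := dser_unshift v a Da).
  assert (Dc := dser_conv _ _ De Dv).
  exists (shift (S v) (conv (euler12 2 12) (fun n => a (v + n)%nat))). split; [|split; [|split]].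
  - apply fourier_expansion_1. split; [apply dser_shift, Dc|]. intros tau U.
    assert (L := exp2ipi_upper_lt_1 _ U).
    rewrite F64_1_q_expansion, Ea, (PS_unshift v a _ Da L Za) by exact U.
    rewrite (PS_shift _ _ _ Dc L), (PS_conv _ _ _ De Dv L), Cpow_S. ring.
  - intros n Hn. now apply shift_small.
  - assert (Q := shift_add (S v) (conv (euler12 2 12) (fun n => a (v + n)%nat)) 0).
    rewrite Nat.add_0_r in Q. rewrite Q, conv_0, euler12_0, Nat.add_0_r, Ca. ring.
  - exact Na.
Qed.

Lemma leading_term_1 : leading_term (fun _ => 1%C) 0 1%C.
Proof.
  exists (cst 1%C). split; [|split; [intros; lia|split; [reflexivity|exact C1_nz]]].
  apply fourier_expansion_1. split; [apply dser_cst|]. intros tau _. now rewrite PS_cst.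
Qed.

Lemma leading_term_ext f g v c : eq_upper f g -> leading_term f v c -> leading_term g v c.
Proof.
  intros E [a [Ea R]]. exists a. split; [|exact R]. apply fourier_expansion_ext with (1 := E), Ea.
Qed.

Lemma F64_1_leading : leading_term F64_1 1 1%C.
Proof.
  apply leading_term_ext with (2 := F64_1_mult_leading _ _ _ leading_term_1).
  intros tau _. ring.
Qed.

Lemma leading_term_scal f v (c x : C) : x <> 0%C -> leading_term f v c ->
  leading_term (fun t => x * f t)%C v (x * c)%C.
Proof.
  intros Nx [a [Ea [Za [Ca Na]]]]. apply fourier_expansion_1 in Ea. destruct Ea as [Da Ea].
  exists (fun n => x * a n)%C. split; [|split; [|split]].
  - apply fourier_expansion_1. split; [apply dser_scal, Da|]. intros tau U.
    rewrite PS_scal, Ea by (auto; now apply exp2ipi_upper_lt_1). reflexivity.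
  - intros n Hn. rewrite Za by exact Hn. ring.
  - now rewrite Ca.
  - now apply Cmult_neq_0.
Qed.

Lemma leading_term_nonzero f v c : leading_term f v c -> ~ eq_upper f (fun _ => 0%C).
Proof.
  intros [a [Ea [Za [Ca Na]]]] Z. apply Na. rewrite <- Ca.
  assert (E0 : fourier_expansion 1 f (cst 0%C)).
  { apply fourier_expansion_1. split; [apply dser_cst|]. intros tau U. rewrite PS_cst. apply Z, U. }
  rewrite (fourier_expansion_1_unique _ _ _ Ea E0). destruct v; reflexivity.
Qed.

Lemma cusp_form_6_multiple f : cusp_form 4 6 f -> exists c, eq_upper f (fun t => c * F64_1 t)%C.
Proof.
  intros H. destruct (modular_form_weight_0 _ (quotient_modular 0 f H)) as [c Hc].
  exists c. intros tau U. rewrite <- (Hc tau U). field. now apply F64_1_neq_0.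
Qed.

Lemma lincomb_mul_family F c B tau :
  lincomb c (mul_family F B) tau = (F tau * lincomb c B tau)%C.
Proof.
  revert B. induction c as [|x c IH]; intros B; simpl; [ring|].
  destruct B as [|b B]; simpl; [ring|]. rewrite IH. ring.
Qed.

Lemma basis_S6 : is_basis (cusp_form 4 6) [F64_1].
Proof.
  split; [|split].
  - repeat constructor; apply F64_1_cusp_form.
  - intros c Lc Z. destruct c as [|x [|y c]]; try discriminate Lc.
    constructor; [|constructor]. specialize (Z Ci upper_Ci). simpl in Z.
    assert (Z' : (x * F64_1 Ci)%C = 0%C) by (rewrite <- Z; ring).
    apply Cmult_integral in Z'. destruct Z' as [Z'|Z']; [exact Z'|].
    exfalso. revert Z'. apply F64_1_neq_0, upper_Ci.
  - intros f Hf. destruct (cusp_form_6_multiple f Hf) as [c Hc]. exists [c]. split; [reflexivity|].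
    intros tau U. rewrite Hc by exact U. simpl. ring.
Qed.

Lemma mul_family_basis k B : (3 <= k)%nat -> is_basis (modular_form 4 (2 * k - 6)) B ->
  is_basis (cusp_form 4 (2 * k)) (mul_family F64_1 B).
Proof.
  intros Hk [H1 [H2 H3]].
  (* For k >= 3 the truncated subtraction is exact, and the weight takes the form 6 + w. *)
  assert (Ek : (2 * k = 6 + (2 * k - 6))%nat) by lia. rewrite Ek. set (w := (2 * k - 6)%nat) in *. clearbody w.
  split; [|split].
  - unfold mul_family. apply Forall_map. apply Forall_impl with (2 := H1). intros f Hf.
    apply (cusp_form_mult 6 w F64_1 f F64_1_cusp_form Hf).
  - intros c Lc Z. unfold mul_family in Lc. rewrite length_map in Lc. apply (H2 c Lc).
    intros tau U. specialize (Z tau U). rewrite lincomb_mul_family in Z.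
    apply Cmult_integral in Z. destruct Z as [Z|Z]; [|exact Z].
    exfalso. revert Z. apply F64_1_neq_0, U.
  - intros f Hf. destruct (H3 _ (quotient_modular w f Hf)) as [c [Lc E]].
    exists c. split; [unfold mul_family; now rewrite length_map|].
    intros tau U. rewrite lincomb_mul_family, <- E by exact U. field. now apply F64_1_neq_0.
Qed.

Lemma mul_family_triangular B : unitary_upper_triangular B ->
  unitary_upper_triangular (mul_family F64_1 B).
Proof.
  intros [H1 H2]. split.
  - unfold mul_family. apply Forall_map. apply Forall_impl with (2 := H1).
    intros f [v Hv]. exists (S v). now apply F64_1_mult_leading.
  (* All valuations are raised by the same amount, so their strict order survives; uniqueness of
     leading terms is needed because the ordering is asked for every valuation. *)
  - assert (Hv : forall f, unitary f -> exists v, valuation f v /\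
      forall v', valuation (fun t => F64_1 t * f t)%C v' -> v' = S v).
    { intros f [v Hv]. exists v. split; [now exists 1%C|].
      intros v' [c Hc]. apply (leading_term_unique _ _ _ _ _ Hc (F64_1_mult_leading _ _ _ Hv)). }
    revert H1 H2. unfold mul_family. induction B as [|f B IH]; intros H1 H2; simpl; [constructor|].
    inversion H1 as [|? ? Uf UB]; subst. inversion H2 as [|? ? Of OB]; subst.
    constructor; [|now apply IH].
    apply Forall_map. rewrite Forall_forall in *. intros g Hg v w Vv Vw.
    destruct (Hv f Uf) as [vf [Vf Ef]]. destruct (Hv g (UB g Hg)) as [vg [Vg Eg]].
    rewrite (Ef v Vv), (Eg w Vw). specialize (Of g Hg vf vg Vf Vg). lia.
Qed.

Theorem mainTheorem8 :
  has_dimension (cusp_form 4 6) 1 /\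
  is_unitary_generator (cusp_form 4 6) F64_1 /\
  (forall G : C -> C,
     is_unitary_generator (cusp_form 4 6) G -> eq_upper G F64_1) /\
  (forall (k : nat) (B : list (C -> C)),
     (3 <= k)%nat ->
     is_basis (modular_form 4 (2 * k - 6)) B ->
     unitary_upper_triangular B ->
     is_basis (cusp_form 4 (2 * k)) (mul_family F64_1 B) /\
     unitary_upper_triangular (mul_family F64_1 B)).
Proof.
  split; [|split; [|split]].
  - exists [F64_1]. split; [reflexivity|exact basis_S6].
  - split; [exact basis_S6|]. exists 1%nat. exact F64_1_leading.
  - intros G [[HG _] [v Hv]]. inversion HG as [|? ? CG _]; subst.
    destruct (cusp_form_6_multiple G CG) as [c Hc].
    (* G has a leading term, so c is not 0; comparing the leading coefficients of G and of c F then
       gives c = 1. *)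
    destruct (Ceq_dec c 0%C) as [->|Nc].
    + exfalso. apply (leading_term_nonzero G v 1%C Hv). intros tau U. rewrite Hc by exact U. ring.
    + assert (Lt := leading_term_ext _ _ _ _ Hc Hv).
      destruct (leading_term_unique _ _ _ _ _ Lt (leading_term_scal _ _ _ c Nc F64_1_leading)) as [_ E].
      intros tau U. rewrite Hc by exact U. replace c with (RtoC 1) by (rewrite E; ring). ring.
  - intros k B Hk HB HT. split; [now apply mul_family_basis|now apply mul_family_triangular].
Qed.
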